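(* Let $\mathsf{G}$ be a finite simple graph, and let $\mathcal{A}_{\mathsf{G}}$ be the associated graphic arrangement with Orlik-Solomon algebra $A$. Then $\mathcal{A}_{\mathsf{G}}$ is supersolvable if and only if $A$ is a Koszul algebra; in fact, $\mathcal{A}_{\mathsf{G}}$ is supersolvable if and only if $A$ is quadratic.
   Context: $\Bbbk$ is a field of characteristic $0$. For a simple graph $\mathsf{G}$ on vertices $1,\dots,\ell$ with edge set $\mathsf{E}$, the graphic arrangement is $\mathcal{A}_{\mathsf{G}}=\{z_i-z_j=0\mid (i,j)\in\mathsf{E}\}$ in $\mathbb{C}^\ell$. For a finite central arrangement $\{H_1,\dots,H_n\}$, let $E$ be the exterior algebra over $\Bbbk$ on degree-one generators $e_1,\dots,e_n$, with derivation $\partial$ given by $\partial(e_i)=1$ and the graded Leibniz rule, and $e_J=e_{i_1}\wedge\cdots\wedge e_{i_r}$ for $J=\{i_1<\dots<i_r\}$. The Orlik-Solomon ideal $I\subset E$ is generated by all $\partial e_J$ with $\operatorname{codim}\bigcap_{i\in J}H_i<|J|$; the Orlik-Solomon algebra is $A=E/I$, graded by degree. $A$ is quadratic if $I$ is generated by its degree $2$ part. $A$ is Koszul if $\operatorname{Tor}_i^A(\Bbbk,\Bbbk)_j=0$ for all $i\neq j$ (equivalently $\operatorname{Ext}^i_A(\Bbbk,\Bbbk)_j=0$ for $i\ne j$). An arrangement is supersolvable if its intersection lattice is supersolvable, i.e. has a maximal chain of modular elements. *)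

(* Defs.v *)
From HB Require Import structures.
From mathcomp Require Import all_boot all_order all_algebra all_field.
From mathcomp Require Import ring.
From mathcomp Require Import generic_quotient ring_quotient.
From mathcomp Require Import complex reals.

Set Implicit Arguments.
Unset Strict Implicit.
Unset Printing Implicit Defensive.

Import GRing.Theory.
Local Open Scope ring_scope.
Local Open Scope quotient_scope.

Section ExteriorAlgebra.
Variables (k : fieldType) (n : nat).
Implicit Types (S T U V W : {set 'I_n}).

(* x : extalg k n is the element \sum_S (x S) e_S of the exterior algebra on
   e_0, ..., e_(n-1). *)
Definition extalg := {ffun {set 'I_n} -> k^o}.
HB.instance Definition _ := Vector.on extalg.
Implicit Types x y z : extalg.

Definition ext_basis S : extalg := [ffun T => (T == S)%:R].

(* e_S e_T = (-1)^(inversions S T) e_(S :|: T) for disjoint S and T. *)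
Definition inversions S T : nat :=
  (\sum_(i in S) \sum_(j in T) (j < i))%N.

Definition ext_mul x y : extalg :=
  [ffun U : {set 'I_n} => \sum_(S : {set 'I_n} | S \subset U)
     (-1) ^+ inversions S (U :\: S) * (x S * y (U :\: S))].

Lemma inversionsUl S T W : [disjoint S & T] ->
  inversions (S :|: T) W = (inversions S W + inversions T W)%N.
Proof. by move=> dST; rewrite /inversions -bigU //=;
  apply: eq_bigl => i; rewrite inE. Qed.

Lemma inversionsUr S T W : [disjoint S & T] ->
  inversions W (S :|: T) = (inversions W S + inversions W T)%N.
Proof.
move=> dST; rewrite /inversions -big_split /=; apply: eq_bigr => i _.
by rewrite -bigU //=; apply: eq_bigl => j; rewrite inE.
Qed.

Lemma inversions0l T : inversions set0 T = 0%N.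
Proof. by rewrite /inversions big_set0. Qed.

Lemma inversions0r T : inversions T set0 = 0%N.
Proof. by rewrite /inversions big1 // => i _; rewrite big_set0. Qed.

Let subsetUD S U : S \subset U -> S :|: (U :\: S) = U.
Proof.
by move=> sSU; rewrite -{2}(setID U S) (setIidPr sSU).
Qed.

Fact ext_mulA : associative ext_mul.
Proof.
move=> x y z; apply/ffunP=> U; rewrite !ffunE.
under [RHS]eq_bigr => V sVU do rewrite ffunE mulr_suml mulr_sumr.
rewrite [RHS](exchange_big_dep (fun S => S \subset U)) /=; last first.
  by move=> V S sVU sSV; apply: subset_trans sVU.
apply: eq_bigr => S sSU; rewrite ffunE !mulr_sumr.
have disj T : T \subset U :\: S -> [disjoint S & T].
  by rewrite subsetD disjoint_sym => /andP[].
rewrite [RHS](reindex_onto (fun T => S :|: T) (fun V => V :\: S)) /=; last first.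
  by move=> V /andP[_ sSV]; exact: subsetUD.
rewrite [RHS](eq_bigl (fun T : {set 'I_n} => T \subset U :\: S)); last first.
  move=> T; rewrite subUset sSU subsetUl andbT /= subsetD; congr (_ && _).
  by rewrite setDUl setDv set0U; apply/eqP/idP => /setDidPl.
apply: eq_bigr => T sT; have dST := disj _ sT.
have -> : (S :|: T) :\: S = T.
  by rewrite setDUl setDv set0U; apply/setDidPl; rewrite disjoint_sym.
rewrite -setDDl inversionsUl // -(subsetUD sT) inversionsUr; last first.
  by rewrite disjoint_sym disjoints_subset subsetDr.
rewrite subsetUD // !exprD; ring.
Qed.

Fact ext_mul1x : left_id (ext_basis set0) ext_mul.
Proof.
move=> x; apply/ffunP=> U; rewrite ffunE (bigD1 set0) ?sub0set //= big1 => [|S].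
  by rewrite ffunE eqxx inversions0l expr0 setD0 !mul1r addr0.
by case/andP=> _ /negPf S0; rewrite ffunE S0 mul0r mulr0.
Qed.

Fact ext_mulx1 : right_id (ext_basis set0) ext_mul.
Proof.
move=> x; apply/ffunP=> U; rewrite ffunE (bigD1 U) //= big1 => [|S].
  by rewrite ffunE setDv eqxx inversions0r expr0 mulr1 mul1r addr0.
case/andP=> sSU neSU; rewrite ffunE setD_eq0 (_ : U \subset S = false) ?mulr0 //.
by apply: contraNF neSU => sUS; rewrite eqEsubset sSU.
Qed.

Fact ext_mulDl : left_distributive ext_mul +%R.
Proof.
move=> x y z; apply/ffunP=> U; rewrite !ffunE -big_split /=.
by apply: eq_bigr => S _; rewrite ffunE mulrDl mulrDr.
Qed.

Fact ext_mulDr : right_distributive ext_mul +%R.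
Proof.
move=> x y z; apply/ffunP=> U; rewrite !ffunE -big_split /=.
by apply: eq_bigr => S _; rewrite ffunE !mulrDr.
Qed.

Fact ext_one_neq0 : ext_basis set0 != 0 :> extalg.
Proof.
by apply/eqP=> /ffunP/(_ set0)/eqP; rewrite !ffunE eqxx oner_eq0.
Qed.

HB.instance Definition _ := GRing.Zmodule_isNzRing.Build extalg
  ext_mulA ext_mul1x ext_mulx1 ext_mulDl ext_mulDr ext_one_neq0.

Fact ext_scaleAl (a : k) x y : a *: (x * y) = (a *: x) * y.
Proof.
apply/ffunP=> U; rewrite !ffunE scaler_sumr; apply: eq_bigr => S _.
by rewrite ffunE -[LHS]/(a * _ : k) -[a *: x S]/(a * x S : k); ring.
Qed.

Fact ext_scaleAr (a : k) x y : a *: (x * y) = x * (a *: y).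
Proof.
apply/ffunP=> U; rewrite !ffunE scaler_sumr; apply: eq_bigr => S _.
by rewrite ffunE -[LHS]/(a * _ : k) -[a *: y _]/(a * y (U :\: S) : k); ring.
Qed.

HB.instance Definition _ := GRing.Lmodule_isLalgebra.Build k extalg ext_scaleAl.
HB.instance Definition _ := GRing.Lalgebra_isAlgebra.Build k extalg ext_scaleAr.
HB.instance Definition _ := Algebra_isFalgebra.Build k extalg.


Lemma ext_mulE x y U : (x * y) U = \sum_(S : {set 'I_n} | S \subset U)
  (-1) ^+ inversions S (U :\: S) * (x S * y (U :\: S)).
Proof. by rewrite ffunE. Qed.

Lemma ext_sum_basis x : x = \sum_S x S *: ext_basis S.
Proof.
apply/ffunP=> U; rewrite sum_ffunE (bigD1 U) //= big1 => [|S neSU].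
  by rewrite !ffunE eqxx addr0 -[RHS]/(x U * 1 : k) mulr1.
by rewrite !ffunE eq_sym (negPf neSU) scaler0.
Qed.

Definition ext_gen (i : 'I_n) : extalg := ext_basis [set i].

Lemma inversions1l i T : inversions [set i] T = (\sum_(j in T) (j < i))%N.
Proof. by rewrite /inversions big_set1. Qed.

Lemma ext_genM i x U : (ext_gen i * x) U =
  if i \in U then (-1) ^+ inversions [set i] (U :\ i) * x (U :\ i) else 0.
Proof.
rewrite ext_mulE; case: ifPn => [iU | niU].
  rewrite (bigD1 [set i]) ?sub1set //= big1 => [|S /andP[_ /negPf neS]].
    by rewrite ffunE eqxx mul1r addr0.
  by rewrite ffunE neS mul0r mulr0.
rewrite big1 // => S sSU; rewrite ffunE (_ : (S == [set i]) = false).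
  by rewrite mul0r mulr0.
by apply: contraNF niU => /eqP eqS; rewrite -sub1set -eqS.
Qed.

Lemma ext_basis_prod S : ext_basis S = \prod_(i <- enum S) ext_gen i.
Proof.
have: sorted (fun i j : 'I_n => i < j)%N (enum S).
  rewrite {1}/enum_mem -enumT; apply: sorted_filter.
    by move=> a b c; apply: ltn_trans.
  by have := iota_ltn_sorted 0 n; rewrite -val_enum_ord sorted_map; apply: sub_sorted.
have {2}->: S = [set i in enum S] by apply/setP=> i; rewrite inE mem_enum.
elim: {S}(enum S) => [_|i s IHs] /=.
  by rewrite big_nil -[RHS]/(ext_basis set0); congr ext_basis.
rewrite path_sortedE; last by move=> a b c; apply: ltn_trans.
case/andP=> /allP lti /IHs; rewrite big_cons => <-; apply/ffunP=> U.
have nis : i \notin s by apply/negP=> /lti; rewrite ltnn.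
rewrite ext_genM !ffunE; case: ifPn => [iU|niU]; last first.
  case: eqP => // eqU; case/negP: niU; by rewrite eqU !inE eqxx.
rewrite (_ : (U :\ i == [set j in s]) = (U == [set j in i :: s])).
  case: eqP => [->|_]; last by rewrite mulr0.
  rewrite inversions1l big1 ?expr0 ?mulr1 // => j; rewrite !inE => /andP[/negPf-> /=].
  by move/lti=> ltij; rewrite ltnNge (ltnW ltij).
apply/eqP/eqP=> [/setP eqU|->]; apply/setP=> j; last rewrite !inE.
  by have := eqU j; rewrite !inE; case: eqP => //= ->.
by case: eqP => // ->; rewrite (negPf nis).
Qed.

Definition ext_deg (d : nat) : {vspace extalg} :=
  (\sum_(S : {set 'I_n} | #|S| == d) <[ext_basis S]>)%VS.

(* Coefficientwise form of
   \partial e_S = \sum_(i in S) (-1)^#|{j in S | j < i}| e_(S :\ i);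
   ext_der_gen and ext_der_leibniz below characterise it. *)
Definition ext_der x : extalg :=
  [ffun U : {set 'I_n} => \sum_(i | i \notin U)
     (-1) ^+ inversions [set i] U * x (i |: U)].

Lemma ext_derE x U : ext_der x U =
  \sum_(i | i \notin U) (-1) ^+ inversions [set i] U * x (i |: U).
Proof. by rewrite ffunE. Qed.

Fact ext_der_is_linear : linear ext_der.
Proof.
move=> a x y; apply/ffunP=> U; rewrite !ffunE scaler_sumr -big_split /=.
apply: eq_bigr => i _; rewrite !ffunE mulrDr.
by rewrite -[a *: x _]/(a * x (i |: U) : k) -[a *: _]/(a * _ : k) mulrCA.
Qed.
HB.instance Definition _ :=
  GRing.isLinear.Build k extalg extalg *:%R ext_der ext_der_is_linear.

Lemma ext_der1 : ext_der 1 = 0.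
Proof.
apply/ffunP=> U; rewrite !ffunE big1 // => i _; rewrite ffunE.
by rewrite setU_eq0 -cards_eq0 cards1 mulr0.
Qed.

Lemma ext_der_genM i y : ext_der (ext_gen i * y) = y - ext_gen i * ext_der y.
Proof.
apply/ffunP=> U; rewrite ext_derE [RHS]ffunE [X in _ + X]ffunE ext_genM.
have invU j V : j \notin V ->
    inversions [set i] (j |: V) = ((j < i) + inversions [set i] V)%N.
  by move=> jV; rewrite !inversions1l big_setU1.
have signK m (z : k) : (-1) ^+ m * ((-1) ^+ m * z) = z.
  by rewrite mulrA -expr2 sqrr_sign mul1r.
case: ifPn => [iU|niU]; last first.
  rewrite (bigD1 i) //= big1 => [|j /andP[njU neji]].
    by rewrite ext_genM setU11 setU1K // signK addr0 oppr0 addr0.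
  by rewrite ext_genM !inE eq_sym (negPf neji) (negPf niU) mulr0.
rewrite ext_derE [in RHS](bigD1 i) ?setD11 //= setD1K // mulrDr signK opprD addrA subrr add0r.
rewrite mulr_sumr -sumrN.
rewrite [RHS](eq_bigl (fun j => j \notin U)); last first.
  move=> j; rewrite !inE; case: (eqVneq j i) => [->|_] /=; first by rewrite iU ?andbF.
  by rewrite ?andbT ?andTb.
apply: eq_bigr => j njU; have neji : j != i by apply: contraNneq njU => ->.
rewrite ext_genM !inE iU orbT.
have -> : (j |: U) :\ i = j |: (U :\ i).
  by apply/setP=> m; rewrite !inE; case: (eqVneq m i) => [->|_] //=; rewrite eq_sym (negPf neji).
rewrite invU ?inE ?(negPf njU) ?andbF //.
rewrite -{1}(setD1K iU) [inversions [set j] _]inversions1l big_setU1 ?setD11 //=.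
rewrite -inversions1l !exprD.
have: (-1) ^+ (i < j)%N * (-1) ^+ (j < i)%N = -1 :> k.
  rewrite -exprD; case: ltngtP => // /val_inj eqij.
  by rewrite eqij eqxx in neji.
set a := (-1) ^+ (i < j)%N; set b := (-1) ^+ (j < i)%N => ab.
transitivity ((a * b) * ((-1) ^+ inversions [set j] (U :\ i) *
  ((-1) ^+ inversions [set i] (U :\ i) * y (j |: U :\ i)))); first by ring.
by rewrite ab; ring.
Qed.

Lemma ext_der_gen i : ext_der (ext_gen i) = 1.
Proof. by rewrite -[ext_gen i]mulr1 ext_der_genM ext_der1 mulr0 subr0. Qed.

Lemma ext_der_leibniz d x y : x \in ext_deg d ->
  ext_der (x * y) = ext_der x * y + (-1) ^+ d * (x * ext_der y).
Proof.
case/memv_sumP=> u u_line ->; rewrite !mulr_suml linear_sum /= mulr_sumr.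
rewrite linear_sum /= mulr_suml -big_split /=; apply: eq_bigr => S /[dup] Sd.
move/u_line/vlineP=> [a ->]; rewrite -!scalerAl !linearZ /= -scalerAl -scalerAr.
rewrite -scalerDr; congr (_ *: _).
rewrite ext_basis_prod -(eqP Sd) cardE.
elim: (enum S) y => [|i s IHs] z; first by rewrite big_nil ext_der1 mul0r add0r !mul1r.
rewrite big_cons -mulrA !ext_der_genM IHs /=.
rewrite exprS mulN1r mulNr mulrBl mulrDr opprD addrA !mulrA; congr (_ - _).
by rewrite (commr_sign (ext_gen i)).
Qed.

(* The projection of E onto E_0 = k. *)
Definition ext_aug x : k := x set0.

Fact ext_aug_is_zmod_morphism : zmod_morphism ext_aug.
Proof. by move=> x y; rewrite /ext_aug !ffunE. Qed.

Fact ext_aug_is_monoid_morphism : monoid_morphism ext_aug.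
Proof.
split=> [|x y]; first by rewrite /ext_aug ffunE eqxx.
rewrite /ext_aug ext_mulE (big_pred1 set0) => [|S]; last by rewrite subset0.
by rewrite inversions0l setD0 mul1r.
Qed.

HB.instance Definition _ :=
  GRing.isZmodMorphism.Build extalg k ext_aug ext_aug_is_zmod_morphism.
HB.instance Definition _ :=
  GRing.isMonoidMorphism.Build extalg k ext_aug ext_aug_is_monoid_morphism.

End ExteriorAlgebra.

Section ExteriorQuotient.
Variables (k : fieldType) (n : nat).
Local Notation E := (extalg k n).

Definition ideal_gen (U : {vspace E}) : {vspace E} := ({:E} * U * {:E})%VS.

Lemma sub_ideal_gen U : (U <= ideal_gen U)%VS.
Proof.
apply/subvP=> u Uu; rewrite -[u]mul1r -[1 * u]mulr1.
by rewrite !memv_mul ?memvf.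
Qed.

(* Two-sided ideals contained in E_+, so that E / I is nonzero and augmented over
   k.  Homogeneity is not part of the record; os_ideal below is homogeneous
   because its generators are. *)
Record ext_ideal := ExtIdeal {
  eideal :> {vspace E};
  eideal_mull : forall x y, y \in eideal -> x * y \in eideal;
  eideal_mulr : forall x y, x \in eideal -> x * y \in eideal;
  eideal_aug : forall x, x \in eideal -> ext_aug x = 0 }.

Lemma ideal_gen_mull U x y : y \in ideal_gen U -> x * y \in ideal_gen U.
Proof.
move=> Iy; apply: (subvP (_ : ({:E} * ideal_gen U <= ideal_gen U)%VS)).
  by rewrite /ideal_gen !prodvA !prodvSl ?subvf.
by rewrite memv_mul ?memvf.
Qed.

Lemma ideal_gen_mulr U x y : x \in ideal_gen U -> x * y \in ideal_gen U.
Proof.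
move=> Ix; apply: (subvP (_ : (ideal_gen U * {:E} <= ideal_gen U)%VS)).
  by rewrite /ideal_gen -prodvA prodvSr ?subvf.
by rewrite memv_mul ?memvf.
Qed.

Let aug_lin (x : E) : k^o := ext_aug x.
Fact aug_lin_is_linear : linear aug_lin.
Proof. by move=> a x y; rewrite /aug_lin /ext_aug !ffunE. Qed.
HB.instance Definition _ :=
  GRing.isLinear.Build k E k^o *:%R aug_lin aug_lin_is_linear.

Lemma ideal_gen_aug (U : {vspace E}) : {in U, forall x, ext_aug x = 0} ->
  forall x, x \in ideal_gen U -> ext_aug x = 0.
Proof.
move=> U0 x; pose ker := lker (linfun aug_lin).
have kerE y : (y \in ker) = (ext_aug y == 0) by rewrite memv_ker lfunE.
suff /subvP sub : (ideal_gen U <= ker)%VS by move/sub; rewrite kerE => /eqP.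
apply/prodvP => y z yU _; rewrite kerE rmorphM /=.
suff /subvP/(_ _ yU) : ({:E} * U <= ker)%VS by rewrite kerE => /eqP->; rewrite mul0r.
by apply/prodvP => a b _ bU; rewrite kerE rmorphM /= (U0 b) // mulr0.
Qed.

Section Quotient.
Variable I : ext_ideal.

Definition extquot := Quotient.quot (I : {vspace E}).
HB.instance Definition _ := GRing.Zmodule.on extquot.
HB.instance Definition _ := EqQuotient.on extquot.

Lemma extquot_eqP (x y : E) :
  reflect (\pi_extquot x = \pi y) (x - y \in eideal I).
Proof. by rewrite Quotient.idealrBE; apply: eqP. Qed.

Lemma extquot_piD x y : \pi_extquot (x + y) = \pi_extquot x + \pi_extquot y.
Proof. exact: Quotient.pi_add. Qed.

Lemma extquot_piN x : \pi_extquot (- x) = - \pi_extquot x.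
Proof. exact: Quotient.pi_opp. Qed.

Definition extquot_one : extquot := \pi_extquot (1 : E).
Definition extquot_mul (a b : extquot) : extquot :=
  \pi_extquot (repr a * repr b : E).
Definition extquot_aug (a : extquot) : k := ext_aug (repr a).

Lemma extquot_piM x y : \pi_extquot (x * y) = extquot_mul (\pi x) (\pi y).
Proof.
apply/extquot_eqP.
set x' := repr _; set y' := repr _.
have xx : x - x' \in eideal I by apply/extquot_eqP; rewrite reprK.
have yy : y - y' \in eideal I by apply/extquot_eqP; rewrite reprK.
rewrite (_ : _ - _ = (x - x') * y + x' * (y - y')); last first.
  by rewrite mulrBl mulrBr addrA addrNK.
by apply: memvD; [apply: eideal_mulr | apply: eideal_mull].
Qed.

Lemma extquot_augE x : extquot_aug (\pi x) = ext_aug x.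
Proof.
apply/eqP; rewrite -subr_eq0 -rmorphB; apply/eqP/(@eideal_aug I)/extquot_eqP.
by rewrite reprK.
Qed.

Fact extquot_mulA : associative extquot_mul.
Proof.
elim/quotW=> x; elim/quotW=> y; elim/quotW=> z.
by rewrite -(extquot_piM y z) -(extquot_piM x y) -(extquot_piM x (y * z))
  -(extquot_piM (x * y) z) mulrA.
Qed.

Fact extquot_mul1x : left_id extquot_one extquot_mul.
Proof. by elim/quotW=> x; rewrite -(extquot_piM 1 x) mul1r. Qed.

Fact extquot_mulx1 : right_id extquot_one extquot_mul.
Proof. by elim/quotW=> x; rewrite -(extquot_piM x 1) mulr1. Qed.

Fact extquot_mulDl : left_distributive extquot_mul +%R.
Proof.
elim/quotW=> x; elim/quotW=> y; elim/quotW=> z.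
by rewrite -(extquot_piM x z) -(extquot_piM y z) -!extquot_piD
  -(extquot_piM (x + y) z) mulrDl.
Qed.

Fact extquot_mulDr : right_distributive extquot_mul +%R.
Proof.
elim/quotW=> x; elim/quotW=> y; elim/quotW=> z.
by rewrite -(extquot_piM x y) -(extquot_piM x z) -!extquot_piD
  -(extquot_piM x (y + z)) mulrDr.
Qed.

Fact extquot_one_neq0 : extquot_one != 0.
Proof.
apply/eqP=> /(congr1 extquot_aug)/eqP.
have -> : 0 = \pi_extquot 0.
  by rewrite -(subrr (0 : E)) extquot_piD extquot_piN subrr.
by rewrite !extquot_augE rmorph1 rmorph0 oner_eq0.
Qed.

HB.instance Definition _ := GRing.Zmodule_isNzRing.Build extquot
  extquot_mulA extquot_mul1x extquot_mulx1 extquot_mulDl extquot_mulDr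
  extquot_one_neq0.

Fact extquot_aug_zmod : zmod_morphism extquot_aug.
Proof.
elim/quotW=> x; elim/quotW=> y.
by rewrite -extquot_piN -extquot_piD !extquot_augE rmorphB.
Qed.

Fact extquot_aug_monoid : monoid_morphism extquot_aug.
Proof.
split; first by rewrite extquot_augE rmorph1.
elim/quotW=> x; elim/quotW=> y.
by rewrite -[_ * _]extquot_piM !extquot_augE rmorphM.
Qed.

HB.instance Definition _ :=
  GRing.isZmodMorphism.Build extquot k extquot_aug extquot_aug_zmod.
HB.instance Definition _ :=
  GRing.isMonoidMorphism.Build extquot k extquot_aug extquot_aug_monoid.

(* The degree d component of E / I, for homogeneous I: the image of E_d. *)
Definition extquot_deg (d : nat) (a : extquot) : Prop :=
  exists2 x : E, x \in ext_deg k n d & a = \pi x.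

End Quotient.

Definition quadratic (I : ext_ideal) : Prop :=
  (I : {vspace E}) = ideal_gen (I :&: ext_deg k n 2)%VS.

End ExteriorQuotient.

(* A is a connected graded k-algebra: deg d x says that x is in A_d, and aug is
   the projection of A onto A_0 = k, which makes k an A-module. *)
Section Koszul.
Variables (k : fieldType) (A : nzRingType).
Variables (deg : nat -> A -> Prop) (aug : {rmorphism A -> k}).

(* x belongs to A_(a - b), where A_m = 0 for m < 0. *)
Definition deg_diff (a b : nat) (x : A) : Prop :=
  if (b <= a)%N then deg (a - b) x else x = 0.

(* Graded resolutions of the left A-module k by free modules of finite rank
   ... -> F_1 -> F_0 -> k -> 0.  F_i is the module of row vectors over A, its
   basis vector a has internal degree fr_deg a, and all maps, acting by right
   multiplication on row vectors, preserve internal degrees (k is in degree 0).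
   Finite rank is no restriction when A is finite dimensional, as it is for
   Orlik-Solomon algebras: the trivial module then has such a resolution. *)
Record free_resolution := FreeResolution {
  fr_rank : nat -> nat;
  fr_deg : forall i, 'I_(fr_rank i) -> nat;
  fr_diff : forall i, 'M[A]_(fr_rank i.+1, fr_rank i);
  fr_aug : 'cV[k]_(fr_rank 0);
  fr_diff_deg : forall i a b,
    deg_diff (fr_deg a) (fr_deg b) (fr_diff i a b);
  fr_aug_deg : forall a, fr_deg a != 0%N -> fr_aug a 0 = 0;
  fr_aug_neq0 : fr_aug != 0;
  fr_exact0 : forall v : 'rV[A]_(fr_rank 0),
    map_mx aug v *m fr_aug = 0 <-> exists w, v = w *m fr_diff 0;
  fr_exact : forall i (v : 'rV[A]_(fr_rank i.+1)),
    v *m fr_diff i = 0 <-> exists w, v = w *m fr_diff i.+1 }.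

(* The differential of the complex of k-vector spaces k \otimes_A F. *)
Definition tor_diff (F : free_resolution) i :
  'M[k]_(fr_rank F i.+1, fr_rank F i) :=
  map_mx aug (fr_diff F i).

Definition tor_cycle (F : free_resolution) i : 'rV[k]_(fr_rank F i) -> Prop :=
  match i return 'rV[k]_(fr_rank F i) -> Prop with
  | 0%N => fun _ => True
  | i'.+1 => fun v => v *m tor_diff F i' = 0
  end.

Definition tor_deg (F : free_resolution) i j
  (v : 'rV[k]_(fr_rank F i)) : Prop :=
  forall a, fr_deg a != j -> v 0 a = 0.

(* Tor_i^A(k, k)_j = 0: the homology of k \otimes_A F in homological degree i and
   internal degree j vanishes.  That homology does not depend on F, so that it is
   enough to compute it for one resolution. *)
Definition tor_vanishes i j : Prop :=
  exists F : free_resolution, forall v : 'rV[k]_(fr_rank F i),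
    tor_deg j v -> tor_cycle v ->
    exists2 w : 'rV[k]_(fr_rank F i.+1), tor_deg j w & v = w *m tor_diff F i.

Definition koszul : Prop := forall i j, i != j -> tor_vanishes i j.

End Koszul.

Section Arrangement.
Variables (K : fieldType) (V : vectType K).

Definition codim (X : {vspace V}) : nat := (\dim {:V} - \dim X)%N.

Record arrangement n := Arrangement {
  hplane :> 'I_n -> {vspace V};
  hplane_codim : forall i, codim (hplane i) = 1%N;
  hplane_inj : injective hplane }.

Variables (n : nat) (H : arrangement n).
Implicit Types (X Y Z : {vspace V}) (J : {set 'I_n}).

Definition flat J : {vspace V} := (\bigcap_(i in J) H i)%VS.

(* The intersection lattice, which is ordered by reverse inclusion. *)
Definition is_flat X : Prop := exists J, X = flat J.

Definition flat_join X Y : {vspace V} := (X :&: Y)%VS.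
Definition flat_meet X Y : {vspace V} :=
  (\bigcap_(i < n | (X + Y <= H i)%VS) H i)%VS.

Lemma flat_joinP X Y : is_flat X -> is_flat Y -> is_flat (flat_join X Y).
Proof.
move=> [J ->] [J' ->]; exists (J :|: J'); rewrite /flat_join /flat.
apply/eqP; rewrite eqEsubv; apply/andP; split.
  apply/subv_bigcapP => i; rewrite inE => /orP[] iJ.
    by apply: subv_trans (capvSl _ _) _; apply: bigcapv_inf iJ _.
  by apply: subv_trans (capvSr _ _) _; apply: bigcapv_inf iJ _.
by rewrite subv_cap; apply/andP; split; apply/subv_bigcapP => i iJ;
  apply: (bigcapv_inf i); rewrite // inE iJ ?orbT.
Qed.

Lemma flat_meet_flat X Y : is_flat (flat_meet X Y).
Proof.
exists [set i | (X + Y <= H i)%VS]; apply: eq_bigl => i; by rewrite inE.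
Qed.

Lemma flat_meetP X Y Z : is_flat Z ->
  (flat_meet X Y <= Z)%VS = ((X <= Z)%VS && (Y <= Z)%VS).
Proof.
case=> J ->; apply/idP/andP => [le | [leX leY]].
  by split; apply: subv_trans le; apply/subv_bigcapP => i;
    apply: subv_trans; rewrite ?addvSl ?addvSr.
apply/subv_bigcapP => i iJ; apply: (bigcapv_inf i) => //.
by rewrite subv_add (subv_trans leX) ?(subv_trans leY) ?(bigcapv_inf i).
Qed.

(* For all Z <= Y in the lattice, Z \/ (X /\ Y) = (Z \/ X) /\ Y. *)
Definition modular_pair X Y : Prop := forall Z, is_flat Z -> (Y <= Z)%VS ->
  flat_join Z (flat_meet X Y) = flat_meet (flat_join Z X) Y.

Definition modular X : Prop :=
  is_flat X /\ forall Y, is_flat Y -> modular_pair X Y.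

Definition maximal_chain (c : seq {vspace V}) : Prop :=
  [/\ {in c, forall X, is_flat X},
      {in c &, forall X Y, (X <= Y)%VS || (Y <= X)%VS} &
      forall Y, is_flat Y -> {in c, forall X, (X <= Y)%VS || (Y <= X)%VS} ->
        Y \in c].

Definition supersolvable : Prop :=
  exists2 c, maximal_chain c & {in c, forall X, modular X}.

Definition dependent J : bool := (codim (flat J) < #|J|)%N.

Variable k : fieldType.

Definition os_relations : {vspace extalg k n} :=
  (\sum_(J : {set 'I_n} | dependent J) <[ext_der (ext_basis k J)]>)%VS.

Fact os_relations_aug : {in os_relations, forall x, ext_aug x = 0}.
Proof.
move=> x /memv_sumP[u uP ->]; rewrite raddf_sum big1 //= => J dJ.
have /vlineP[a ->] := uP J dJ.
rewrite /ext_aug ffunE ext_derE big1 ?scaler0 // => i _.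
rewrite ffunE setU0; case: eqP => [eJ|]; last by rewrite mulr0.
move: dJ; rewrite /dependent -eJ cards1 /flat big_set1 hplane_codim ltnn //.
Qed.

Definition os_ideal : ext_ideal k n :=
  ExtIdeal (@ideal_gen_mull k n os_relations)
    (@ideal_gen_mulr k n os_relations) (ideal_gen_aug os_relations_aug).

Definition os_algebra : nzRingType := extquot os_ideal.

Definition os_koszul : Prop :=
  koszul (A := os_algebra) (@extquot_deg k n os_ideal)
    (@extquot_aug k n os_ideal).

Definition os_quadratic : Prop := quadratic os_ideal.

End Arrangement.

Section GraphicArrangement.
Variables (K : fieldType) (l : nat) (e : rel 'I_l).
Local Notation V := 'rV[K]_l.

(* Each edge is listed once, as the pair (i, j) with i < j. *)
Definition edges : {set 'I_l * 'I_l} :=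
  [set p : 'I_l * 'I_l | (p.1 < p.2)%N && e p.1 p.2].

Definition coord_diff (p : 'I_l * 'I_l) (z : V) : K^o := z 0 p.1 - z 0 p.2.

Fact coord_diff_is_linear p : linear (coord_diff p).
Proof.
move=> a y z; rewrite /coord_diff !mxE opprD addrACA.
by rewrite [RHS]/(a * _ + _) mulrBr.
Qed.
HB.instance Definition _ p :=
  GRing.isLinear.Build K V K^o *:%R (coord_diff p) (coord_diff_is_linear p).

Definition edge_hplane (p : 'I_l * 'I_l) : {vspace V} :=
  lker (linfun (coord_diff p)).

Lemma edge_hplaneE p z : (z \in edge_hplane p) = (z 0 p.1 - z 0 p.2 == 0).
Proof. by rewrite memv_ker lfunE. Qed.

Definition graphic_hplane (i : 'I_#|edges|) : {vspace V} :=
  edge_hplane (enum_val i).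

Fact graphic_hplane_codim i : codim (graphic_hplane i) = 1%N.
Proof.
have := enum_valP i; rewrite /graphic_hplane inE.
case: (enum_val i) => a b /= /andP[ab _].
have := limg_ker_dim (linfun (coord_diff (a, b))) fullv.
rewrite capfv /codim -/(edge_hplane (a, b)) => <-; rewrite addKn.
suff -> : limg (linfun (coord_diff (a, b))) = fullv by rewrite dimvf.
apply/eqP; rewrite eqEsubv subvf /=; apply/subvP=> c _.
have -> : c = linfun (coord_diff (a, b)) (c *: delta_mx 0 a).
  rewrite lfunE linearZ /= /coord_diff !mxE !eqxx /=.
  by rewrite (_ : (b == a) = false) ?subr0 ?[RHS]mulr1 //; apply: gtn_eqF.
exact: memv_img (memvf _).
Qed.

Fact graphic_hplane_inj : injective graphic_hplane.
Proof.
move=> i j eqH; apply: enum_val_inj.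
have := enum_valP i; have := enum_valP j.
move: eqH; rewrite /graphic_hplane !inE.
case: (enum_val i) (enum_val j) => a b [c d] /= /vspaceP eqH.
move=> /andP[cd _] /andP[ab _].
have ind (z : 'I_l -> K) : (z a == z b) = (z c == z d).
  have := eqH (\row_m z m); rewrite !edge_hplaneE !mxE /=.
  by rewrite !subr_eq0.
have ac : (a == c) || (b == c).
  have := ind (fun m => (m == c)%:R).
  rewrite eqxx (_ : (d == c) = false) ?oner_eq0; last by apply: gtn_eqF.
  by case: (a == c) (b == c) => [] []; rewrite ?eqxx.
have ad : (a == d) || (b == d).
  have := ind (fun m => (m == d)%:R).
  rewrite eqxx (_ : (c == d) = false); last by apply: ltn_eqF.
  rewrite [RHS]eq_sym oner_eq0.
  by case: (a == d) (b == d) => [] []; rewrite ?eqxx.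
case/orP: ac ad ab cd => /eqP <- /orP[] /eqP <- //; rewrite ?ltnn // => ab ba.
by have := ltn_trans ab ba; rewrite ltnn.
Qed.

Definition graphic_arrangement : arrangement V #|edges| :=
  Arrangement graphic_hplane_codim graphic_hplane_inj.

End GraphicArrangement.

(* Main.v *)
(* The proof goes around the cycle: supersolvable => Koszul => quadratic => the graph
   is chordal => supersolvable.

   Supersolvable => Koszul.  A maximal chain of modular flats sorts the hyperplanes
   into levels, so that two hyperplanes a, b of the same level span some c of lower
   level, whence e_a e_b = (e_a - e_b) e_c in A.  The monomials with at most one
   factor in each level are then a basis of A: they span by straightening, and they
   are independent because for each such monomial e_T the flag of the flats of the
   upper parts of T defines a homomorphism from A to the exterior algebra fixing e_T
   and killing the coefficient at T of the other basis monomials.  In an ordering of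
   the hyperplanes by level, it follows that the left ideal generated by the
   predecessors of a has as colon ideal by e_a the ideal generated by all hyperplanes
   of level at most that of a, again an initial segment.  So the syzygies of the
   residue field are linear at every step.

   Koszul => quadratic.  Comparing a resolution with A^n -> A -> k shows that a
   relation of degree j >= 3 with Tor_2 vanishing in degree j lies in
   E_+ I + I E_+.

   Quadratic => chordal.  On the edge set C of a cycle without a triangle that meets
   it in two edges, the monomials supported in C have coefficient 0 on the degree 2
   part of I, so the element \partial e_C of I is not in the ideal it generates.

   Chordal => supersolvable.  By Dirac's theorem the vertices can be ordered so that
   the earlier neighbours of each vertex form a clique; the flats of the initial
   segments are a maximal modular chain. *)

From HB Require Import structures.
Require Import Defs.
From mathcomp Require Import all_boot all_order all_algebra all_field.
From mathcomp Require Import zify ring.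
From mathcomp Require Import generic_quotient ring_quotient.
From mathcomp Require Import complex boolp reals.

Set Implicit Arguments.
Unset Strict Implicit.
Unset Printing Implicit Defensive.

Import GRing.Theory.
Local Open Scope ring_scope.
Local Open Scope quotient_scope.

(** * Monomials of the exterior algebra and its universal property *)

Section ExteriorMonomials.
Variables (k : fieldType) (n : nat).
Local Notation E := (extalg k n).
Local Notation gen := (@ext_gen k n).
Local Notation mon := (@ext_basis k n).
Implicit Types (S T U : {set 'I_n}) (x y z : E).

Lemma ext_basisE S U : mon S U = (U == S)%:R.
Proof. by rewrite ffunE. Qed.

Lemma ext_basisM S T : mon S * mon T =
  if [disjoint S & T] then (-1) ^+ inversions S T *: mon (S :|: T) else 0.
Proof.
apply/ffunP=> U; rewrite ext_mulE.
have [sSU|nsSU] := boolP (S \subset U); last first.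
  rewrite big1 => [|S' sS'U]; last first.
    rewrite ext_basisE (_ : (S' == S) = false) ?mul0r ?mulr0 //.
    by apply: contraNF nsSU => /eqP <-.
  case: ifP => _; rewrite !ffunE // (_ : (U == _) = false) ?scaler0 //.
  by apply: contraNF nsSU => /eqP ->; rewrite subsetUl.
rewrite (bigD1 S) //= big1 ?addr0 => [|S' /andP[_ /negPf nS]]; last first.
  by rewrite ext_basisE nS mul0r mulr0.
rewrite !ext_basisE eqxx mul1r.
have [dST|ndST] := ifPn.
  rewrite !ffunE.
  have -> : (U :\: S == T) = (U == S :|: T).
    apply/eqP/eqP=> [<-|->]; first by rewrite -{1}(setID U S) (setIidPr sSU).
    by rewrite setDUl setDv set0U; apply/setDidPl; rewrite disjoint_sym.
  by case: eqP => [->|]; rewrite ?mulr0 ?scaler0 // setDUl setDv set0U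
    (_ : T :\: S = T) //; apply/setDidPl; rewrite disjoint_sym.
rewrite ffunE (_ : (_ == T) = false) ?mulr0 //.
apply: contraNF ndST => /eqP <-; rewrite disjoint_sym.
by rewrite disjoints_subset subsetDr.
Qed.

Lemma ext_genM_basis i S : i \notin S ->
  gen i * mon S = (-1) ^+ inversions [set i] S *: mon (i |: S).
Proof. by move=> iS; rewrite ext_basisM disjoints1 iS. Qed.

Lemma ext_genM_basis0 i S : i \in S -> gen i * mon S = 0.
Proof. by move=> iS; rewrite ext_basisM disjoints1 iS. Qed.

Lemma ext_basisM_gen i S : i \notin S ->
  mon S * gen i = (-1) ^+ inversions S [set i] *: mon (i |: S).
Proof. by move=> iS; rewrite ext_basisM disjoint_sym disjoints1 iS setUC. Qed.

Lemma ext_basisM_gen0 i S : i \in S -> mon S * gen i = 0.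
Proof. by move=> iS; rewrite ext_basisM disjoint_sym disjoints1 iS. Qed.

Lemma ext_basisU1l i S : i \notin S ->
  mon (i |: S) = (-1) ^+ inversions [set i] S *: (gen i * mon S).
Proof. by move=> iS; rewrite ext_genM_basis // scalerA -expr2 sqrr_sign scale1r. Qed.

Lemma ext_basisU1r i S : i \notin S ->
  mon (i |: S) = (-1) ^+ inversions S [set i] *: (mon S * gen i).
Proof. by move=> iS; rewrite ext_basisM_gen // scalerA -expr2 sqrr_sign scale1r. Qed.

Lemma ext_gen_sq i : gen i * gen i = 0.
Proof. by rewrite ext_genM_basis0 ?set11. Qed.

Lemma ext_gen_anticomm i j : gen i * gen j = - (gen j * gen i).
Proof.
have [->|neij] := eqVneq i j; first by rewrite ext_gen_sq oppr0.
rewrite !ext_genM_basis ?inE // 1?eq_sym // setUC -scaleNr; congr (_ *: _).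
rewrite !inversions1l !big_set1.
rewrite -val_eqE /= in neij.
by case: ltngtP neij => //= _ _; rewrite ?expr0 ?expr1 ?opprK.
Qed.

End ExteriorMonomials.

Section ExteriorUniversal.
Variables (k : fieldType) (n : nat) (B : algType k) (y : 'I_n -> B).
Hypothesis y_sq : forall i, y i * y i = 0.
Hypothesis y_anti : forall i j, y i * y j = - (y j * y i).
Local Notation E := (extalg k n).
Local Notation gen := (@ext_gen k n).
Local Notation mon := (@ext_basis k n).

(** The universal property of the exterior algebra: since the [y i] square to zero and anticommute,
    this linear map is the algebra homomorphism with [ext_gen i] sent to [y i]. [enum S] lists [S]
    in increasing order, as in [ext_basis_prod]. *)
Definition ext_lift (x : E) : B :=
  \sum_(S : {set 'I_n}) (x S : k) *: \prod_(i <- enum S) y i.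

Fact ext_lift_is_linear : linear ext_lift.
Proof.
move=> a u v; rewrite /ext_lift scaler_sumr -big_split /=.
by apply: eq_bigr => S _; rewrite !ffunE scalerDl scalerA.
Qed.
HB.instance Definition _ :=
  GRing.isLinear.Build k E B *:%R ext_lift ext_lift_is_linear.

Lemma ext_lift_basis S : ext_lift (mon S) = \prod_(i <- enum S) y i.
Proof.
rewrite /ext_lift (bigD1 S) //= [X in _ + X]big1 => [|T /negPf neT].
  by rewrite ext_basisE eqxx scale1r addr0.
by rewrite ext_basisE neT scale0r.
Qed.

Lemma ext_lift1 : ext_lift 1 = 1.
Proof.
have -> : (1 : E) = mon set0 by [].
by rewrite ext_lift_basis enum_set0 big_nil.
Qed.

Lemma enum_set_sorted (S : {set 'I_n}) : sorted (fun i j : 'I_n => i < j)%N (enum S).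
Proof.
rewrite /enum_mem -enumT; apply: sorted_filter.
  by move=> a b c; apply: ltn_trans.
by have := iota_ltn_sorted 0 n; rewrite -val_enum_ord sorted_map; apply: sub_sorted.
Qed.

Lemma enum_set_mem (s : seq 'I_n) :
  sorted (fun i j : 'I_n => i < j)%N s -> enum [set i in s] = s.
Proof.
have tr : transitive (fun i j : 'I_n => i < j)%N by move=> a b c; apply: ltn_trans.
move=> ss; apply: (irr_sorted_eq tr) => //; first by move=> a; apply: ltnn.
  exact: enum_set_sorted.
by move=> i; rewrite mem_enum inE.
Qed.

(** The factor [y i] is moved to its sorted place. Each smaller entry that it passes costs a sign,
    which adds up to the inversion number, and meeting its own copy gives 0. *)
Lemma ext_lift_gen_seq i (s : seq 'I_n) :
  sorted (fun i j : 'I_n => i < j)%N s ->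
  y i * \prod_(j <- s) y j = if i \in s then 0 else
    (-1) ^+ inversions [set i] [set j in s] *:
      \prod_(j <- enum (i |: [set j in s])) y j.
Proof.
have tr : transitive (fun i j : 'I_n => i < j)%N by move=> a b c; apply: ltn_trans.
elim: s => [|j s IHs] ss.
  rewrite big_nil mulr1 in_nil (_ : [set j in [::]] = set0); last first.
    by apply/setP=> j; rewrite !inE.
  by rewrite setU0 inversions0r enum_set1 big_seq1 scale1r.
have := ss; rewrite /= (path_sortedE tr) => /andP[/allP lts ss'].
have js : j \notin s by apply/negP=> /lts; rewrite ltnn.
have [ltij|ltji|/val_inj eqij] := ltngtP i j; last first.
- by rewrite eqij inE eqxx big_cons mulrA y_sq mul0r.
- rewrite big_cons mulrA y_anti mulNr -mulrA (IHs ss').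
  rewrite inE -val_eqE gtn_eqF //=; case: ifP => [|nis]; first by rewrite mulr0 oppr0.
  have setE : [set u in j :: s] = j |: [set u in s].
    by apply/setP=> u; rewrite !inE.
  rewrite setE !inversions1l big_setU1 ?inE //= ltji exprS mulN1r scaleNr.
  rewrite -scalerAr; congr (- (_ *: _)).
  have -> : i |: (j |: [set u in s]) =
      [set u in j :: enum (i |: [set u in s])].
    by apply/setP=> u; rewrite !inE mem_enum !inE orbCA.
  rewrite enum_set_mem ?big_cons // /= (path_sortedE tr) enum_set_sorted andbT.
  by apply/allP=> u; rewrite mem_enum !inE => /orP[/eqP->|/lts].
have nis : i \notin j :: s.
  apply/negP; rewrite inE -val_eqE ltn_eqF //= => /lts ltji.
  by have := ltn_trans ltij ltji; rewrite ltnn.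
rewrite (negPf nis) inversions1l.
rewrite [X in (-1) ^+ X]big1 => [|u]; last first.
  rewrite !inE => /orP[/eqP->|/lts ltju]; first by rewrite ltnNge ltnW.
  by rewrite ltnNge (ltnW (ltn_trans ltij ltju)).
rewrite scale1r (_ : i |: _ = [set u in i :: j :: s]); last first.
  by apply/setP=> u; rewrite !inE.
by rewrite enum_set_mem ?big_cons //= ltij.
Qed.

Lemma ext_lift_genM i (z : E) : ext_lift (gen i * z) = y i * ext_lift z.
Proof.
rewrite (ext_sum_basis z) mulr_sumr !linear_sum mulr_sumr /=.
apply: eq_bigr => S _; rewrite -scalerAr !linearZ /= -scalerAr; congr (_ *: _).
rewrite ext_lift_basis ext_lift_gen_seq ?enum_set_sorted // mem_enum.
have -> : [set j in enum S] = S by apply/setP=> j; rewrite inE mem_enum.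
case: ifPn => iS; first by rewrite ext_genM_basis0 // linear0.
by rewrite ext_genM_basis // linearZ /= ext_lift_basis.
Qed.

Lemma ext_liftM (x z : E) : ext_lift (x * z) = ext_lift x * ext_lift z.
Proof.
rewrite (ext_sum_basis x) mulr_suml !linear_sum mulr_suml /=.
apply: eq_bigr => S _; rewrite -scalerAl !linearZ /= -scalerAl; congr (_ *: _).
rewrite ext_basis_prod; elim: (enum S) => [|i s IHs].
  by rewrite big_nil ext_lift1 !mul1r.
by rewrite big_cons -mulrA !ext_lift_genM IHs mulrA.
Qed.

Lemma ext_lift_gen i : ext_lift (gen i) = y i.
Proof. by rewrite -[gen i]mulr1 ext_lift_genM ext_lift1 mulr1. Qed.

End ExteriorUniversal.

(** * Flats and supersolvable arrangements *)

Section Flats.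
Variables (K : fieldType) (V : vectType K) (n : nat) (H : arrangement V n).
Implicit Types (J S C : {set 'I_n}) (X Y : {vspace V}).

Lemma flatS S J : S \subset J -> (flat H J <= flat H S)%VS.
Proof.
move=> sSJ; apply/subv_bigcapP => i iS.
by apply: (bigcapv_inf i) => //; apply: subsetP iS.
Qed.

Lemma flat_sub i J : i \in J -> (flat H J <= H i)%VS.
Proof. by move=> iJ; apply: (bigcapv_inf i). Qed.

Lemma flatU1 i J : flat H (i |: J) = (H i :&: flat H J)%VS.
Proof.
apply/eqP; rewrite eqEsubv subv_cap flat_sub ?setU11 // flatS ?subsetUr //=.
apply/subv_bigcapP => j; rewrite !inE => /orP[/eqP->|jJ]; first exact: capvSl.
exact: subv_trans (capvSr _ _) (flat_sub jJ).
Qed.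

Lemma flatD1 i J : i \in J -> flat H J = (H i :&: flat H (J :\ i))%VS.
Proof. by move=> iJ; rewrite -flatU1 setD1K. Qed.

Lemma hplane_sub_eq a b : (H a <= H b)%VS -> a = b.
Proof.
move=> sab; apply/(@hplane_inj _ _ _ H)/eqP; rewrite eqEdim sab /=.
have := hplane_codim H a; have := hplane_codim H b.
rewrite /codim; have := dimvS (subvf (H a)); have := dimvS (subvf (H b)); lia.
Qed.

Lemma codim_hplane_cap i X : (codim (H i :&: X) <= (codim X).+1)%N.
Proof.
have := hplane_codim H i; rewrite /codim.
have := dimv_sum_cap (H i) X; have := dimvS (subvf (H i + X)%VS).
have := dimvS (subvf X); have := dimvS (subvf (H i)); lia.
Qed.

Lemma codim_flat J : (codim (flat H J) <= #|J|)%N.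
Proof.
elim: {J}_.+1 {-2}J (ltnSn #|J|) => // m IHm J ltJm.
have [->|[i iJ]] := set_0Vmem J.
  by rewrite /flat big_set0 /codim subnn.
rewrite (flatD1 iJ); apply: leq_trans (codim_hplane_cap _ _) _.
rewrite (cardsD1 i J) iJ ltnS IHm //.
by move: ltJm; rewrite (cardsD1 i J) iJ.
Qed.

Lemma dependent_sub i J : i \in J -> (flat H (J :\ i) <= H i)%VS -> dependent H J.
Proof.
move=> iJ sJi; rewrite /dependent (flatD1 iJ) (capv_idPr sJi) (cardsD1 i J) iJ.
by rewrite ltnS codim_flat.
Qed.

(** Take [C] minimal among the dependent subsets of [J]: each [C :\ i] is independent, so its flat
    has no smaller codimension than [flat H C] and the two flats coincide. *)
Lemma dependent_circuit J : dependent H J ->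
  exists2 C : {set 'I_n}, C \subset J /\ C != set0 &
    {in C, forall i, (flat H (C :\ i) <= H i)%VS}.
Proof.
move=> /minset_exists[C /minsetP[dC minC] sCJ]; exists C; first split=> //.
  by apply: contraTneq dC => ->; rewrite /dependent cards0.
move=> i iC; have ndCi : ~~ dependent H (C :\ i).
  apply/negP=> /minC/(_ (subD1set _ _)) eqC.
  by move: iC; rewrite -eqC !inE eqxx.
move: dC ndCi; rewrite /dependent -leqNgt (cardsD1 i C) iC ltnS => le1 le2.
rewrite -[X in (X <= _)%VS](_ : flat H C = _); first exact: flat_sub.
apply/eqP; rewrite eqEdim flatS ?subD1set //=.
move: (leq_trans le1 le2); rewrite /codim.
have := dimvS (subvf (flat H C)); have := dimvS (subvf (flat H (C :\ i))); lia.
Qed.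

End Flats.

(* The combinatorial shadow of supersolvability: a projection that forgets the
   hyperplanes of top level is a fibration by punctured lines. *)
Definition fiber_level (K : fieldType) (V : vectType K) (n : nat)
    (H : arrangement V n) (lev : 'I_n -> nat) : Prop :=
  (forall a, ~~ (flat H [set s | (lev s < lev a)%N] <= H a)%VS) /\
  (forall a b, a != b -> lev a = lev b ->
     exists2 c, (lev c < lev a)%N & (H a :&: H b <= H c)%VS).

(** * Levels of hyperplanes from a maximal chain of modular flats *)

Section Supersolvable.
Variables (K : fieldType) (V : vectType K) (n : nat) (H : arrangement V n).
Implicit Types (J S C : {set 'I_n}) (X Y : {vspace V}).

Lemma flat_hplane a : is_flat H (H a).
Proof. by exists [set a]; rewrite /flat big_set1. Qed.

Lemma chain_min (c : seq {vspace V}) (P : pred {vspace V}) :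
  {in c &, forall X Y, (X <= Y)%VS || (Y <= X)%VS} -> has P c ->
  exists X, [/\ X \in c, P X & {in c, forall Y, P Y -> (X <= Y)%VS}].
Proof.
elim: c => //= X c IHc tot.
have totc : {in c &, forall X Y, (X <= Y)%VS || (Y <= X)%VS}.
  by move=> Y Z Yc Zc; apply: tot; rewrite inE ?Yc ?Zc orbT.
have [hasc _|hasNc] := boolP (has P c).
  have [Y [Yc PY minY]] := IHc totc hasc.
  have [/andP[PX sXY]|] := boolP (P X && (X <= Y)%VS).
    exists X; rewrite inE eqxx; split=> // Z; rewrite inE.
    by case/orP=> [/eqP-> //|Zc PZ]; apply: subv_trans sXY (minY _ Zc PZ).
  move=> nXY; exists Y; rewrite inE Yc orbT; split=> // Z; rewrite inE.
  case/orP=> [/eqP-> PX|Zc PZ]; last exact: minY.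
  move: nXY (tot X Y); rewrite PX /= !inE eqxx Yc orbT => /negPf->.
  exact.
rewrite orbF => PX; exists X; rewrite inE eqxx; split=> // Z; rewrite inE.
case/orP=> [/eqP-> //|Zc PZ]; case/negP: hasNc; apply/hasP.
by exists Z.
Qed.

(** The level of [a] counts the members of the chain that are not contained in [H a]. Maximality of
    the chain and modularity of its smallest such member [X] produce the third hyperplane. *)
Lemma supersolvable_fiber_level : supersolvable H ->
  exists lev : 'I_n -> nat, fiber_level H lev.
Proof.
case=> c [flc tot maxc] modc.
pose P a X := ~~ (X <= H a)%VS; pose lev a := count (P a) c.
have hasP a : has (P a) c.
  apply/hasP; exists fullv; last first.
    apply/negP=> /dimvS; have := hplane_codim H a; rewrite /codim; lia.
  apply: maxc; first by exists set0; rewrite /flat big_set0.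
  by move=> X Xc; rewrite subvf.
have count_sum Q : count Q c = (\sum_(Y <- c) Q Y)%N.
  by rewrite -sum1_count big_mkcond; apply: eq_bigr => Y _; case: (Q Y).
(* The members counted by [lev a] and by [lev b] are upper segments of one chain, hence nested.
   Whether [X], the smallest one counted by [lev a], lies in [H b] decides which segment is
   larger. *)
have ltlev a b X : X \in c -> P a X -> {in c, forall Y, P a Y -> (X <= Y)%VS} ->
    (X <= H b)%VS = (lev b < lev a)%N.
  move=> Xc PX minX; apply/idP/idP => [sXb|].
    have le : {in c, forall Y, (P b Y + (Y == X) <= P a Y)%N}.
      move=> Y Yc; case: eqP => [->|_]; first by rewrite PX /P sXb.
      rewrite addn0; case: (boolP (P b Y)) => // PbY; rewrite lt0b.
      case/orP: (tot _ _ Xc Yc) => [sXY|sYX].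
        by apply: contraNN PX => /(subv_trans sXY).
      by case/negP: PbY; apply: subv_trans sXb.
    rewrite /lev !count_sum.
    apply: leq_trans (_ : \sum_(Y <- c) (P b Y + (Y == X)) <= _)%N.
      rewrite big_split /= -addn1 leq_add2l -(count_sum (pred1 X)).
      by rewrite -has_count has_pred1.
    by rewrite !big_seq; apply: leq_sum => Y Yc; apply: le.
  apply: contraTT => PbX; rewrite -leqNgt /lev !count_sum !big_seq.
  apply: leq_sum => Y Yc; case: (boolP (P a Y)) => // /(minX _ Yc) sXY.
  by rewrite lt0b; apply: contraNN PbX => /(subv_trans sXY).
exists lev; split=> [a|a b neab eqlev].
  have [X [Xc PX minX]] := chain_min tot (hasP a).
  apply: contraNN (PX); apply: subv_trans; apply/subv_bigcapP => s.
  by rewrite inE -(ltlev _ _ _ Xc PX minX).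
have [X [Xc PX minX]] := chain_min tot (hasP a).
(* [X :&: H a] is comparable with the whole chain, hence belongs to it. If it were not inside [H b],
   the smallest member outside [H b] would lie inside [H a], forcing the level of [a] strictly below
   that of [b]. *)
have sXab : (H a :&: X <= H b)%VS.
  have: (X :&: H a)%VS \in c.
    apply: maxc; first exact: flat_joinP (flc _ Xc) (flat_hplane a).
    move=> Y Yc; have [PaY|] := boolP (P a Y).
      by rewrite (subv_trans (capvSl _ _) (minX _ Yc PaY)) orbT.
    rewrite negbK => sYa; rewrite subv_cap sYa andbT.
    case/orP: (tot _ _ Xc Yc) => [sXY|->//].
    by case/negP: PX; apply: subv_trans sYa.
  move=> XYc; have [Z [Zc PZ minZ]] := chain_min tot (hasP b).
  rewrite capvC; apply/negPn/negP=> PbXY.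
  have := ltlev b a Z Zc PZ minZ; rewrite eqlev ltnn.
  by rewrite (subv_trans (minZ _ XYc PbXY)) ?capvSr.
set Y := (H a :&: H b)%VS; have flY : is_flat H Y.
  exact: flat_joinP (flat_hplane a) (flat_hplane b).
(* Any hyperplane containing [X + Y] serves as [c]. Without one the meet of [X] and [Y] is the whole
   space, and the modular law collapses to [H a <= H b]. *)
have := (modc X Xc).2 Y flY (H a) (flat_hplane a) (capvSl _ _).
have [d sXYd _|none eqF] := pickP (fun d => (X + Y <= H d)%VS).
  move: sXYd; rewrite subv_add => /andP[sXd sYd]; exists d => //.
  by rewrite -(ltlev _ _ _ Xc PX minX).
case/eqP: neab; apply: (@hplane_sub_eq _ _ _ H).
move: eqF; rewrite /flat_join /flat_meet (eq_bigl _ _ none) big_pred0_eq capvf => ->.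
by apply: (bigcapv_inf b) => //; rewrite subv_add sXab capvSr.
Qed.

End Supersolvable.

(** * The monomial basis of the Orlik-Solomon algebra *)

Section OrlikSolomon.
Variables (K : fieldType) (V : vectType K) (n : nat) (H : arrangement V n).
Variable k : fieldType.
Local Notation E := (extalg k n).
Local Notation gen := (@ext_gen k n).
Local Notation mon := (@ext_basis k n).
Local Notation I := (eideal (os_ideal H k)).
Implicit Types (J S T C D : {set 'I_n}) (x z : E).

Lemma os_ideal_mull x z : z \in I -> x * z \in I.
Proof. exact: eideal_mull. Qed.

Lemma os_ideal_mulr x z : x \in I -> x * z \in I.
Proof. exact: eideal_mulr. Qed.

Lemma os_ideal_der J : dependent H J -> ext_der (mon J) \in I.
Proof.
move=> dJ; apply: (subvP (sub_ideal_gen _)).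
apply: (subvP (sumv_sup J dJ (subvv _))); exact: memv_line.
Qed.

Lemma os_ideal_sub (W : {vspace E}) :
  (forall S J T, dependent H J -> mon S * ext_der (mon J) * mon T \in W) ->
  (I <= W)%VS.
Proof.
move=> monW; apply/prodvP=> u z Uu _.
suff /subvP/(_ _ Uu) : ({:E} * os_relations H k <= linfun (z \o* idfun) @^-1: W)%VS.
  by rewrite -memv_preim lfunE.
apply/prodvP=> x w _ /memv_sumP[r rP ->]; rewrite mulr_sumr memv_suml // => J dJ.
have /vlineP[c ->] := rP J dJ; rewrite -memv_preim lfunE /=.
rewrite (ext_sum_basis x) (ext_sum_basis z) mulr_suml mulr_suml memv_suml // => S _.
rewrite mulr_sumr memv_suml // => T _.
by rewrite -!(scalerAl, scalerAr) !memvZ // monW.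
Qed.

Lemma os_ideal_ker (B : vectType k) (f : {linear E -> B}) :
  (forall S J T, dependent H J -> f (mon S * ext_der (mon J) * mon T) = 0) ->
  forall x, x \in I -> f x = 0.
Proof.
move=> f0 x Ix; suff /subvP/(_ _ Ix) : (I <= lker (linfun f))%VS.
  by rewrite memv_ker lfunE => /eqP.
by apply: os_ideal_sub => S J T dJ; rewrite memv_ker lfunE /= f0.
Qed.

Lemma ext_basisU2 a b S : a \notin b |: S -> b \notin S -> exists s : bool,
  mon (a |: (b |: S)) = (-1) ^+ s *: (gen a * (gen b * mon S)).
Proof.
move=> aS bS; exists (odd (inversions [set a] (b |: S)) (+) odd (inversions [set b] S)).
rewrite ext_basisU1l // ext_basisU1l // -scalerAr scalerA.
by rewrite signr_addb !signr_odd.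
Qed.

(** Up to sign this element is the derivative of the monomial on the dependent set of [a], [b], [c],
    namely e_b e_c - e_a e_c + e_a e_b. *)
Lemma os_ideal_triple a b c : uniq [:: a; b; c] -> (H a :&: H b <= H c)%VS ->
  gen a * gen b - (gen a - gen b) * gen c \in I.
Proof.
rewrite /= !inE andbT negb_or => /andP[/andP[neab neac] nebc] sabc.
have dJ : dependent H (a |: (b |: [set c])).
  apply: (@dependent_sub _ _ _ _ c); first by rewrite !inE eqxx !orbT.
  apply: subv_trans sabc; rewrite subv_cap !flat_sub //.
    by rewrite !inE eqxx orbT nebc.
  by rewrite !inE eqxx neac.
have := os_ideal_der dJ.
have [||s ->] := @ext_basisU2 a b [set c]; rewrite ?inE ?negb_or ?neab //.
rewrite linearZ /= rpredZsign.
rewrite !ext_der_genM -[mon [set c]]/(gen c) ext_der_gen mulr1 !mulrBr mulrBl.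
by rewrite opprB addrA [in X in X - _]addrC opprB addrA addrAC.
Qed.

End OrlikSolomon.

(** * Linear independence of the transversal monomials modulo the ideal *)

Section Transversals.
Variables (K : fieldType) (V : vectType K) (n : nat) (H : arrangement V n).
Variables (lev : 'I_n -> nat) (levP : fiber_level H lev).
Variable k : fieldType.
Local Notation E := (extalg k n).
Local Notation gen := (@ext_gen k n).
Local Notation mon := (@ext_basis k n).
Local Notation I := (eideal (os_ideal H k)).
Implicit Types (J S T C D : {set 'I_n}) (x z : E).

Definition transversal_set T : bool :=
  [forall i in T, forall j in T, (lev i == lev j) ==> (i == j)].

Lemma transversal_setP T : reflect {in T &, injective lev} (transversal_set T).
Proof.
apply: (iffP forall_inP) => [h i j iT jT eqij|h i iT].
  by apply/eqP; have /forall_inP/(_ j jT) := h i iT; rewrite eqij eqxx.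
by apply/forall_inP=> j jT; apply/implyP=> /eqP/(h i j iT jT)->.
Qed.

Lemma transversal_sub S T : S \subset T -> transversal_set T -> transversal_set S.
Proof.
move=> /subsetP sST /transversal_setP injT; apply/transversal_setP=> i j iS jS.
by apply: injT; apply: sST.
Qed.

Lemma transversalU1 i T : {in T, forall t, lev t != lev i} ->
  transversal_set T -> transversal_set (i |: T).
Proof.
move=> neT /transversal_setP injT; apply/transversal_setP=> a b; rewrite !inE.
case/orP=> [/eqP->|aT] /orP[/eqP->|bT] // eqab; last exact: injT.
  by have := neT _ bT; rewrite eqab eqxx.
by have := neT _ aT; rewrite eqab eqxx.
Qed.

(** In a circuit inside [T] the element of highest level has all others strictly below it, so its
    hyperplane would contain the flat of all lower levels. *)
Lemma transversal_independent T : transversal_set T -> ~~ dependent H T.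
Proof.
move=> /transversal_setP injT; apply/negP=> /dependent_circuit[C [sCT]].
case/set0Pn=> i0 i0C cycC.
have [i iC maxi] := arg_maxnP lev i0C; case/negP: (levP.1 i).
apply: subv_trans (cycC i iC); apply: flatS; apply/subsetP=> s.
rewrite !inE => /andP[nesi sC]; rewrite ltn_neqAle [(_ <= _)%N]maxi // andbT.
by apply: contraNneq nesi => /injT-> //; apply: (subsetP sCT).
Qed.

Section Dual.
Variables (T : {set 'I_n}) (trT : transversal_set T).

(** As [m] grows, the flats of these sets form an increasing flag of subspaces from [flat H T] to
    the whole space. *)
Definition flag_set (m : nat) : {set 'I_n} := [set s in T | (m <= lev s)%N].

(* The step at which the flag of the flats of [flag_set m] enters H i. *)
Definition flag_step (i : 'I_n) : option 'I_n :=
  [pick t in T | (flat H (flag_set (lev t)) <= H i)%VS &&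
                 ~~ (flat H (flag_set (lev t).+1) <= H i)%VS].

Lemma flag_stepP i t : flag_step i = Some t ->
  [/\ t \in T, (flat H (flag_set (lev t)) <= H i)%VS &
      ~~ (flat H (flag_set (lev t).+1) <= H i)%VS].
Proof. by rewrite /flag_step; case: pickP => // u /and3P[? ? ?] [<-]. Qed.

Lemma flag_setS p q : (p <= q)%N -> (flat H (flag_set p) <= flat H (flag_set q))%VS.
Proof.
move=> lepq; apply: flatS; apply/subsetP=> s; rewrite !inE => /andP[-> /=].
exact: leq_trans.
Qed.

Lemma flag_step_uniq i t u :
  [/\ t \in T, (flat H (flag_set (lev t)) <= H i)%VS &
      ~~ (flat H (flag_set (lev t).+1) <= H i)%VS] ->
  [/\ u \in T, (flat H (flag_set (lev u)) <= H i)%VS &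
      ~~ (flat H (flag_set (lev u).+1) <= H i)%VS] -> t = u.
Proof.
move=> [tT st nt] [uT su nu]; apply: (transversal_setP _ trT) => //.
case: (ltngtP (lev t) (lev u)) => // [lttu|ltut].
  by case/negP: nt; apply: subv_trans su; apply: flag_setS.
by case/negP: nu; apply: subv_trans st; apply: flag_setS.
Qed.

Lemma flag_step_some i t : t \in T -> (flat H (flag_set (lev t)) <= H i)%VS ->
  ~~ (flat H (flag_set (lev t).+1) <= H i)%VS -> flag_step i = Some t.
Proof.
move=> tT st nt; rewrite /flag_step.
case: pickP => [u /and3P[uT su nu]|/(_ t)]; last by rewrite tT st nt.
by congr Some; apply: (@flag_step_uniq i).
Qed.

Lemma flag_step_exists i : (flat H T <= H i)%VS -> flag_step i != None.
Proof.
have [M leM] : exists M, forall s, (lev s < M)%N.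
  by exists (\max_s lev s).+1 => s; rewrite ltnS (leq_bigmax s).
(* The search descends from the bound [M], where the flat is the whole space and lies in no
   hyperplane. The flag changes only at levels of members of [T], so the first flat inside [H i] is
   that of some [t]. *)
suff step m : (flat H (flag_set (M - m)) <= H i)%VS -> flag_step i != None.
  move=> sTi; apply: (step M); rewrite subnn; apply: subv_trans sTi.
  by apply: flatS; apply/subsetP=> s; rewrite inE leq0n andbT.
elim: m => [|m IHm].
  rewrite subn0 (_ : flag_set M = set0); last first.
    by apply/setP=> s; rewrite !inE leqNgt leM andbF.
  rewrite /flat big_set0 => /dimvS; have := hplane_codim H i; rewrite /codim; lia.
have [sm _|nsm ssm] := boolP (flat H (flag_set (M - m)) <= H i)%VS; first exact: IHm.
have [leMm|ltmM] := leqP M m.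
  by case/negP: nsm; rewrite (eqP (_ : M - m == M - m.+1)%N) //; lia.
have eqm : (M - m = (M - m.+1).+1)%N by lia.
have [t /andP[tT /eqP levt]|none] :=
    pickP (fun t => (t \in T) && (lev t == M - m.+1)%N).
  by rewrite (@flag_step_some i t) // levt -?eqm.
case/negP: nsm; rewrite (_ : flag_set _ = flag_set (M - m.+1)) //.
apply/setP=> s; rewrite !inE; case: (boolP (s \in T)) => //= sT.
rewrite eqm ltn_neqAle; case: eqP => //= eqs.
by have := none s; rewrite sT -eqs eqxx.
Qed.

Lemma flag_step_id t : t \in T -> flag_step t = Some t.
Proof.
move=> tT; apply: flag_step_some => //; first by rewrite flat_sub ?inE ?tT /=.
apply/negP=> st; have: dependent H (t |: flag_set (lev t).+1).
  apply: (@dependent_sub _ _ _ _ t); first exact: setU11.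
  by rewrite setU1K // !inE ltnn andbF.
apply/negP/transversal_independent/(transversal_sub _ trT).
by apply/subsetP=> s; rewrite !inE => /orP[/eqP->|/andP[]].
Qed.

(** In a circuit inside [S], let [i] have the step [t] of lowest level. All other members contain
    the flat of [flag_set (lev t).+1], hence so does [H i], although its step is [t]. *)
Lemma flag_step_independent S : {in S, forall s, flag_step s != None} ->
  {in S &, injective flag_step} -> ~~ dependent H S.
Proof.
move=> someS injS; apply/negP=> /dependent_circuit[C [/subsetP sCS]].
case/set0Pn=> i0 i0C cycC.
pose r i := oapp lev 0%N (flag_step i).
have [i iC mini] := arg_minnP r i0C.
case eqi : (flag_step i) (someS _ (sCS _ iC)) => [t|] // _.
have [tT _ /negP] := flag_stepP eqi; apply; apply: subv_trans (cycC i iC).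
apply/subv_bigcapP=> s; rewrite !inE => /andP[nesi sC].
case eqs : (flag_step s) (someS _ (sCS _ sC)) => [u|] // _.
have [uT su _] := flag_stepP eqs; apply: subv_trans su; apply: flag_setS.
have := mini s sC; rewrite /r eqs eqi /= leq_eqVlt => /orP[/eqP eqtu|//].
case/eqP: nesi; apply: injS; rewrite ?sCS // eqs eqi; congr Some.
by apply: (transversal_setP _ trT).
Qed.

(** Hyperplanes that do not contain [flat H T] have no step and go to 0; the others go to the
    generator of their step. The lift [psi] of this assignment is the homomorphism that detects the
    monomial of [T]. *)
Definition flag_gen (i : 'I_n) : E := oapp gen 0 (flag_step i).

Lemma flag_gen_sq i : flag_gen i * flag_gen i = 0.
Proof.
by rewrite /flag_gen; case: flag_step => [t|] /=; rewrite ?mulr0 ?ext_gen_sq.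
Qed.

Lemma flag_gen_anticomm i j : flag_gen i * flag_gen j = - (flag_gen j * flag_gen i).
Proof.
rewrite /flag_gen; case: (flag_step i) (flag_step j) => [t|] [u|] /=;
  rewrite ?mulr0 ?mul0r ?oppr0 //; exact: ext_gen_anticomm.
Qed.

Local Notation psi := (ext_lift flag_gen).
Let psiM := ext_liftM flag_gen_sq flag_gen_anticomm.
Let psi_gen := ext_lift_gen flag_gen_sq flag_gen_anticomm.

Lemma set2_split a b J : a \in J -> b \in J -> a != b ->
  exists2 S, J = a |: (b |: S) & (a \notin b |: S) && (b \notin S).
Proof.
move=> aJ bJ neab; exists (J :\ a :\ b); last by rewrite !inE !eqxx (negPf neab) !andbF.
by rewrite !setD1K // !inE eq_sym neab.
Qed.

(** Write the monomial as e_a e_b m up to sign. Its derivative is e_b m - e_a m + e_a e_b (dm), with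
    dm the derivative of m: the images of the first two terms cancel, and the last one contains a
    square. *)
Lemma flag_lift_eq0 a b J : a \in J -> b \in J -> a != b ->
  flag_step a = flag_step b -> psi (mon J) = 0 /\ psi (ext_der (mon J)) = 0.
Proof.
move=> aJ bJ neab eqab; have [S -> /andP[aS bS]] := set2_split aJ bJ neab.
have [s ->] := @ext_basisU2 n k a b S aS bS.
have eqg : flag_gen a = flag_gen b by rewrite /flag_gen eqab.
rewrite !linearZ /= !ext_der_genM !mulrBr opprB !linearD !linearN /= !psiM !psi_gen.
rewrite eqg !mulrA flag_gen_sq !mul0r addrCA subrr addr0.
by rewrite scaler0.
Qed.

(** If two members of [J] share a step, [flag_lift_eq0] applies. Otherwise the steps are injective
    on [J], and this contradicts dependence. *)
Lemma flag_lift_der J : dependent H J -> psi (ext_der (mon J)) = 0.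
Proof.
move=> dJ; have [/forall_inP injJ|] := boolP [forall a in J, forall b in J,
    (flag_step a == flag_step b) ==> (a == b)]; last first.
  rewrite negb_forall => /existsP[a]; rewrite negb_imply => /andP[aJ].
  rewrite negb_forall => /existsP[b]; rewrite !negb_imply => /and3P[bJ /eqP eqab neab].
  by have [] := flag_lift_eq0 aJ bJ neab eqab.
have {}injJ : {in J &, injective flag_step}.
  move=> a b aJ bJ eqab; apply/eqP; have /forall_inP/(_ b bJ) := injJ a aJ.
  by rewrite eqab eqxx.
have [C [/subsetP sCJ /set0Pn[i iC]] cycC] := dependent_circuit dJ.
(* By injectivity at most one member [j] of the circuit lacks a step. The others then contain
   [flat H T], so [H j] contains it too and has a step after all. With all steps present,
   [flag_step_independent] contradicts the circuit. *)
have [j /andP[jC /eqP nj]|some] := pickP (fun j => (j \in C) && (flag_step j == None)).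
  suff: flag_step j != None by rewrite nj eqxx.
  apply: flag_step_exists; apply: subv_trans (cycC j jC); apply/subv_bigcapP=> s.
  rewrite !inE => /andP[nesj sC].
  case eqs : (flag_step s) => [t|]; last first.
    by case/eqP: nesj; apply: injJ; rewrite ?sCJ // eqs nj.
  have [_ st _] := flag_stepP eqs; apply: subv_trans st; apply: flatS.
  by apply/subsetP=> u; rewrite inE => /andP[].
have /negP[] : ~~ dependent H C.
  apply: flag_step_independent => [s sC|a b aC bC].
    by have := some s; rewrite sC /= => ->.
  by apply: injJ; apply: sCJ.
exact: dependent_sub (cycC i iC).
Qed.

Lemma flag_lift_os_ideal x : x \in I -> psi x = 0.
Proof.
apply: os_ideal_ker => u J z dJ.
by rewrite /= !psiM flag_lift_der // mulr0 mul0r.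
Qed.

Lemma flag_lift_id : psi (mon T) = mon T.
Proof.
rewrite ext_lift_basis ext_basis_prod; apply: eq_big_seq => t.
by rewrite mem_enum => tT; rewrite /flag_gen flag_step_id.
Qed.

(** No factor of the image is the generator of [t], so no monomial in it involves [t]. *)
Lemma flag_lift_coef0 t S : t \in T ->
  {in S, forall i, flag_step i != Some t} -> psi (mon S) T = 0.
Proof.
move=> tT nS; rewrite ext_lift_basis.
have {}nS : {in enum S, forall i, flag_step i != Some t}.
  by move=> i; rewrite mem_enum; apply: nS.
suff coef0 (U : {set 'I_n}) : t \in U -> (\prod_(i <- enum S) flag_gen i) U = 0.
  exact: coef0.
elim: (enum S) nS U => [|i s IHs] nS U tU.
  by rewrite big_nil ext_basisE; case: eqP tU => // ->; rewrite inE.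
rewrite big_cons {1}/flag_gen.
case eqi : (flag_step i) => [u|] /=; last by rewrite mul0r ffunE.
rewrite ext_genM; case: ifP => // uU; rewrite IHs ?mulr0 //.
  by move=> j js; apply: nS; rewrite inE js orbT.
rewrite !inE tU andbT eq_sym; have := nS i (mem_head _ _).
by rewrite eqi; apply: contraNneq => ->.
Qed.

(** If [S] properly contains [T], an extra element is killed or shares the step of a member of [T].
    If [T] is not contained in [S], the member [t] of [T :\: S] of highest level is the step of no
    element of [S]. *)
Lemma flag_lift_coef S : transversal_set S -> psi (mon S) T = (S == T)%:R.
Proof.
move=> trS; have [->|neST] := eqVneq S T; first by rewrite flag_lift_id ext_basisE eqxx.
have [sTS|nsTS] := boolP (T \subset S).
  have [i iS niT] : exists2 i, i \in S & i \notin T.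
    by apply/subsetPn; apply: contraNN neST => sST; rewrite eqEsubset sST.
  case eqi : (flag_step i) => [t|].
    have [tT _ _] := flag_stepP eqi.
    have neit : i != t by apply: contraNneq niT => ->.
    have [|-> _] := flag_lift_eq0 iS (subsetP sTS _ tT) neit; last by rewrite ffunE.
    by rewrite eqi flag_step_id.
  rewrite -(setD1K iS) ext_basisU1l ?setD11 // linearZ /= psiM psi_gen.
  by rewrite /flag_gen eqi mul0r scaler0 ffunE.
have [t0 t0T nt0S] := subsetPn nsTS.
have t0P : (t0 \in T) && (t0 \notin S) by rewrite t0T.
have [t /andP[tT ntS] maxt] :=
  @arg_maxnP _ t0 (fun t => (t \in T) && (t \notin S)) lev t0P.
apply: (@flag_lift_coef0 t) => // i iS; apply/eqP=> eqi.
have [_ sti nti] := flag_stepP eqi.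
have neit : i != t by apply: contraNneq ntS => <-.
have high s : s \in T -> (lev t < lev s)%N -> (s \in S) && (lev s != lev i).
  move=> sT ltts; have sS : s \in S.
    apply/negPn/negP=> nsS; have: (lev s <= lev t)%N by apply: maxt; rewrite sT nsS.
    by rewrite leqNgt ltts.
  rewrite sS; apply/eqP=> eqsi; have eq_si := transversal_setP _ trS _ _ sS iS eqsi.
  have := flag_step_id sT; rewrite eq_si eqi => -[eqts].
  by rewrite eqts eq_si ltnn in ltts.
have trt m : transversal_set (flag_set m).
  by apply: transversal_sub trT; apply/subsetP=> s; rewrite !inE => /andP[].
(* [c] is new to the levels of the flag, yet H c contains its flat *)
have contra c : {in flag_set (lev t), forall s, lev s != lev c} ->
    (flat H (flag_set (lev t)) <= H c)%VS -> False.
  move=> nec stc; have := transversal_independent (transversalU1 nec (trt _)).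
  case/negP; apply: (@dependent_sub _ _ _ _ c); first exact: setU11.
  by rewrite setU1K //; apply/negP=> /nec; rewrite eqxx.
(* If the level of [i] differs from that of [t], it is new to the flag set and [contra] applies to
   [i] itself. If they agree, it applies to the hyperplane of lower level that contains
   [H i :&: H t]. *)
have [eqlev|nelev] := eqVneq (lev i) (lev t); last first.
  apply: (contra i) => // s; rewrite inE => /andP[sT].
  rewrite leq_eqVlt => /orP[/eqP|/(high _ sT)/andP[] //].
  by move/(transversal_setP _ trT _ _ tT sT)=> <-; rewrite eq_sym.
have [c ltc sc] := levP.2 i t neit eqlev.
apply: (contra c) => [s|].
  by rewrite inE -eqlev => /andP[_ leis]; rewrite gtn_eqF // (leq_trans ltc).
apply: subv_trans sc; rewrite subv_cap sti.
by apply: flat_sub; rewrite inE tT leqnn.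
Qed.

Let dual (x : E) : k^o := psi x T.

Fact dual_is_linear : linear dual.
Proof. by move=> a x z; rewrite /dual linearD linearZ !ffunE. Qed.
HB.instance Definition _ := GRing.isLinear.Build k E k^o *:%R dual dual_is_linear.

Lemma transversal_dual : exists f : {linear E -> k^o},
  (forall x, x \in I -> f x = 0) /\
  (forall S, transversal_set S -> f (mon S) = (S == T)%:R).
Proof.
exists dual; split=> [x Ix|S]; last exact: flag_lift_coef.
by rewrite /= /dual flag_lift_os_ideal // ffunE.
Qed.

End Dual.
End Transversals.

(** * Spanning by transversal monomials, and colon ideals of initial segments *)

Section Colon.
Variables (K : fieldType) (V : vectType K) (n : nat) (H : arrangement V n).
Variables (lev : 'I_n -> nat) (levP : fiber_level H lev).
Variable k : fieldType.
Local Notation E := (extalg k n).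
Local Notation gen := (@ext_gen k n).
Local Notation mon := (@ext_basis k n).
Local Notation I := (eideal (os_ideal H k)).
Local Notation transversal := (transversal_set lev).
Implicit Types (J S T C D : {set 'I_n}) (x z : E).

Definition level_closed D := {in D, forall s c, (lev c < lev s)%N -> c \in D}.

(** For level-closed [D] this contains the left ideal generated by [D] and the Orlik-Solomon ideal
    ([in_gen_ideal_span]), and describes it by monomials on which the dual forms can be
    evaluated. *)
Definition transversal_span D : {vspace E} :=
  (I + \sum_(T | transversal T && ~~ [disjoint T & D]) <[mon T]>)%VS.

Lemma transversal_span_mon D T s :
  transversal T -> s \in T -> s \in D -> mon T \in transversal_span D.
Proof.
move=> trT sT sD; apply: (subvP (addvSr _ _)).
apply: (subvP (sumv_sup T _ (subvv _))); last exact: memv_line.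
by rewrite trT; apply/pred0Pn; exists s; rewrite /= sT.
Qed.

Lemma os_ideal_sub_span D x : x \in I -> x \in transversal_span D.
Proof. by apply: subvP; apply: addvSl. Qed.

(** Induction on the level of [s]. If [T] has another element [u] of that level, then e_u e_s is
    (e_u - e_s) e_c modulo the ideal with [c] of lower level: [u] is kept or replaced by [s], and
    e_c is absorbed by induction. *)
Lemma transversal_span_M_gen D T s : level_closed D -> transversal T -> s \in D ->
  mon T * gen s \in transversal_span D.
Proof.
move=> clD; elim: {s}_.+1 {-2}s T (ltnSn (lev s)) => // m IHm s T ltm trT sD.
have [sT|nsT] := boolP (s \in T); first by rewrite ext_basisM_gen0 ?mem0v.
have [u /andP[uT /eqP eqlev]|none] :=
    pickP (fun u => (u \in T) && (lev u == lev s)); last first.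
  rewrite ext_basisM_gen // rpredZsign (@transversal_span_mon _ _ s) ?setU11 //.
  by apply: transversalU1 => // t tT; have := none t; rewrite tT /= => ->.
have neus : u != s by apply: contraNneq nsT => <-.
have [c ltc sc] := levP.2 u s neus eqlev.
have ltcm : (lev c < m)%N by apply: leq_trans ltc _; rewrite eqlev -ltnS.
have cD : c \in D by apply: clD sD _ _; rewrite -eqlev.
have nuT : u \notin T :\ u by rewrite !inE eqxx.
have trTu : transversal (T :\ u) by apply: transversal_sub trT; apply: subD1set.
have trsu : transversal (s |: T :\ u).
  apply: transversalU1 => // t; rewrite !inE => /andP[neut tT].
  by rewrite -eqlev; apply: contraNneq neut => /(transversal_setP _ _ trT t u tT uT)->.
have nsu : s \notin T :\ u by rewrite !inE (negPf nsT) andbF.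
have relI : gen u * gen s - (gen u - gen s) * gen c \in I.
  apply: os_ideal_triple => //=; rewrite !inE negb_or neus andbT.
  by apply/andP; split; apply: contraTneq ltc => <-; rewrite ?eqlev ltnn.
rewrite -(setD1K uT) ext_basisU1r // -scalerAl rpredZsign -mulrA.
rewrite -(subrK ((gen u - gen s) * gen c) (gen u * gen s)) mulrDr.
apply: memvD; first exact/os_ideal_sub_span/os_ideal_mull.
rewrite mulrBl mulrBr !mulrA; apply: memvB.
  rewrite ext_basisM_gen // -scalerAl rpredZsign setD1K //.
  exact: IHm.
rewrite ext_basisM_gen // -scalerAl rpredZsign.
exact: IHm.
Qed.

Lemma transversal_spanning x :
  x \in (I + \sum_(T | transversal T) <[mon T]>)%VS.
Proof.
rewrite (ext_sum_basis x); apply: memv_suml => S _; apply: memvZ.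
have closedT : level_closed setT by move=> s _ c _; rewrite inE.
have sub : (transversal_span setT <= I + \sum_(T | transversal T) <[mon T]>)%VS.
  rewrite /transversal_span addvS //; apply/subv_sumP=> T /andP[trT _].
  exact: (sumv_sup T).
elim: {S}_.+1 {-2}S (ltnSn #|S|) => // m IHm S ltSm.
have [->|[s sS]] := set_0Vmem S.
  apply: (subvP (addvSr _ _)).
  apply: (subvP (sumv_sup set0 _ (subvv _))); last exact: memv_line.
  by apply/transversal_setP=> i j; rewrite inE.
rewrite -(setD1K sS) ext_basisU1r ?setD11 // rpredZsign; apply: (subvP sub).
have /IHm/memv_addP[y Iy [z /memv_sumP[c cP ->] ->]] : (#|S :\ s| < m)%N.
  by move: ltSm; rewrite (cardsD1 s S) sS.
rewrite mulrDl mulr_suml; apply: memvD.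
  exact/os_ideal_sub_span/os_ideal_mulr.
apply: memv_suml => T trT; have /vlineP[a ->] := cP T trT.
by rewrite -scalerAl memvZ // transversal_span_M_gen ?inE.
Qed.

(** The left ideal of the Orlik-Solomon algebra generated by [D], expressed through representatives
    in the exterior algebra. *)
Definition in_gen_ideal D x : Prop :=
  exists c : 'I_n -> E, x - \sum_(s in D) c s * gen s \in I.

Lemma in_gen_idealI D x : x \in I -> in_gen_ideal D x.
Proof.
by move=> Ix; exists (fun _ => 0); rewrite big1 ?subr0 // => s _; rewrite mul0r.
Qed.

Lemma in_gen_idealD D x z :
  in_gen_ideal D x -> in_gen_ideal D z -> in_gen_ideal D (x + z).
Proof.
move=> [c Ic] [d Id]; exists (fun s => c s + d s).
rewrite (eq_bigr (fun s => c s * gen s + d s * gen s)) => [|s _]; last exact: mulrDl.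
by rewrite big_split /= opprD addrACA memvD.
Qed.

Lemma in_gen_idealM D x z : in_gen_ideal D z -> in_gen_ideal D (x * z).
Proof.
move=> [c Ic]; exists (fun s => x * c s).
rewrite (eq_bigr (fun s => x * (c s * gen s))) => [|s _]; last by rewrite mulrA.
by rewrite -mulr_sumr -mulrBr os_ideal_mull.
Qed.

Lemma in_gen_idealN D x : in_gen_ideal D x -> in_gen_ideal D (- x).
Proof. by rewrite -mulN1r; apply: in_gen_idealM. Qed.

Lemma in_gen_ideal_sum (J : finType) (P : pred J) D (F : J -> E) :
  (forall j, P j -> in_gen_ideal D (F j)) -> in_gen_ideal D (\sum_(j | P j) F j).
Proof.
move=> FP; apply: big_ind => //; last exact: in_gen_idealD.
exact/in_gen_idealI/mem0v.
Qed.

Lemma in_gen_ideal_gen D s : s \in D -> in_gen_ideal D (gen s).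
Proof.
move=> sD; exists (fun i => (i == s)%:R); rewrite (bigD1 s) //= eqxx mul1r.
rewrite big1 ?addr0 ?subrr ?mem0v // => i /andP[_ /negPf->]; exact: mul0r.
Qed.

Lemma in_gen_ideal_span D x : level_closed D -> in_gen_ideal D x ->
  x \in transversal_span D.
Proof.
move=> clD [c Ic]; rewrite -[x](subrK (\sum_(s in D) c s * gen s)).
apply: memvD; first exact: os_ideal_sub_span.
apply: memv_suml => s sD.
have /memv_addP[y Iy [z /memv_sumP[u uP ->] ->]] := transversal_spanning (c s).
rewrite mulrDl mulr_suml; apply: memvD; first exact/os_ideal_sub_span/os_ideal_mulr.
apply: memv_suml => T trT; have /vlineP[b ->] := uP T trT.
by rewrite -scalerAl memvZ // transversal_span_M_gen.
Qed.

(** Backward, each e_s e_a with [s] of level at most that of [a] reduces to generators in [D], by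
    anticommutation or by the relation of a triple. Forward, the part of [x] with all levels above
    that of [a] must vanish, by the dual forms. *)
Lemma os_colon D a x : level_closed D -> a \notin D ->
    (forall s, (lev s < lev a)%N -> s \in D) ->
    {in D, forall s, (lev s <= lev a)%N} ->
  in_gen_ideal D (x * gen a) <-> in_gen_ideal [set s | (lev s <= lev a)%N] x.
Proof.
move=> clD aD ltD leD; set L := [set s | _].
have backward z : in_gen_ideal L z -> in_gen_ideal D (z * gen a).
  case=> c Ic; rewrite -[z](subrK (\sum_(s in L) c s * gen s)) mulrDl.
  apply: in_gen_idealD; first exact/in_gen_idealI/os_ideal_mulr.
  rewrite mulr_suml; apply: in_gen_ideal_sum => s; rewrite inE => les.
  rewrite -mulrA; apply: in_gen_idealM.
  have [->|nesa] := eqVneq s a.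
    by rewrite ext_gen_sq; apply/in_gen_idealI/mem0v.
  move: les; rewrite leq_eqVlt => /orP[/eqP eqlev|lts]; last first.
    rewrite ext_gen_anticomm; apply/in_gen_idealN/in_gen_idealM.
    exact/in_gen_ideal_gen/ltD.
  have [d ltd sd] := levP.2 s a nesa eqlev.
  rewrite -(subrK ((gen s - gen a) * gen d) (gen s * gen a)).
  apply: in_gen_idealD.
    apply/in_gen_idealI/os_ideal_triple => //=; rewrite !inE negb_or nesa andbT.
    by apply/andP; split; apply: contraTneq ltd => <-; rewrite ?eqlev ltnn.
  by apply/in_gen_idealM/in_gen_ideal_gen/ltD; rewrite -eqlev.
split=> [Dxa|]; last exact: backward.
have /memv_addP[y Iy [z /memv_sumP[u uP ->] eqx]] := transversal_spanning x.
pose low := \sum_(T | transversal T && ~~ [disjoint T & L]) u T.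
pose high := \sum_(T | transversal T && [disjoint T & L]) u T.
have eqx' : x = (y + low) + high.
  by rewrite eqx (bigID (fun T => [disjoint T & L])) /= -addrA [low + _]addrC.
have Llow : in_gen_ideal L (y + low).
  apply: in_gen_idealD; first exact: in_gen_idealI.
  apply: in_gen_ideal_sum => T /andP[trT /pred0Pn[s /andP[/= sT sL]]].
  have /vlineP[b ->] := uP T trT.
  rewrite -(setD1K sT) ext_basisU1r ?setD11 // scalerA scalerAl.
  exact/in_gen_idealM/in_gen_ideal_gen.
suff -> : x = y + low by [].
have spanh : high * gen a \in transversal_span D.
  rewrite (_ : high * gen a = x * gen a + - ((y + low) * gen a)); last first.
    by rewrite eqx' mulrDl addrAC subrr add0r.
  apply: in_gen_ideal_span => //; apply: in_gen_idealD => //.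
  exact/in_gen_idealN/backward.
rewrite eqx' (_ : high = 0) ?addr0 // /high big1 // => T /andP[trT dTL].
have high_lev t S : [disjoint S & L] -> t \in S -> (lev a < lev t)%N.
  move=> dSL tS; rewrite ltnNge; apply/negP=> let_.
  by have := disjointFr dSL tS; rewrite inE let_.
have naT S : [disjoint S & L] -> a \notin S.
  by move=> dSL; apply/negP=> /(high_lev _ _ dSL); rewrite ltnn.
have traS S : transversal S -> [disjoint S & L] -> transversal (a |: S).
  move=> trS dSL; apply: transversalU1 => // t /(high_lev _ _ dSL).
  by move=> lta; rewrite gtn_eqF.
(* Multiplication by e_a sends the monomials of [high], up to sign, to distinct transversal
   monomials [a |: T] that miss [D]. The form dual to [a |: T] kills [transversal_span D] and so
   reads off a zero coefficient. *)
have [f [fI fT]] := transversal_dual levP k (traS T trT dTL).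
have f_span w : w \in transversal_span D -> f w = 0.
  case/memv_addP=> y' Iy' [z' /memv_sumP[v vP ->] ->].
  rewrite linearD fI // add0r linear_sum big1 // => S /[dup] SP /andP[trS dSD].
  have /vlineP[b ->] := vP S SP; rewrite linearZ /= fT //.
  rewrite (_ : (S == _) = false) ?scaler0 //; apply: contraNF dSD => /eqP->.
  apply/pred0P=> t /=; rewrite !inE; case: eqP => [->|_] /=; first exact: negPf.
  apply/negP=> /andP[tT /leD]; rewrite leqNgt.
  by rewrite (high_lev _ _ dTL tT).
have := f_span _ spanh; rewrite /high mulr_suml linear_sum /=.
have [b uT] := vlineP _ _ (uP T trT).
rewrite (bigD1 T) ?trT //= big1 => [|S /andP[/andP[trS dSL] neST]].
  rewrite uT -scalerAl ext_basisM_gen ?naT // scalerA linearZ /= fT ?traS //.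
  rewrite eqxx addr0 => /eqP; rewrite scaler_eq0 oner_eq0 orbF mulf_eq0 signr_eq0 orbF.
  by move/eqP->; rewrite scale0r.
have /vlineP[c ->] := uP S trS.
rewrite -scalerAl ext_basisM_gen ?naT // scalerA linearZ /= fT ?traS //.
rewrite (_ : (_ == _) = false) ?scaler0 //; apply: contraNF neST => /eqP eqST.
by rewrite -(setU1K (naT _ dSL)) eqST setU1K ?naT.
Qed.

End Colon.

(** * Linear resolutions from linear colon ideals *)

Section LinearResolution.
Variables (A : nzRingType) (N : nat) (g : 'I_N -> A).
Variables (pr1 pr2 : {additive A -> A}).
Hypothesis pr1_g : forall s, pr1 (g s) = g s.
Hypothesis pr1_idem : forall x, pr1 (pr1 x) = pr1 x.
Hypothesis pr2M : forall x y, pr1 y = y -> pr2 (x * y) = pr1 x * y.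
Variables (rho t : 'I_N -> nat) (B : nat).
Hypothesis rho_inj : injective rho.
Hypothesis rhoB : forall s, (rho s < B)%N.

(** [rho] orders the generators, so these are the left ideals of initial segments, and [g_colon]
    makes every successive colon ideal again one of them. [pr1] and [pr2] play the part of the
    projections to degrees 1 and 2. *)
Definition gen_ideal (q : nat) (x : A) : Prop :=
  exists c : 'I_N -> A, x = \sum_(s | (rho s < q)%N) c s * g s.

Hypothesis g_colon : forall s x, gen_ideal (rho s) (x * g s) <-> gen_ideal (t s) x.

Lemma gen_ideal0 q : gen_ideal q 0.
Proof. by exists (fun=> 0); rewrite big1 // => s _; rewrite mul0r. Qed.

Lemma gen_idealD q x y : gen_ideal q x -> gen_ideal q y -> gen_ideal q (x + y).
Proof.
move=> [c ->] [d ->]; exists (fun s => c s + d s).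
by rewrite -big_split; apply: eq_bigr => s _; rewrite mulrDl.
Qed.

Lemma gen_ideal_gen q x s : (rho s < q)%N -> gen_ideal q (x * g s).
Proof.
move=> lts; exists (fun i => if i == s then x else 0).
rewrite (bigD1 s) //= eqxx big1 ?addr0 // => i /andP[_ /negPf->]; exact: mul0r.
Qed.

Definition supported r (rk : 'I_r -> nat) (q : nat) (w : 'rV[A]_r) : Prop :=
  forall i, (q <= rk i)%N -> w 0 i = 0.

(* A matrix of linear forms whose rows, ordered by [fm_rk], have as successive
   colon ideals the ideals [gen_ideal (fm_tau q)]. *)
Record filtered_matrix := FilteredMatrix {
  fm_row : nat;
  fm_col : nat;
  fm_mx : 'M[A]_(fm_row, fm_col);
  fm_rk : 'I_fm_row -> nat;
  fm_tau : 'I_fm_row -> nat;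
  fm_rk_inj : injective fm_rk;
  fm_lin : forall i j, pr1 (fm_mx i j) = fm_mx i j;
  fm_colon : forall q x,
    (exists2 w, supported fm_rk (fm_rk q) w & x *: row q fm_mx = w *m fm_mx) <->
    gen_ideal (fm_tau q) x }.

Section Syzygy.
Variable F : filtered_matrix.
Local Notation M := (fm_mx F).
Local Notation rk := (@fm_rk F).
Local Notation tau := (@fm_tau F).
Implicit Types (q : 'I_(fm_row F)) (p : 'I_(fm_row F) * 'I_N).

Definition syz_index : {set 'I_(fm_row F) * 'I_N} :=
  [set p | (rho p.2 < tau p.1)%N].

(** A linear syzygy in echelon form: its last nonzero position, in the order [rk], can only be row
    [p.1], where it has the entry [g p.2]. *)
Definition is_syz p (v : 'rV[A]_(fm_row F)) : Prop :=
  [/\ v *m M = 0, forall i, pr1 (v 0 i) = v 0 i, v 0 p.1 = g p.2 &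
      forall i, (rk p.1 < rk i)%N -> v 0 i = 0].

Lemma syz_exists p : exists v, p \in syz_index -> is_syz p v.
Proof.
have [pP|] := boolP (p \in syz_index); last by exists 0.
have /fm_colon[w suppw eqw] : gen_ideal (tau p.1) (g p.2).
  by rewrite -[g _]mul1r; apply: gen_ideal_gen; rewrite inE in pP.
exists (g p.2 *: delta_mx 0 p.1 - map_mx pr1 w) => _; split.
- apply/rowP=> j; rewrite mulmxBl -scalemxAl -rowE !mxE.
  apply/eqP; rewrite subr_eq0; apply/eqP.
  (* The degree 2 part of the equation shows that the coefficients [w] may be replaced by their
     linear parts. *)
  have /rowP/(_ j)/(congr1 pr2) := eqw; rewrite !mxE pr2M ?fm_lin // pr1_g => ->.
  rewrite raddf_sum; apply: eq_bigr => i _.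
  by rewrite !mxE pr2M ?fm_lin.
- move=> i; rewrite !mxE raddfB /= pr1_idem; congr (_ - _).
  by case: (i == _); rewrite ?mulr1 ?mulr0 ?raddf0 ?pr1_g.
- by rewrite !mxE !eqxx /= mulr1 suppw // raddf0 subr0.
move=> i lti; rewrite !mxE suppw ?(ltnW lti) // raddf0 subr0.
rewrite eqxx /=; case: (eqVneq i p.1) => [eqi|_]; last by rewrite mulr0.
by rewrite eqi ltnn in lti.
Qed.

Definition syz := projT1 (choice syz_exists).
Definition syzP p : p \in syz_index -> is_syz p (syz p) :=
  projT2 (choice syz_exists) p.

Definition syz_mx : 'M[A]_(#|syz_index|, fm_row F) :=
  \matrix_(i < #|syz_index|) syz (enum_val i).
(** Lexicographic order on pairs, the row first, coded in base [B] because [rho] is bounded by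
    [B]. *)
Definition syz_rk (i : 'I_#|syz_index|) : nat :=
  (rk (enum_val i).1 * B + rho (enum_val i).2)%N.
Definition syz_tau (i : 'I_#|syz_index|) : nat := t (enum_val i).2.

Lemma mul_syz_mx (a : 'I_(fm_row F) -> 'I_N -> A) :
  (\row_i a (enum_val i).1 (enum_val i).2) *m syz_mx =
  \sum_(p in syz_index) a p.1 p.2 *: syz p.
Proof.
rewrite big_enum_val /= mulmx_sum_row; apply: eq_bigr => i _.
by rewrite mxE rowK.
Qed.

Lemma mul_syz_mx_row q (P : pred 'I_N) (a : 'I_N -> A) :
  (forall s, P s -> (rho s < tau q)%N) ->
  (\row_i (if ((enum_val i).1 == q) && P (enum_val i).2
           then a (enum_val i).2 else 0)) *m syz_mx =
  \sum_(s | P s) a s *: syz (q, s).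
Proof.
move=> Plt; rewrite (mul_syz_mx (fun i s => if (i == q) && P s then a s else 0)).
rewrite big_mkcond /=.
transitivity (\sum_i \sum_s (if (i, s) \in syz_index then
  (if (i == q) && P s then a s else 0) *: syz (i, s) else 0)).
  by rewrite pair_bigA; apply: eq_bigr => -[].
rewrite (bigD1 q) //= [X in _ + X]big1 ?addr0 => [|i /negPf neiq]; last first.
  by rewrite big1 // => s _; rewrite neiq scale0r if_same.
rewrite [RHS]big_mkcond; apply: eq_bigr => s _; rewrite eqxx /=.
by case: ifP => [|/negbT]; case: ifP => // Ps; rewrite ?scale0r // inE Plt.
Qed.

(** Elimination from the top row downwards: the entry of a syzygy at its last row [q] lies in the
    colon ideal of that row, so a combination of the [syz (q, s)] cancels it and leaves a syzygy
    supported on earlier rows. *)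
Lemma ker_supported Q v : v *m M = 0 -> supported rk Q v ->
  exists2 w : 'rV[A]_#|syz_index|,
    (forall i, (Q <= rk (enum_val i).1)%N -> w 0 i = 0) & v = w *m syz_mx.
Proof.
elim: Q v => [|Q IHQ] v vM suppv.
  exists 0; first by move=> i _; rewrite mxE.
  by rewrite mul0mx; apply/rowP=> i; rewrite mxE suppv.
have [q /eqP rkq|none] := pickP (fun q => rk q == Q); last first.
  have [|w suppw ->] := IHQ v vM.
    by move=> i; rewrite leq_eqVlt eq_sym none => /suppv.
  by exists w => // i /ltnW/suppw.
have /fm_colon[c eqc] : exists2 w, supported rk (rk q) w &
    v 0 q *: row q M = w *m M.
  exists (v 0 q *: delta_mx 0 q - v).
    move=> i leqi; rewrite !mxE; rewrite eqxx /=; case: (eqVneq i q) => [->|neiq].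
      by rewrite mulr1 subrr.
    rewrite mulr0 sub0r suppv ?oppr0 // ltn_neqAle -rkq leqi andbT.
    by apply: contraNneq neiq => /fm_rk_inj->.
  by rewrite mulmxBl vM subr0 -scalemxAl -rowE.
pose P s := (rho s < tau q)%N; have Pq s : P s -> is_syz (q, s) (syz (q, s)).
  by move=> Ps; apply: syzP; rewrite inE.
pose v' := v - \sum_(s | P s) c s *: syz (q, s).
have [||w suppw eqw] := IHQ v'.
- rewrite mulmxBl vM mulmx_suml big1 ?subrr // => s /Pq[sM _ _ _].
  by rewrite -scalemxAl sM scaler0.
- move=> i leQi; rewrite !mxE summxE; case: (eqVneq i q) => [->|neiq].
    rewrite {1}eqc; apply/eqP; rewrite subr_eq0; apply/eqP/eq_bigr => s Ps.
    by have [_ _ eqs _] := Pq s Ps; rewrite mxE eqs.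
  have ltQi : (rk q < rk i)%N.
    by rewrite ltn_neqAle rkq leQi -rkq andbT; apply: contraNneq neiq => /fm_rk_inj->.
  rewrite suppv -?rkq // big1 ?subrr // => s Ps.
  by have [_ _ _ supps] := Pq s Ps; rewrite mxE supps // mulr0.
exists (w + \row_i (if ((enum_val i).1 == q) && P (enum_val i).2
           then c (enum_val i).2 else 0)).
  move=> i ltQi; rewrite !mxE suppw ?(ltnW ltQi) // add0r.
  by case: eqP => //= eqi; rewrite eqi rkq ltnn in ltQi.
by rewrite mulmxDl mul_syz_mx_row // -eqw subrK.
Qed.

Lemma syz_exact (v : 'rV[A]_(fm_row F)) :
  v *m M = 0 <-> exists w, v = w *m syz_mx.
Proof.
split=> [vM|[w ->]]; last first.
  rewrite -mulmxA (_ : syz_mx *m M = 0) ?mulmx0 //.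
  apply/row_matrixP=> i; rewrite row_mul rowK row0.
  by have [] := syzP (enum_valP i).
have [|w _ ->] := @ker_supported (\max_i rk i).+1 v vM; last by exists w.
by move=> i; rewrite leqNgt ltnS (leq_bigmax i).
Qed.

Lemma syz_rk_inj : injective syz_rk.
Proof.
move=> i j; rewrite /syz_rk => eqij; apply: enum_val_inj.
case: (enum_val i) (enum_val j) eqij => q s [q' s'] /= eqij.
have := rhoB s; have := rhoB s' => ltB' ltB.
have B0 : (0 < B)%N by apply: leq_ltn_trans ltB.
have /fm_rk_inj-> : rk q = rk q'.
  have := congr1 (divn^~ B) eqij.
  by rewrite /= !divnMDl // !divn_small // !addn0.
congr (_, _); apply: rho_inj; have := congr1 (modn^~ B) eqij.
by rewrite /= !modnMDl !modn_small.
Qed.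

Lemma syz_lin i j : pr1 (syz_mx i j) = syz_mx i j.
Proof. by have [_ lin _ _] := syzP (enum_valP i); rewrite mxE lin. Qed.

Lemma syz_rk_lt i j : (syz_rk j < syz_rk i)%N ->
  (rk (enum_val j).1 < rk (enum_val i).1)%N \/
  (enum_val j).1 = (enum_val i).1 /\ (rho (enum_val j).2 < rho (enum_val i).2)%N.
Proof.
rewrite /syz_rk; case: (enum_val i) (enum_val j) => q s [q' s'] /= lt.
have [ltq|ltq|/fm_rk_inj eqq] := ltngtP (rk q') (rk q); first by left.
  suff : (rk q * B + rho s <= rk q' * B)%N by move: lt; lia.
  apply: leq_trans (_ : (rk q).+1 * B <= _)%N; last by rewrite leq_mul2r ltq orbT.
  by rewrite mulSn addnC leq_add2r ltnW.
by right; move: lt; rewrite eqq ltn_add2l.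
Qed.

(** Write (q, s) for the index of row [i]. Comparing entries at [q], where the earlier syzygies have
    0 or an earlier generator, reduces the condition to [x * g s] being in [gen_ideal (rho s)],
    which is [g_colon]. Conversely, the remainder is supported before [q] and [ker_supported]
    absorbs it. *)
Lemma syz_colon i x :
  (exists2 w, supported syz_rk (syz_rk i) w & x *: row i syz_mx = w *m syz_mx) <->
  gen_ideal (syz_tau i) x.
Proof.
rewrite /syz_tau -g_colon rowK; have := syzP (enum_valP i).
have := enum_valP i; rewrite inE.
have rkP := @syz_rk_lt i.
case eqi : (enum_val i) rkP => [q s] /= rkP ltst [sM lins sq supps].
split=> [[w suppw /rowP/(_ q)]|[c eqc]].
  rewrite !mxE sq => ->; apply: big_ind => [||j _];
    [exact: gen_ideal0|exact: gen_idealD|].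
  rewrite !mxE; have [/suppw->|ltj] := leqP (syz_rk i) (syz_rk j).
    by rewrite mul0r; apply: gen_ideal0.
  have [_ _ jq suppj] := syzP (enum_valP j).
  case: (rkP j ltj) => [ltq|[eqq ltr]].
    by rewrite suppj // mulr0; apply: gen_ideal0.
  by rewrite -eqq jq; apply: gen_ideal_gen.
pose P s' := (rho s' < rho s)%N.
have Plt s' : P s' -> (rho s' < tau q)%N by move=> /ltn_trans; apply.
have Pq s' : P s' -> is_syz (q, s') (syz (q, s')).
  by move=> /Plt Ps; apply: syzP; rewrite inE.
pose v := x *: syz (q, s) - \sum_(s' | P s') c s' *: syz (q, s').
have [||w suppw eqw] := @ker_supported (rk q) v.
- rewrite mulmxBl -scalemxAl sM scaler0 mulmx_suml big1 ?subrr // => s' /Pq[s'M _ _ _].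
  by rewrite -scalemxAl s'M scaler0.
- move=> j; rewrite leq_eqVlt => /orP[/eqP/fm_rk_inj<-|ltj]; rewrite !mxE summxE.
    rewrite sq eqc; apply/eqP; rewrite subr_eq0; apply/eqP/eq_bigr => s' /Pq[_ _ s'q _].
    by rewrite mxE s'q.
  rewrite supps // mulr0 big1 ?subrr // => s' /Pq[_ _ _ supps'].
  by rewrite mxE supps' ?mulr0.
exists (w + \row_j (if ((enum_val j).1 == q) && P (enum_val j).2
           then c (enum_val j).2 else 0)); last first.
  by rewrite mulmxDl mul_syz_mx_row // -eqw subrK.
move=> j; rewrite /syz_rk eqi /= => lej; rewrite !mxE.
have leq_j : (rk q <= rk (enum_val j).1)%N.
  rewrite leqNgt; apply/negP=> ltq; move: lej; rewrite leqNgt.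
  apply/negP/negPn; apply: leq_trans (_ : (rk (enum_val j).1).+1 * B <= _)%N.
    by rewrite mulSn addnC ltn_add2r.
  by apply: leq_trans (leq_addr _ _); rewrite leq_mul2r ltq orbT.
rewrite suppw // add0r; case: eqP => //= eqj; case: ifP => // Pj.
by move: lej; rewrite eqj leq_add2l leqNgt -/(P _) Pj.
Qed.

Definition syz_filtered : filtered_matrix :=
  FilteredMatrix syz_rk_inj syz_lin syz_colon.

End Syzygy.

Definition gen_mx : 'M[A]_(N, 1) := \col_s g s.

Lemma gen_mx_lin i j : pr1 (gen_mx i j) = gen_mx i j.
Proof. by rewrite mxE. Qed.

Lemma gen_mx_colon q x :
  (exists2 w, supported rho (rho q) w & x *: row q gen_mx = w *m gen_mx) <->
  gen_ideal (t q) x.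
Proof.
rewrite -g_colon; split=> [[w suppw /rowP/(_ 0)]|[c eqc]].
  rewrite !mxE => ->; apply: big_ind => [||s _]; [exact: gen_ideal0|exact: gen_idealD|].
  rewrite mxE; have [/suppw->|lts] := leqP (rho q) (rho s).
    by rewrite mul0r; apply: gen_ideal0.
  exact: gen_ideal_gen.
exists (\row_s (if (rho s < rho q)%N then c s else 0)).
  by move=> s; rewrite mxE ltnNge => ->.
apply/rowP=> j; rewrite !mxE eqc [LHS]big_mkcond; apply: eq_bigr => s _; rewrite !mxE.
by case: ifP => // _; rewrite mul0r.
Qed.

Definition gen_filtered : filtered_matrix :=
  FilteredMatrix rho_inj gen_mx_lin gen_mx_colon.

Definition resolution_step i : filtered_matrix := iter i syz_filtered gen_filtered.

Variables (k : fieldType) (deg : nat -> A -> Prop) (aug : {rmorphism A -> k}).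
Hypothesis deg_pr1 : forall x, pr1 x = x -> deg 1 x.
Hypothesis aug0 : forall x, aug x = 0 <-> exists c : 'I_N -> A, x = \sum_s c s * g s.

(** The columns of each step are by definition the rows of the preceding one, so the matrices
    compose without casts. *)
Definition res_rank i := fm_col (resolution_step i).
Definition res_diff i : 'M[A]_(res_rank i.+1, res_rank i) := fm_mx (resolution_step i).
Definition res_deg i (_ : 'I_(res_rank i)) := i.
Definition res_aug : 'cV[k]_(res_rank 0) := const_mx 1.

Lemma res_diff_deg i a b :
  deg_diff deg (@res_deg i.+1 a) (@res_deg i b) (res_diff i a b).
Proof. by rewrite /deg_diff /res_deg leqnSn subSnn; apply/deg_pr1/fm_lin. Qed.

Lemma res_aug_deg a : @res_deg 0 a != 0%N -> res_aug a 0 = 0.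
Proof. by []. Qed.

Lemma res_aug_neq0 : res_aug != 0.
Proof.
by apply/eqP=> /matrixP/(_ 0 0); rewrite !mxE => /eqP; rewrite oner_eq0.
Qed.

Lemma res_exact0 (v : 'rV[A]_(res_rank 0)) :
  map_mx aug v *m res_aug = 0 <-> exists w, v = w *m res_diff 0.
Proof.
have -> : map_mx aug v *m res_aug = (aug (v 0 0))%:M.
  by apply/matrixP=> i j; rewrite !mxE big_ord1 !mxE mulr1 !ord1 eqxx.
transitivity (aug (v 0 0) = 0).
  split=> [/matrixP/(_ 0 0)|->]; first by rewrite !mxE.
  by rewrite raddf0.
rewrite aug0; split=> [[c eqc]|[w ->]].
  exists (\row_s c s); apply/rowP=> j; rewrite [j]ord1 eqc !mxE.
  by apply: eq_bigr => s _; rewrite !mxE.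
by exists (w 0); rewrite mxE; apply: eq_bigr => s _; rewrite mxE.
Qed.

Lemma res_exact i (v : 'rV[A]_(res_rank i.+1)) :
  v *m res_diff i = 0 <-> exists w, v = w *m res_diff i.+1.
Proof. exact: syz_exact. Qed.

Definition linear_resolution : free_resolution deg aug :=
  FreeResolution res_diff_deg res_aug_deg res_aug_neq0 res_exact0 res_exact.

(** The i-th module is generated in degree i only, so a vector of internal degree j different from i
    is already zero. *)
Theorem linear_quotients_koszul : koszul deg aug.
Proof.
move=> i j neij; exists linear_resolution => v vdeg _; exists 0.
  by move=> a _; rewrite mxE.
by rewrite mul0mx; apply/rowP=> a; rewrite mxE; apply: vdeg.
Qed.

End LinearResolution.

(** * Supersolvable arrangements have Koszul algebras *)

Section ExteriorGrading.
Variables (k : fieldType) (n : nat).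
Local Notation E := (extalg k n).
Local Notation gen := (@ext_gen k n).
Local Notation mon := (@ext_basis k n).
Implicit Types (S T U : {set 'I_n}) (x y z : E).

Lemma ext_degP d x :
  reflect (forall S, #|S| != d -> x S = 0) (x \in ext_deg k n d).
Proof.
apply: (iffP idP) => [/memv_sumP[u uP ->] S neSd|x0].
  rewrite sum_ffunE big1 // => T Td; have /vlineP[a ->] := uP T Td.
  rewrite ffunE ext_basisE (_ : (S == T) = false) ?scaler0 //.
  by apply: contraNF neSd => /eqP->.
rewrite (ext_sum_basis x); apply: memv_suml => S _.
have [Sd|/x0->] := eqVneq #|S| d; last by rewrite scale0r mem0v.
by apply: memvZ; apply: (subvP (sumv_sup S _ (subvv _))); rewrite ?Sd ?memv_line.
Qed.

Lemma ext_deg_basis S : mon S \in ext_deg k n #|S|.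
Proof.
by apply/ext_degP=> T; rewrite ext_basisE; case: (eqVneq T S) => [->|//]; rewrite eqxx.
Qed.

Lemma ext_deg_gen i : gen i \in ext_deg k n 1.
Proof. by have := ext_deg_basis [set i]; rewrite cards1. Qed.

Lemma ext_deg_mul d d' x y : x \in ext_deg k n d -> y \in ext_deg k n d' ->
  x * y \in ext_deg k n (d + d')%N.
Proof.
move=> /ext_degP xd /ext_degP yd; apply/ext_degP=> U neU.
rewrite ext_mulE big1 // => S sSU.
have [Sd|/xd->] := eqVneq #|S| d; last by rewrite mul0r mulr0.
rewrite yd ?mulr0 //; apply: contraNneq neU => Ud.
by rewrite -(cardsID S U) (setIidPr sSU) Sd Ud.
Qed.

Lemma ext_deg_der d x : x \in ext_deg k n d.+1 -> ext_der x \in ext_deg k n d.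
Proof.
move=> /ext_degP xd; apply/ext_degP=> U neU; rewrite ext_derE big1 // => i iU.
by rewrite xd ?mulr0 // cardsU1 iU.
Qed.

Definition ext_comp d x : E := [ffun S : {set 'I_n} => if #|S| == d then x S else 0].

Fact ext_comp_is_linear d : linear (ext_comp d).
Proof.
move=> a x y; apply/ffunP=> S; rewrite !ffunE.
by case: ifP; rewrite ?scaler0 ?addr0.
Qed.
HB.instance Definition _ d :=
  GRing.isLinear.Build k E E *:%R (ext_comp d) (ext_comp_is_linear d).

Lemma ext_comp_deg d x : ext_comp d x \in ext_deg k n d.
Proof. by apply/ext_degP=> S /negPf neS; rewrite ffunE neS. Qed.

Lemma ext_comp_id d x : x \in ext_deg k n d -> ext_comp d x = x.
Proof.
by move=> /ext_degP xd; apply/ffunP=> S; rewrite ffunE; case: eqVneq => // /xd->.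
Qed.

Lemma ext_comp_neq d d' x : x \in ext_deg k n d -> d != d' -> ext_comp d' x = 0.
Proof.
move=> /ext_degP xd ned; apply/ffunP=> S; rewrite !ffunE.
by case: eqVneq => // Sd'; rewrite xd // Sd' eq_sym.
Qed.

Lemma ext_comp_sum x : x = \sum_(d < n.+1) ext_comp d x.
Proof.
apply/ffunP=> S; have ltSn : (#|S| < n.+1)%N.
  by rewrite ltnS -[n in (_ <= n)%N]card_ord max_card.
rewrite sum_ffunE (bigD1 (Ordinal ltSn)) //= big1 => [|d neS].
  by rewrite ffunE eqxx addr0.
rewrite ffunE (_ : (_ == _) = false) //; apply: contraNF neS => /eqP eqd.
by apply/eqP/val_inj.
Qed.

Lemma ext_compMr d d' x y : y \in ext_deg k n d' ->
  ext_comp (d + d')%N (x * y) = ext_comp d x * y.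
Proof.
move=> /ext_degP yd; apply/ffunP=> U; rewrite ffunE !ext_mulE.
have -> : (if #|U| == (d + d')%N then \sum_(S : {set 'I_n} | S \subset U)
     (-1) ^+ inversions S (U :\: S) * (x S * y (U :\: S)) else 0) =
   \sum_(S : {set 'I_n} | S \subset U) (if #|U| == (d + d')%N then
     (-1) ^+ inversions S (U :\: S) * (x S * y (U :\: S)) else 0) :> k.
  by case: ifP => // _; rewrite big1.
apply: eq_bigr => S sSU; rewrite ffunE.
have [Ud|/yd->] := eqVneq #|U :\: S| d'; last by rewrite !mulr0 if_same.
rewrite -(cardsID S U) (setIidPr sSU) Ud eqn_add2r.
by case: ifP => // _; rewrite mul0r mulr0.
Qed.

Lemma ext_aug_gen i : ext_aug (gen i) = 0.
Proof.
rewrite /ext_aug ext_basisE (_ : (_ == _) = false) // eq_sym.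
by apply/negP=> /eqP/setP/(_ i); rewrite !inE eqxx.
Qed.

Lemma ext_augP x : ext_aug x = 0 -> exists c : 'I_n -> E, x = \sum_i c i * gen i.
Proof.
move=> x0; rewrite (ext_sum_basis x).
apply: (big_ind (fun z => exists c : 'I_n -> E, z = \sum_i c i * gen i)).
- by exists (fun=> 0); rewrite big1 // => i _; rewrite mul0r.
- move=> y z [c ->] [d ->]; exists (fun i => c i + d i).
  by rewrite -big_split; apply: eq_bigr => i _; rewrite mulrDl.
move=> S _; have [->|[s sS]] := set_0Vmem S.
  have -> : x set0 = 0 by exact: x0.
  by exists (fun=> 0); rewrite scale0r big1 // => i _; rewrite mul0r.
exists (fun i => if i == s then
  x S *: ((-1) ^+ inversions (S :\ s) [set s] *: mon (S :\ s)) else 0).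
rewrite (bigD1 s) //= eqxx [X in _ + X]big1 => [|i /negPf->]; last by rewrite mul0r.
by rewrite addr0 -{2}(setD1K sS) ext_basisU1r ?setD11 // -!scalerAl.
Qed.

End ExteriorGrading.

(** * Homogeneous components in a quotient by a homogeneous ideal *)

Section GradedQuotient.
Variables (k : fieldType) (n : nat) (I : ext_ideal k n).
Hypothesis I_homog : forall d x, x \in eideal I -> ext_comp d x \in eideal I.
Local Notation E := (extalg k n).
Local Notation A := (extquot I).
Local Notation pi := (\pi_(A) : E -> A).

Definition quot_comp d (a : A) : A := pi (ext_comp d (repr a)).

Lemma quot_compE d x : quot_comp d (pi x) = pi (ext_comp d x).
Proof.
apply/extquot_eqP; rewrite -linearB /=; apply: I_homog.
by apply/extquot_eqP; rewrite reprK.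
Qed.

Lemma extquot_pi0 : pi 0 = 0.
Proof. by rewrite -(subrr (0 : E)) extquot_piD extquot_piN subrr. Qed.

Lemma extquot_pi_eq0 x : pi x = 0 <-> x \in eideal I.
Proof.
rewrite -extquot_pi0; split=> [/extquot_eqP|Ix]; first by rewrite subr0.
by apply/extquot_eqP; rewrite subr0.
Qed.

Lemma extquot_piMr x y : pi (x * y) = pi x * pi y.
Proof. exact: extquot_piM. Qed.

Lemma extquot_pi_sum (J : Type) (r : seq J) (P : pred J) (F : J -> E) :
  pi (\sum_(j <- r | P j) F j) = \sum_(j <- r | P j) pi (F j).
Proof. exact: (big_morph pi (@extquot_piD _ _ I) extquot_pi0). Qed.

Fact quot_comp_is_zmod_morphism d : zmod_morphism (quot_comp d).
Proof.
elim/quotW=> x; elim/quotW=> y.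
by rewrite -extquot_piN -extquot_piD !quot_compE linearB extquot_piD extquot_piN.
Qed.

Lemma quot_comp_idem d a : quot_comp d (quot_comp d a) = quot_comp d a.
Proof.
elim/quotW: a => x.
by rewrite (quot_compE d x) quot_compE (ext_comp_id (ext_comp_deg d x)).
Qed.

Lemma quot_comp_degE d a : quot_comp d a = a <-> extquot_deg d a.
Proof.
elim/quotW: a => x; split=> [<-|[y yd ->]].
  by rewrite quot_compE; exists (ext_comp d x); rewrite ?ext_comp_deg.
by rewrite quot_compE ext_comp_id.
Qed.

Lemma quot_compM d d' a b : quot_comp d' b = b ->
  quot_comp (d + d')%N (a * b) = quot_comp d a * b.
Proof.
elim/quotW: a => x /quot_comp_degE[y yd ->].
by rewrite (quot_compE d x) -!extquot_piMr quot_compE ext_compMr.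
Qed.

End GradedQuotient.

Section FiberTypeKoszul.
Variables (K : fieldType) (V : vectType K) (n : nat) (H : arrangement V n).
Variable k : fieldType.
Local Notation E := (extalg k n).
Local Notation gen := (@ext_gen k n).
Local Notation mon := (@ext_basis k n).
Local Notation I := (os_ideal H k).
Local Notation A := (extquot I).
Local Notation pi := (\pi_(A) : E -> A).

Lemma os_ideal_homog d x : x \in eideal I -> ext_comp d x \in eideal I.
Proof.
suff /subvP sub : (eideal I <= linfun (@ext_comp k n d) @^-1: eideal I)%VS.
  by move/sub; rewrite -memv_preim lfunE.
apply: os_ideal_sub => S J T dJ; rewrite -memv_preim lfunE /=.
have hom : mon S * ext_der (mon J) * mon T \in ext_deg k n (#|S| + #|J|.-1 + #|T|)%N.
  rewrite !ext_deg_mul ?ext_deg_basis // ext_deg_der // prednK ?ext_deg_basis //.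
  by apply: leq_ltn_trans dJ.
have [<-|ned] := eqVneq (#|S| + #|J|.-1 + #|T|)%N d; last first.
  by rewrite (ext_comp_neq hom ned) mem0v.
by rewrite ext_comp_id // os_ideal_mulr // os_ideal_mull // os_ideal_der.
Qed.

HB.instance Definition _ d := GRing.isZmodMorphism.Build A A
  (@quot_comp k n I d) (quot_comp_is_zmod_morphism os_ideal_homog d).

Lemma quot_comp_gen s : quot_comp 1 (pi (gen s)) = pi (gen s).
Proof. by rewrite (quot_compE os_ideal_homog) ext_comp_id ?ext_deg_gen. Qed.

Lemma extquot_augP a : extquot_aug a = 0 <->
  exists c : 'I_n -> A, a = \sum_i c i * pi (gen i).
Proof.
split=> [|[c ->]].
  elim/quotW: a => x; rewrite extquot_augE => /ext_augP[c ->].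
  exists (pi \o c); rewrite extquot_pi_sum; apply: eq_bigr => i _.
  by rewrite extquot_piMr.
rewrite raddf_sum big1 // => i _.
by rewrite /= rmorphM /= extquot_augE ext_aug_gen mulr0.
Qed.

Variables (lev : 'I_n -> nat) (levP : fiber_level H lev).

(** Lexicographic in level and index. The cut at [(lev a).+1 * n] then falls just after the level of
    [a] ([level_rank_ltS]), where the colon ideal by e_a ends. *)
Definition level_rank (s : 'I_n) : nat := (lev s * n + s)%N.

Lemma level_rank_lt a b : (lev a < lev b)%N -> (level_rank a < level_rank b)%N.
Proof.
move=> ltab; rewrite /level_rank.
apply: leq_trans (_ : (lev a).+1 * n <= _)%N.
  by rewrite mulSn addnC ltn_add2r.
by apply: leq_trans (leq_addr _ _); rewrite leq_mul2r ltab orbT.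
Qed.

Lemma level_rank_le a b : (level_rank a <= level_rank b)%N -> (lev a <= lev b)%N.
Proof. by apply: contraTT; rewrite -!ltnNge; apply: level_rank_lt. Qed.

Lemma level_rank_inj : injective level_rank.
Proof.
move=> a b eqab; have eqlev : lev a = lev b.
  by apply/eqP; rewrite eqn_leq !level_rank_le ?eqab.
by move: eqab; rewrite /level_rank eqlev => /addnI/val_inj.
Qed.

Lemma level_rank_ltS a s : (level_rank s < (lev a).+1 * n)%N = (lev s <= lev a)%N.
Proof.
apply/idP/idP => [|les].
  apply: contraTT; rewrite -ltnNge -leqNgt => lts.
  by apply: leq_trans (leq_addr _ _); rewrite leq_mul2r lts orbT.
apply: leq_trans (_ : (lev s).+1 * n <= _)%N; last by rewrite leq_mul2r ltnS les orbT.
by rewrite /level_rank mulSn addnC ltn_add2r.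
Qed.

Lemma gen_ideal_pi q x : gen_ideal (pi \o gen) level_rank q (pi x) <->
  in_gen_ideal H [set s | (level_rank s < q)%N] x.
Proof.
split=> [[c eqc]|[c Ic]].
  exists (fun s => repr (c s)); apply/extquot_eqP; rewrite eqc extquot_pi_sum.
  apply: eq_big => [s|s _]; first by rewrite inE.
  by rewrite extquot_piMr reprK.
exists (fun s => pi (c s)); move/extquot_eqP: Ic => ->; rewrite extquot_pi_sum.
apply: eq_big => [s|s _]; first by rewrite inE.
by rewrite extquot_piMr.
Qed.

Lemma fiber_level_koszul : os_koszul H k.
Proof.
have bound s : (level_rank s < (\max_s level_rank s).+1)%N by rewrite ltnS leq_bigmax.
apply: (@linear_quotients_koszul A n (pi \o gen) (@quot_comp _ _ I 1)
  (@quot_comp _ _ I 2) quot_comp_gen _ _ level_rank (fun s => (lev s).+1 * n)%N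
  _ level_rank_inj bound).
- exact: (quot_comp_idem os_ideal_homog).
- by move=> x y y1; apply: (quot_compM os_ideal_homog).
- move=> s; elim/quotW=> x; rewrite /= -extquot_piMr !gen_ideal_pi.
  rewrite (_ : [set s' | (level_rank s' < (lev s).+1 * n)%N] =
    [set s' | (lev s' <= lev s)%N]); last first.
    by apply/setP=> s'; rewrite !inE level_rank_ltS.
  apply: os_colon => //.
  + by move=> s1; rewrite !inE => lt1 c /level_rank_lt lt2; rewrite inE (ltn_trans lt2).
  + by rewrite inE ltnn.
  + by move=> s1 /level_rank_lt; rewrite inE.
  + by move=> s1; rewrite inE => /ltnW/level_rank_le.
- by move=> x /(quot_comp_degE os_ideal_homog).
- exact: extquot_augP.
Qed.

End FiberTypeKoszul.

Theorem supersolvable_koszul (K : fieldType) (V : vectType K) (n : nat)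
  (H : arrangement V n) (k : fieldType) : supersolvable H -> os_koszul H k.
Proof.
by move=> /supersolvable_fiber_level[lev levP]; apply: fiber_level_koszul levP.
Qed.

(** * Koszul algebras are quadratic *)

Section KoszulQuadratic.
Variables (K : fieldType) (V : vectType K) (n : nat) (H : arrangement V n).
Variable k : fieldType.
Local Notation E := (extalg k n).
Local Notation gen := (@ext_gen k n).
Local Notation mon := (@ext_basis k n).
Local Notation I := (os_ideal H k).
Local Notation A := (extquot I).
Local Notation pi := (\pi_(A) : E -> A).
Local Notation comp := (@quot_comp _ _ I).
Local Notation homog := (@os_ideal_homog _ _ _ H k).

(** A circuit of one element would put the whole space in a hyperplane, and one of two elements
    would make two distinct hyperplanes equal. *)
Lemma dependent_card (J : {set 'I_n}) : dependent H J -> (2 < #|J|)%N.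
Proof.
case/dependent_circuit=> C [/subset_leq_card leCJ /set0Pn[i iC]] cyc.
apply: leq_trans leCJ; rewrite ltnNge (cardsD1 i C) iC ltnS; apply/negP=> leC.
have [Ci0|[j jCi]] := set_0Vmem (C :\ i).
  have := cyc i iC; rewrite Ci0 /flat big_set0 => /dimvS.
  by have := hplane_codim H i; rewrite /codim; lia.
have [neji jC] : j != i /\ j \in C by move: jCi; rewrite !inE => /andP[].
have := cyc j jC; have -> : C :\ j = [set i].
  apply/eqP; rewrite eqEsubset sub1set !inE iC (eq_sym i) neji !andbT.
  apply/subsetP=> s; rewrite !inE => /andP[nesj sC]; apply: contraLR leC => nesi.
  rewrite -ltnNge (cardsD1 j) (cardsD1 s) !inE neji jC nesj nesi sC.
  by rewrite addnCA.
rewrite /flat big_set1 => sij; case/eqP: neji.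
exact/esym/(@hplane_sub_eq _ _ _ H).
Qed.

Lemma ext_compMr0 (d d' : nat) (x y : E) : y \in ext_deg k n d' -> (d < d')%N ->
  ext_comp d (x * y) = 0.
Proof.
move=> /ext_degP yd ltd; apply/ffunP=> U; rewrite [LHS]ffunE [RHS]ffunE.
case: eqP => // Ud; rewrite ext_mulE big1 // => S sSU.
rewrite yd ?mulr0 //; apply: contraTneq ltd => <-; rewrite -leqNgt -Ud.
by rewrite subset_leq_card ?subsetDl.
Qed.

Lemma ext_comp0 (x : E) : ext_aug x = 0 -> ext_comp 0 x = 0.
Proof.
move=> x0; apply/ffunP=> S; rewrite !ffunE cards_eq0.
by case: eqP => // ->.
Qed.

(** The projection onto the component described by [deg_diff], with value 0 in negative degree. *)
Definition comp_diff (a b : nat) (x : A) : A :=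
  if (b <= a)%N then comp (a - b)%N x else 0.

Lemma comp_diffD a b x y : comp_diff a b (x + y) = comp_diff a b x + comp_diff a b y.
Proof. by rewrite /comp_diff; case: ifP; rewrite ?addr0 // raddfD. Qed.

Lemma comp_diff0 a b : comp_diff a b 0 = 0.
Proof. by rewrite /comp_diff raddf0 if_same. Qed.

Lemma comp_diffM a b c (x y : A) : deg_diff (@extquot_deg _ _ I) b c y ->
  comp_diff a c (x * y) = comp_diff a b x * y.
Proof.
rewrite /deg_diff /comp_diff; case: leqP => [lecb ydeg|_ ->]; last first.
  by rewrite !mulr0 raddf0 if_same.
have [leba|ltab] := leqP b a.
  rewrite (leq_trans lecb leba) (_ : (a - c = a - b + (b - c))%N); last first.
    by rewrite addnBA // subnK.
  by rewrite (quot_compM homog) //; apply/(quot_comp_degE homog).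
rewrite mul0r; case: leqP => // leca; case: ydeg => z zd ->.
elim/quotW: x => x; rewrite -extquot_piMr (quot_compE homog).
by rewrite (ext_compMr0 _ zd) ?extquot_pi0 // ltn_sub2r // (leq_ltn_trans leca).
Qed.

Lemma comp_diff_aug a b x : a != b -> extquot_aug (comp_diff a b x) = 0.
Proof.
rewrite /comp_diff; case: leqP => [leba neab|_ _]; last exact: raddf0.
elim/quotW: x => x; rewrite (quot_compE homog) extquot_augE /ext_aug ffunE cards0.
rewrite eq_sym subn_eq0 leqNgt; case: ltngtP leba neab => //.
Qed.

Definition quot_const (c : k) : A := pi (c *: 1).

Lemma quot_const_aug c : extquot_aug (quot_const c) = c.
Proof. by rewrite extquot_augE /ext_aug ffunE ffunE eqxx [LHS]mulr1. Qed.

Lemma quot_const_deg c : comp 0 (quot_const c) = quot_const c.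
Proof.
rewrite (quot_compE homog) ext_comp_id // memvZ //.
by have := @ext_deg_basis k n set0; rewrite cards0.
Qed.

Lemma quot_constM c d : quot_const c * quot_const d = quot_const (c * d).
Proof. by rewrite -extquot_piMr -scalerAl mul1r scalerA. Qed.

Lemma quot_const1 : quot_const 1 = 1.
Proof. by rewrite /quot_const scale1r. Qed.

Definition quot_gens : 'cV[A]_n := \col_i pi (gen i).

Section Compare.
Variable F : free_resolution (@extquot_deg k n I) (@extquot_aug k n I).
Local Notation d := (fr_diff F).
Local Notation G := quot_gens.
Local Notation aug_mx := (map_mx (@extquot_aug k n I)).
Local Notation r := (fr_rank F).

Definition row_comp j i (v : 'rV[A]_(r i)) : 'rV[A]_(r i) :=
  \row_b comp_diff j (fr_deg b) (v 0 b).

Lemma row_comp_diff j i (v : 'rV[A]_(r i.+1)) :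
  row_comp j v *m d i = row_comp j (v *m d i).
Proof.
apply/rowP=> c; rewrite !mxE.
rewrite (big_morph _ (comp_diffD j (fr_deg c)) (comp_diff0 _ _)).
by apply: eq_bigr => b _; rewrite mxE (comp_diffM _ _ (fr_diff_deg b c)).
Qed.

Lemma diff_diff i : d i.+1 *m d i = 0.
Proof.
apply/row_matrixP=> b; rewrite row_mul row0.
by apply/fr_exact; exists (delta_mx 0 b); rewrite -rowE.
Qed.

Lemma aug_diff0 : aug_mx (d 0) *m fr_aug F = 0.
Proof.
apply/row_matrixP=> b; rewrite row_mul row0 -map_row.
by apply/fr_exact0; exists (delta_mx 0 b); rewrite -rowE.
Qed.

Lemma gens_factor m (M : 'M[A]_(m, 1)) : aug_mx M = 0 -> exists B, M = B *m G.
Proof.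
move=> M0.
have /choice[c cP] : forall i, exists c : 'I_n -> A, M i 0 = \sum_j c j * pi (gen j).
  by move=> i; apply/extquot_augP; have /matrixP/(_ i 0) := M0; rewrite !mxE.
exists (\matrix_(i, j) c i j); apply/matrixP=> i j; rewrite [j]ord1 cP mxE.
by apply: eq_bigr => s _; rewrite !mxE.
Qed.

Lemma aug_gens : aug_mx G = 0.
Proof. by apply/matrixP=> i j; rewrite !mxE extquot_augE ext_aug_gen. Qed.

(* A relation [m] among the generators of degree [j] is decomposable if
   Tor_2 vanishes in degree [j]: the two comparison maps between [F] and the
   beginning of the minimal resolution carry [m] into A_+ times the relations,
   up to A_+ times the homotopy. *)
Lemma tor2_decomposable j (m : 'rV[A]_n) : (1 < j)%N ->
    (forall v : 'rV[k]_(r 2), tor_deg j v -> tor_cycle v ->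
      exists2 w : 'rV[k]_(r 3), tor_deg j w & v = w *m tor_diff F 2) ->
    (forall i, comp j.-1 (m 0 i) = m 0 i) -> m *m G = 0 ->
  exists p (a : 'rV[A]_p) (P : 'M[A]_(p, n)),
    [/\ m = a *m P, aug_mx a = 0 & P *m G = 0].
Proof.
move=> j_gt1 tor0 m_deg mG0.
have m_aug : aug_mx m = 0.
  apply/matrixP=> i b; rewrite (ord1 i) !mxE -m_deg.
  have := @comp_diff_aug j.-1 0 (m 0 b); rewrite /comp_diff /= subn0; apply.
  by rewrite -lt0n; case: j j_gt1 {tor0 m_deg} => [|[]].
have [a a_neq0] : exists a, fr_aug F a 0 != 0.
  apply/existsP; apply: contraT; rewrite negb_exists => /forallP a0.
  case/eqP: (fr_aug_neq0 F); apply/matrixP=> a b; rewrite [b]ord1 !mxE.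
  by apply/eqP; have := a0 a; rewrite negbK.
have a_deg : fr_deg a = 0%N.
  by apply/eqP; apply: contraNT a_neq0 => /fr_aug_deg->.
(* [u] maps [A] to the first free module and [c0] maps it back, both over the identity of the
   residue field; the inverse scalar normalises the composite to 1. *)
pose u : 'rV[A]_(r 0) := \row_b (if b == a then quot_const (fr_aug F a 0)^-1 else 0).
pose c0 : 'cV[A]_(r 0) := map_mx quot_const (fr_aug F).
have uc0 : u *m c0 = 1.
  apply/matrixP=> i b; rewrite (ord1 i) [b]ord1 !mxE (bigD1 a) //=.
  rewrite big1 => [|b' /negPf neb].
    by rewrite !mxE eqxx quot_constM mulVf // quot_const1 addr0.
  by rewrite mxE neb mul0r.
have [W0 W0P] : exists W0, W0 *m d 0 = G *m u.
  have /choice[w wP] : forall i, exists w, row i (G *m u) = w *m d 0.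
    move=> i; apply/fr_exact0; rewrite map_row -row_mul map_mxM aug_gens.
    by rewrite mul0mx mul0mx row0.
  exists (\matrix_i w i); apply/row_matrixP=> i; rewrite row_mul rowK.
  by rewrite -wP.
(* Only the degree 1 part of the lift is kept, so that [m *m W] is homogeneous of degree [j]. *)
pose W : 'M[A]_(n, r 1) := \matrix_i row_comp 1 (row i W0).
have WP : W *m d 0 = G *m u.
  apply/row_matrixP=> i; rewrite row_mul rowK row_comp_diff -row_mul W0P.
  apply/rowP=> b; rewrite !mxE big_ord1 !mxE.
  have [->|_] := eqVneq b a; last by rewrite mulr0 comp_diff0.
  rewrite a_deg -[comp_diff 1 0 _]/(comp (1 + 0)%N _).
  by rewrite (quot_compM homog) ?quot_const_deg // quot_comp_gen.
have [z zP] : exists z, m *m W = z *m d 1.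
  by apply/fr_exact; rewrite -mulmxA WP mulmxA mG0 mul0mx.
have {}zP : m *m W = row_comp j z *m d 1.
  rewrite row_comp_diff -zP; apply/rowP=> b; rewrite !mxE.
  rewrite (big_morph _ (comp_diffD j (fr_deg b)) (comp_diff0 _ _)).
  apply: eq_bigr => i _; rewrite !mxE.
  have [leb1|ltb1] := leqP (fr_deg b) 1; last first.
    rewrite (_ : comp_diff 1 _ _ = 0) ?mulr0 ?comp_diff0 //.
    by rewrite /comp_diff leqNgt ltb1.
  rewrite /comp_diff leb1 (leq_trans leb1 (ltnW j_gt1)).
  rewrite (_ : (j - fr_deg b = j.-1 + (1 - fr_deg b))%N); last by lia.
  by rewrite (quot_compM homog) ?m_deg // (quot_comp_idem homog).
set y := row_comp j z in zP.
(* Since [m] has entries in the augmentation ideal, the reduction of [y] is a cycle of degree [j],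
   hence a boundary. Subtracting a lift of it leaves [y'] with entries in the augmentation ideal. *)
have [||w _ wP] := tor0 (aug_mx y).
- by move=> b neb; rewrite !mxE comp_diff_aug // eq_sym.
- by rewrite /= /tor_diff -map_mxM -zP map_mxM m_aug mul0mx.
pose y' := y - map_mx quot_const w *m d 2.
have y'P : m *m W = y' *m d 1 by rewrite mulmxBl -mulmxA diff_diff mulmx0 subr0.
have y'_aug : aug_mx y' = 0.
  rewrite map_mxB map_mxM wP (_ : aug_mx (map_mx _ w) = w) ?subrr //.
  by apply/matrixP=> s b; rewrite !mxE quot_const_aug.
have [B BP] : exists B, d 0 *m c0 = B *m G.
  apply: gens_factor; rewrite map_mxM (_ : aug_mx c0 = fr_aug F) ?aug_diff0 //.
  by apply/matrixP=> s b; rewrite !mxE quot_const_aug.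
(* From [m *m W = y' *m d 1] the vector [m] is the product of [y'] with [d 1 *m B] minus that of [m]
   with [W *m B - 1%:M]. Both matrices consist of relations: the first because consecutive
   differentials compose to 0, the second because [u *m c0 = 1]. *)
exists (r 2 + n)%N, (row_mx y' (- m)), (col_mx (d 1 *m B) (W *m B - 1%:M)); split.
- rewrite mul_row_col mulmxA -y'P mulNmx mulmxBr mulmx1 mulmxA.
  by rewrite opprB addrCA subrr addr0.
- by rewrite map_row_mx map_mxN m_aug y'_aug oppr0 row_mx0.
rewrite mul_col_mx -mulmxA -BP mulmxA diff_diff mul0mx mulmxBl -mulmxA -BP.
by rewrite mulmxA WP -mulmxA uc0 mulmx1 mul1mx subrr col_mx0.
Qed.

End Compare.

Lemma os_ideal_low d x : (d < 2)%N -> x \in eideal I -> ext_comp d x = 0.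
Proof.
move=> ltd; apply: (@os_ideal_ker _ _ _ _ _ _ (@ext_comp k n d)) => S J T dJ /=.
apply: (@ext_comp_neq _ _ (#|S| + #|J|.-1 + #|T|)%N).
  rewrite !ext_deg_mul ?ext_deg_basis // ext_deg_der // prednK ?ext_deg_basis //.
  by apply: leq_ltn_trans dJ.
by have := dependent_card dJ; lia.
Qed.

(** The coefficients of [x], cut down to degree [j.-1], form a relation among the generators of the
    quotient, to which [tor2_decomposable] applies. The [u i] are the errors made in lifting the
    resulting factorisation to the exterior algebra. *)
Lemma os_ideal_decomposable j (x : E) : os_koszul H k -> (2 < j)%N ->
    x \in eideal I -> x \in ext_deg k n j ->
  exists p (a : 'I_p -> E) (y : 'I_p -> E) (u : 'I_n -> E),
    [/\ x = \sum_i u i * gen i + \sum_s a s * y s, forall i, u i \in eideal I,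
        forall s, ext_aug (a s) = 0 & forall s, y s \in eideal I].
Proof.
move=> koszulH j_gt2 Ix xj; have j_gt0 : (0 < j)%N by apply: leq_trans j_gt2.
have [F torF] := koszulH 2 j (negbT (ltn_eqF j_gt2)).
have [c eqx] : exists c : 'I_n -> E, x = \sum_i c i * gen i.
  by apply: ext_augP; apply: (@eideal_aug _ _ I).
pose m : 'rV[A]_n := \row_i pi (ext_comp j.-1 (c i)).
have {}eqx : x = \sum_i ext_comp j.-1 (c i) * gen i.
  rewrite -{1}(ext_comp_id xj) eqx linear_sum /=; apply: eq_bigr => i _.
  by rewrite -{1}(prednK j_gt0) -addn1 ext_compMr ?ext_deg_gen.
have m_deg i : quot_comp j.-1 (m 0 i) = m 0 i.
  by rewrite mxE (quot_compE homog) (ext_comp_id (ext_comp_deg _ _)).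
have mG0 : m *m quot_gens = 0.
  apply/matrixP=> a b; rewrite (ord1 a) !mxE.
  transitivity (pi x); last by apply/extquot_pi_eq0.
  rewrite eqx extquot_pi_sum; apply: eq_bigr => i _.
  by rewrite extquot_piMr !mxE.
have [p [a [P [eqm a0 PG0]]]] := tor2_decomposable (ltnW j_gt2) torF m_deg mG0.
pose P' s i := repr (P s i : A); pose y s : E := \sum_i P' s i * gen i.
exists p, (fun s => repr (a 0 s : A)), y.
exists (fun i => ext_comp j.-1 (c i) - \sum_s repr (a 0 s) * P' s i); split.
- rewrite (eq_bigr (fun i => ext_comp j.-1 (c i) * gen i -
    \sum_s repr (a 0 s) * P' s i * gen i)) => [|i _]; last by rewrite mulrBl mulr_suml.
  rewrite sumrB -eqx exchange_big /= (eq_bigr (fun s => repr (a 0 s : A) * y s)).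
    by rewrite subrK.
  by move=> s _; rewrite mulr_sumr; apply: eq_bigr => i _; rewrite mulrA.
- move=> i; apply/extquot_eqP; rewrite extquot_pi_sum.
  have /matrixP/(_ 0 i) := eqm; rewrite !mxE => ->.
  by apply: eq_bigr => s _; rewrite extquot_piMr !reprK.
- by move=> s; have /matrixP/(_ 0 s) := a0; rewrite !mxE.
move=> s; apply/extquot_pi_eq0; rewrite extquot_pi_sum.
have /matrixP/(_ s 0) := PG0; rewrite [RHS]mxE => PGs0; rewrite -[RHS]PGs0 mxE.
by apply: eq_bigr => i _; rewrite extquot_piMr reprK mxE.
Qed.

(** Strong induction on the degree. In the degree [j] part of a decomposition, the [u i] enter in
    degree [j.-1] and the [y s] in degrees below [j]: those above contribute nothing, and in degree
    [j] they meet the constant term of [a s], which is 0. *)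
Theorem koszul_quadratic : os_koszul H k -> os_quadratic H k.
Proof.
move=> koszulH; set Q := ideal_gen (eideal I :&: ext_deg k n 2).
have mulQ x y z : y \in Q -> x * y * z \in Q.
  by move=> Qy; rewrite ideal_gen_mulr // ideal_gen_mull.
suff homQ j x : x \in eideal I -> x \in ext_deg k n j -> x \in Q.
  apply/eqP; rewrite eqEsubv; apply/andP; split; apply/subvP=> x.
    move=> Ix; rewrite (ext_comp_sum x) memv_suml // => d _.
    by apply: (homQ d); rewrite ?ext_comp_deg ?homog.
  move: x; apply/subvP/prodvP=> u v Iu _; apply: eideal_mulr.
  move: u Iu; apply/subvP/prodvP=> u w _.
  by rewrite memv_cap => /andP[Iw _]; apply: eideal_mull.
elim/ltn_ind: j x => j IHj x Ix xj.
have [lej|j_gt2] := leqP j 2.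
  move: lej; rewrite leq_eqVlt => /orP[/eqP j2|ltj2].
    by apply: (subvP (sub_ideal_gen _)); rewrite memv_cap Ix -j2.
  by rewrite -(ext_comp_id xj) (os_ideal_low ltj2 Ix) mem0v.
have [p [a [y [u [eqx Iu a0 Iy]]]]] := os_ideal_decomposable koszulH j_gt2 Ix xj.
rewrite -(ext_comp_id xj) eqx linearD !linear_sum memvD //= memv_suml //.
  move=> i _; have -> : j = (j.-1 + 1)%N by lia.
  rewrite ext_compMr ?ext_deg_gen // -[X in X * _]mul1r mulQ //.
  by apply: (IHj j.-1); rewrite ?homog ?ext_comp_deg //; lia.
move=> s _; rewrite (ext_comp_sum (y s)) mulr_sumr linear_sum memv_suml //= => q _.
have [ltqj|ltjq|eqqj] := ltngtP q j.
- have -> : j = (j - q + q)%N by rewrite subnK // ltnW.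
  rewrite ext_compMr ?ext_comp_deg // -[_ * _]mulr1 mulQ //.
  by apply: (IHj q); rewrite ?homog ?ext_comp_deg.
- by rewrite (ext_compMr0 _ (ext_comp_deg _ _) ltjq) mem0v.
rewrite -[j]add0n eqqj ext_compMr ?ext_comp_deg //.
by rewrite ext_comp0 // mul0r mem0v.
Qed.

End KoszulQuadratic.

(** * Quadratic graphic arrangements come from chordal graphs *)

Section QuadraticCircuits.
Variables (K : fieldType) (V : vectType K) (n : nat) (H : arrangement V n).
Variable k : fieldType.
Local Notation E := (extalg k n).
Local Notation gen := (@ext_gen k n).
Local Notation mon := (@ext_basis k n).
Local Notation I := (eideal (os_ideal H k)).
Implicit Types (S J C : {set 'I_n}) (x y : E).

Lemma ext_mulr_coef0 S x y :
  (forall T : {set 'I_n}, T \subset S -> x T = 0) -> (x * y) S = 0.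
Proof. by move=> x0; rewrite ext_mulE big1 // => T /x0->; rewrite mul0r mulr0. Qed.

Lemma ext_mull_coef0 S x y :
  (forall T : {set 'I_n}, T \subset S -> y T = 0) -> (x * y) S = 0.
Proof.
by move=> y0; rewrite ext_mulE big1 // => T _; rewrite y0 ?subsetDl // !mulr0.
Qed.

Definition ext_coef S x : k^o := x S.

Fact ext_coef_is_linear S : linear (ext_coef S).
Proof. by move=> a x y; rewrite /ext_coef !ffunE. Qed.
HB.instance Definition _ S :=
  GRing.isLinear.Build k E k^o *:%R (ext_coef S) (ext_coef_is_linear S).

Lemma ext_der_basis_coef J S : ext_der (mon J) S != 0 ->
  exists2 i, i \notin S & J = i |: S.
Proof.
rewrite ext_derE => nz; have [i /andP[iS /eqP <-]|none] :=
    pickP (fun i => (i \notin S) && (i |: S == J)); first by exists i.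
case/eqP: nz; rewrite big1 // => i iS; rewrite ext_basisE.
by have := none i; rewrite iS /= => ->; rewrite mulr0.
Qed.

(* If no dependent triple met the circuit C twice, every monomial supported in C
   would vanish on the degree 2 part of I, hence on I, but \partial e_C does not. *)
Lemma quadratic_circuit C : os_quadratic H k -> dependent H C ->
  exists f g h, [/\ f \in C, g \in C, uniq [:: f; g; h] & (H f :&: H g <= H h)%VS].
Proof.
move=> quadH dC.
suff [J [dJ J3 JC]] : exists J : {set 'I_n},
    [/\ dependent H J, #|J| = 3 & (1 < #|J :&: C|)%N].
  have [f [g [/setIP[fJ fC] /setIP[gJ gC] nefg]]] := card_gt1P JC.
  have [D [sDJ D0] cycD] := dependent_circuit dJ.
  have DJ : D = J.
    apply/eqP; rewrite eqEcard sDJ J3; have [i iD] := set0Pn _ D0.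
    exact: dependent_card (dependent_sub iD (cycD i iD)).
  have [h /and3P[hJ nehf nehg]|none] :=
      pickP (fun h => [&& h \in J, h != f & h != g]); last first.
    suff /subset_leq_card : J \subset [set f; g] by rewrite J3 cards2 nefg.
    apply/subsetP=> h hJ; have := none h; rewrite hJ !inE /=.
    by case: (h == f); case: (h == g).
  exists f, g, h; split=> //.
    by rewrite /= !inE negb_or nefg eq_sym nehf eq_sym nehg.
  have := cycD h; rewrite DJ => /(_ hJ); apply: subv_trans.
  apply/subv_bigcapP=> s; rewrite !inE => /andP[nesh sJ].
  suff : s \in [set f; g] by rewrite !inE => /orP[]/eqP->; rewrite ?capvSl ?capvSr.
  have -> : [set f; g] = J :\ h.
    apply/eqP; rewrite eqEcard subUset !sub1set !inE fJ gJ !(eq_sym _ h) nehf nehg.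
    by have := cardsD1 h J; rewrite J3 hJ cards2 nefg add1n => -[<-].
  by rewrite !inE nesh.
apply: contrapT => noJ.
(* A nonzero coefficient on at most two elements of [C] would come from the derivative of a
   dependent triple with two members in [C]. *)
have small (S : {set 'I_n}) (x : E) :
    x \in I -> S \subset C -> (#|S| <= 2)%N -> x S = 0.
  move=> Ix sSC leS2; apply: (@os_ideal_ker _ _ _ H k _ (ext_coef S)) Ix => S' J T dJ.
  apply: ext_mulr_coef0 => T1 sT1; apply: ext_mull_coef0 => T2 sT2.
  apply/eqP; apply: contra_notT noJ => /ext_der_basis_coef[i iT2 eJ].
  have sT2S : T2 \subset S by apply: subset_trans sT1.
  have := dependent_card dJ; rewrite eJ cardsU1 iT2 ltnS => leT2.
  have T22 : #|T2| = 2.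
    by apply/eqP; rewrite eqn_leq leT2 (leq_trans (subset_leq_card sT2S)).
  exists J; split=> //; rewrite eJ ?cardsU1 ?iT2 ?T22 //.
  apply: leq_trans (_ : #|T2| <= _)%N; first by rewrite T22.
  apply: subset_leq_card; rewrite subsetI subsetUr.
  exact: subset_trans sSC.
(* A coefficient of a product at [S] involves only coefficients of the factors at subsets of [S], so
   vanishing inside [C] passes from the degree 2 part to the ideal that it generates. *)
have van (S : {set 'I_n}) (x : E) : x \in I -> S \subset C -> x S = 0.
  rewrite quadH => Ix sSC.
  have van2 (T : {set 'I_n}) (u : E) : T \subset C ->
      u \in ({:E} * (I :&: ext_deg k n 2))%VS -> u T = 0.
    move=> sTC Uu; suff /subvP/(_ _ Uu) :
        ({:E} * (I :&: ext_deg k n 2) <= lker (linfun (ext_coef T)))%VS.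
      by rewrite memv_ker lfunE => /eqP.
    apply/prodvP=> a b _; rewrite memv_cap memv_ker lfunE /= => /andP[Ib b2].
    apply/eqP/ext_mull_coef0 => T' sT'; have [T'2|neT'] := eqVneq #|T'| 2.
      by apply: small => //; [apply: subset_trans sTC | rewrite T'2].
    by move/ext_degP: b2; apply.
  suff /subvP/(_ _ Ix) :
      (ideal_gen (I :&: ext_deg k n 2) <= lker (linfun (ext_coef S)))%VS.
    by rewrite memv_ker lfunE => /eqP.
  apply/prodvP=> u z Uu _; rewrite memv_ker lfunE /=.
  apply/eqP/ext_mulr_coef0 => T sTS; apply: van2 => //.
  exact: subset_trans sSC.
have [i iC] : exists i, i \in C.
  by apply/set0Pn; rewrite -card_gt0; apply: leq_trans (dependent_card dC).
(* The coefficient of the derivative of the monomial of [C] at [C :\ i] is a sign, hence nonzero. *)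
have /eqP := van (C :\ i) _ (os_ideal_der k dC) (subD1set _ _).
rewrite ext_derE (bigD1 i) ?setD11 //= big1 => [|j /andP[jCi neji]].
  by rewrite setD1K // ext_basisE eqxx addr0 mulr1 signr_eq0.
rewrite ext_basisE (_ : (_ == _) = false) ?mulr0 //.
apply/negP=> /eqP/setP/(_ i); rewrite !inE eqxx iC eq_sym (negPf neji) //.
Qed.

End QuadraticCircuits.

(** * Cycles and triangles of a graph as relations among its hyperplanes *)

Section GraphicHyperplanes.
Variables (K : fieldType) (l : nat) (e : rel 'I_l).
Hypotheses (e_sym : symmetric e) (e_irr : irreflexive e).
Local Notation H := (graphic_arrangement K e).
Implicit Types (j : 'I_#|edges e|) (z : 'rV[K]_l).

Definition edge_ends j : 'I_l * 'I_l := enum_val j.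

Lemma graphic_hplaneE j z :
  (z \in H j) = (z 0 (edge_ends j).1 == z 0 (edge_ends j).2).
Proof. by rewrite edge_hplaneE subr_eq0. Qed.

Lemma edge_endsP j : e (edge_ends j).1 (edge_ends j).2.
Proof. by have := enum_valP j; rewrite inE => /andP[]. Qed.

Lemma edge_ends_neq j : (edge_ends j).1 != (edge_ends j).2.
Proof. by apply/eqP=> eqj; have := edge_endsP j; rewrite eqj e_irr. Qed.

Lemma edge_index a b : e a b ->
  exists j, edge_ends j = (a, b) \/ edge_ends j = (b, a).
Proof.
move=> eab; have [ltab|ltba|/val_inj eqab] := ltngtP a b.
- have ab : (a, b) \in edges e by rewrite inE ltab.
  by exists (enum_rank_in ab (a, b)); left; rewrite /edge_ends enum_rankK_in.
- have ba : (b, a) \in edges e by rewrite inE ltba e_sym.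
  by exists (enum_rank_in ba (b, a)); right; rewrite /edge_ends enum_rankK_in.
by rewrite eqab e_irr in eab.
Qed.

Lemma flat_graphicP (J : {set 'I_#|edges e|}) z :
  reflect {in J, forall j, z 0 (edge_ends j).1 = z 0 (edge_ends j).2} (z \in flat H J).
Proof.
rewrite memvE /flat; apply: (iffP subv_bigcapP) => zJ j jJ; last first.
  by rewrite -memvE graphic_hplaneE zJ.
by apply/eqP; rewrite -graphic_hplaneE memvE zJ.
Qed.

Lemma hplane_row j (z : 'I_l -> K) :
  (\row_i z i \in H j) = (z (edge_ends j).1 == z (edge_ends j).2).
Proof. by rewrite graphic_hplaneE !mxE. Qed.

Lemma spanned_edge a b c d : a != c ->
    (forall z : 'I_l -> K, z a = z b -> z c = z d -> z a = z c) ->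
  [\/ b = c, a = d | b = d].
Proof.
move=> neac zac.
have [->|nebc] := eqVneq b c; first by constructor 1.
have [->|nead] := eqVneq a d; first by constructor 2.
have [->|nebd] := eqVneq b d; first by constructor 3.
have := zac (fun i => ((i == a) || (i == b))%:R).
rewrite !eqxx !orbT !(eq_sym c) (negPf neac) (negPf nebc) !(eq_sym d).
rewrite (negPf nead) (negPf nebd) => /(_ erefl erefl)/eqP.
by rewrite oner_eq0.
Qed.

(** Indicator functions of single vertices show that [u] and [w] are ends of the edges ab and cd. If
    they come from different edges, [spanned_edge], applied with the remaining ends, leaves a
    triangle or one of the two edges. *)
Lemma spanned_triangle a b c d u w : a != b -> c != d -> u != w ->
    (forall z : 'I_l -> K, z a = z b -> z c = z d -> z u = z w) ->
  [\/ (u = a /\ w = b) \/ (u = b /\ w = a),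
      (u = c /\ w = d) \/ (u = d /\ w = c) |
      exists x y t, [/\ (x = a /\ y = b) \/ (x = b /\ y = a),
        (y = c /\ t = d) \/ (y = d /\ t = c) & (x = u /\ t = w) \/ (x = w /\ t = u)]].
Proof.
move=> neab necd neuw zuw.
have in_ab x x' : (forall z : 'I_l -> K, z a = z b -> z c = z d -> z x = z x') ->
    x != x' -> [|| x == a, x == b, x == c | x == d].
  move=> zx nex; have := zx (fun i => (i == x)%:R); rewrite eqxx !(eq_sym x).
  rewrite (eq_sym x' x) (negPf nex).
  case: (a == x); case: (b == x); case: (c == x); case: (d == x) => //= h.
  by have /eqP := h erefl erefl; rewrite oner_eq0.
have wab : [|| w == a, w == b, w == c | w == d].
  by apply: (in_ab w u); rewrite 1?eq_sym // => z za zc; rewrite (zuw z).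
have key x y t s : (x = a /\ y = b) \/ (x = b /\ y = a) ->
    (t = c /\ s = d) \/ (t = d /\ s = c) -> (x = u /\ t = w) \/ (x = w /\ t = u) ->
  [\/ (u = a /\ w = b) \/ (u = b /\ w = a),
      (u = c /\ w = d) \/ (u = d /\ w = c) |
      exists x y t, [/\ (x = a /\ y = b) \/ (x = b /\ y = a),
        (y = c /\ t = d) \/ (y = d /\ t = c) & (x = u /\ t = w) \/ (x = w /\ t = u)]].
  move=> hx ht hu; have nxt : x != t by case: hu neuw => -[-> ->] //; rewrite eq_sym.
  have [z zx zt|eqyt|eqxs|eqys] := @spanned_edge x y t s nxt.
  - have zab : z a = z b by case: hx zx => -[-> ->].
    have zcd : z c = z d by case: ht zt => -[-> ->].
    by case: hu => -[-> ->]; rewrite (zuw z).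
  - by constructor 1; intuition congruence.
  - by constructor 2; intuition congruence.
  by constructor 3; exists x, y, t; split=> //; intuition congruence.
have /or4P uab := in_ab _ _ zuw neuw; move/or4P: wab => wab.
have neq := elimN eqP neuw.
case: uab => /eqP eu; case: wab => /eqP ew; try by case: neq; rewrite eu ew.
- by constructor 1; left.
- by apply: (key a b c d); auto.
- by apply: (key a b d c); auto.
- by constructor 1; right.
- by apply: (key b a c d); auto.
- by apply: (key b a d c); auto.
- by apply: (key a b c d); auto.
- by apply: (key b a c d); auto.
- by constructor 2; left.
- by apply: (key a b d c); auto.
- by apply: (key b a d c); auto.
by constructor 2; right.
Qed.

Variable k : fieldType.

(** The last hypothesis says that the edge uw of the subgraph [r] is redundant given its other
    edges, so the edges of [r] are dependent. The triple from [quadratic_circuit] is a triangle with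
    two sides in [r]. *)
Lemma quadratic_shortcut (r : rel 'I_l) u w : os_quadratic H k ->
    symmetric r -> subrel r e -> r u w ->
    (forall z : 'I_l -> K,
      (forall a b, r a b -> (a, b) != (u, w) -> (a, b) != (w, u) -> z a = z b) ->
      z u = z w) ->
  exists a b c, [/\ r a b, r b c, a != c & e a c].
Proof.
move=> quadH r_sym sub_re ruw closed.
have [i0 i0P] := edge_index (sub_re _ _ ruw).
pose C := [set j | r (edge_ends j).1 (edge_ends j).2].
have i0C : i0 \in C by rewrite inE; case: i0P => -> //=; rewrite r_sym.
have dC : dependent H C.
  apply: (dependent_sub i0C); apply/subvP=> z /flat_graphicP zC.
  rewrite graphic_hplaneE; suff : z 0 u = z 0 w by case: i0P => -> /= ->.
  apply: (closed (fun i => z 0 i)) => a b rab neuw newu.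
  have [j jP] := edge_index (sub_re _ _ rab).
  have jC : j \in C :\ i0.
    rewrite !inE; apply/andP; split; last by case: jP => -> //=; rewrite r_sym.
    apply/eqP=> eqj; move: jP; rewrite eqj.
    case: i0P => -> [[ea eb]|[ea eb]]; move: neuw newu; rewrite ea eb !eqxx //.
  by have := zC j jC; case: jP => -> /=.
have [f [g [h [fC gC]]]] := quadratic_circuit quadH dC.
rewrite /= !inE negb_or andbT => /andP[/andP[nefg nefh] negh] /subvP sfgh.
have ends_inj i j :
    (edge_ends i).1 = (edge_ends j).1 /\ (edge_ends i).2 = (edge_ends j).2 \/
    (edge_ends i).1 = (edge_ends j).2 /\ (edge_ends i).2 = (edge_ends j).1 -> i = j.
  have lt s : (val (edge_ends s).1 < val (edge_ends s).2)%N.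
    by have := enum_valP s; rewrite inE => /andP[].
  case=> [[e1 e2]|[e1 e2]].
    apply: enum_val_inj; rewrite -/(edge_ends i) -/(edge_ends j).
    by rewrite [LHS]surjective_pairing e1 e2 -surjective_pairing.
  by have := lt i; rewrite e1 e2 => /(ltn_trans (lt j)); rewrite ltnn.
have spans (z : 'I_l -> K) : z (edge_ends f).1 = z (edge_ends f).2 ->
    z (edge_ends g).1 = z (edge_ends g).2 -> z (edge_ends h).1 = z (edge_ends h).2.
  move=> /eqP zf /eqP zg; apply/eqP; rewrite -hplane_row; apply: sfgh.
  by rewrite memv_cap !hplane_row zf.
have := spanned_triangle (edge_ends_neq f) (edge_ends_neq g) (edge_ends_neq h) spans.
case=> [hf|hg|[x [y [t [xy yt xt]]]]].
- by case/eqP: nefh; apply: ends_inj; case: hf => -[-> ->]; auto.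
- by case/eqP: negh; apply: ends_inj; case: hg => -[-> ->]; auto.
rewrite !inE in fC gC; exists x, y, t; split.
- by case: xy => -[-> ->] //; rewrite r_sym.
- by case: yt => -[-> ->] //; rewrite r_sym.
- by case: xt => -[-> ->]; last rewrite eq_sym; apply: edge_ends_neq.
by case: xt => -[-> ->]; last rewrite e_sym; apply: edge_endsP.
Qed.

End GraphicHyperplanes.

(** * Chordal graphs give supersolvable arrangements *)

Section ChordalGraphs.

(** A walk of minimal length works: a chord or a repeated vertex would allow a stretch of it to be
    cut out. *)
Lemma induced_path (T : finType) (R : rel T) x y : connect R x y ->
  exists m (f : nat -> T), [/\ f 0 = x, f m = y,
    forall i, (i < m)%N -> R (f i) (f i.+1),
    forall i j, (i < j <= m)%N -> f i != f j &
    forall i j, (i.+1 < j <= m)%N -> ~~ R (f i) (f j)].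
Proof.
move=> cxy; pose walk m := exists f : nat -> T,
  [/\ f 0 = x, f m = y & forall i, (i < m)%N -> R (f i) (f i.+1)].
have ex_walk : exists m, `[< walk m >].
  have [p pP yE] := connectP cxy; exists (size p); apply/asboolP.
  exists (nth x (x :: p)); split=> // [|i lti]; last by move/pathP: pP; apply.
  by rewrite yE (last_nth x).
case: (ex_minnP ex_walk) => m /asboolP[f [f0 fm fR]] min_m.
have cut i j : (i < j <= m)%N -> R (f i) (f j) -> (j <= i.+1)%N.
  case/andP=> ltij lejm Rij; rewrite leqNgt; apply/negP=> lti1j.
  have : (m <= m - (j - i.+1))%N.
    apply: min_m; apply/asboolP.
    exists (fun t => if (t <= i)%N then f t else f (t + (j - i.+1))%N).
    split=> // [|t ltt].
      rewrite ifF; last by apply/negbTE; rewrite -ltnNge; lia.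
      by rewrite -fm; congr f; lia.
    have [ltti|leit] := ltnP t i; first by rewrite ltnW // fR //; lia.
    have [eqti|neti] := eqVneq t i.
      by rewrite eqti leqnn (_ : (i.+1 + (j - i.+1) = j)%N) //; lia.
    rewrite ifF; last by apply/negbTE; rewrite -ltnNge; lia.
    rewrite (_ : (t.+1 + _ = (t + (j - i.+1)).+1)%N); last by lia.
    by apply: fR; lia.
  by lia.
exists m, f; split=> // i j /andP[ltij lejm]; last first.
  by apply/negP=> Rij; have := cut i j; rewrite lejm ltnW // => /(_ isT Rij); lia.
apply/eqP=> eqij; have : (m <= m - (j - i))%N; last by lia.
apply: min_m; apply/asboolP.
exists (fun t => if (t <= i)%N then f t else f (t + (j - i))%N).
split=> // [|t ltt].
  case: leqP => [lemi|_]; last by rewrite -fm; congr f; lia.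
  have -> : (m - (j - i) = i)%N by lia.
  by rewrite eqij -fm; congr f; lia.
have [ltti|leit] := ltnP t i; first by rewrite ltnW // fR //; lia.
have [eqti|neti] := eqVneq t i.
  rewrite eqti leqnn (_ : (i.+1 + (j - i) = j.+1)%N); last by lia.
  by rewrite eqij; apply: fR; lia.
rewrite ifF; last by apply/negbTE; rewrite -ltnNge; lia.
rewrite (_ : (t.+1 + _ = (t + (j - i)).+1)%N); last by lia.
by apply: fR; lia.
Qed.

Variables (T : finType) (e : rel T).
Hypotheses (e_sym : symmetric e) (e_irr : irreflexive e).
Implicit Types (W S : {set T}).

Definition simplicial W u : Prop :=
  {in W &, forall a b, e u a -> e u b -> a != b -> e a b}.

(* No cycle of length at least 4 is induced, stated through induced paths from x to
   y that avoid the neighbours of v except at both ends *)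
Definition chordal : Prop := forall v x y m (f : nat -> T),
  f 0 = x -> f m = y -> e v x -> e v y -> x != y -> ~~ e x y ->
  (forall i, (i < m)%N -> e (f i) (f i.+1)) ->
  (forall i j, (i < j <= m)%N -> f i != f j) ->
  (forall i j, (i.+1 < j <= m)%N -> ~~ e (f i) (f j)) ->
  (forall i, (i <= m)%N -> f i != v) ->
  ~ (forall i, (0 < i < m)%N -> ~~ e v (f i)).

Hypothesis e_chordal : chordal.

(** Dirac's argument. [Kc] is the component of [k0] among the non-neighbours of [v], and [S]
    consists of the neighbours of [v] adjacent to [Kc]. Induction applies to [Kc :|: S], which omits
    [v]; a vertex of [Kc] has all its neighbours in [W] there, so being simplicial carries over to
    [W]. *)
Lemma chordal_simplicial W v : v \in W -> (exists2 b, b \in W & (b != v) && ~~ e v b) ->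
  exists u, [/\ u \in W, u != v, ~~ e v u & simplicial W u].
Proof.
elim: {W}_.+1 {-2}W v (ltnSn #|W|) => // m IHm W v ltWm vW [k0 k0W k0v].
pose N := [set a in W | (a != v) && ~~ e v a].
pose R := [rel a b | [&& e a b, a \in N & b \in N]].
pose Kc := [set u | connect R k0 u].
have R_sym : symmetric R by move=> a b; rewrite /= e_sym [(a \in N) && _]andbC.
have k0N : k0 \in N by rewrite inE k0W.
have KN u : u \in Kc -> u \in N.
  rewrite inE => /connectP[p pR ->]; case/lastP: p pR => // p b.
  by rewrite last_rcons rcons_path => /andP[_ /and3P[]].
pose S := [set a in W | e v a && [exists k in Kc, e a k]].
pose W' := Kc :|: S.
have vW' : v \notin W'.
  rewrite !inE e_irr /= andbF orbF; apply/negP=> cv.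
  by have := KN v; rewrite !inE cv eqxx andbF => /(_ isT).
have sW'W : W' \subset W.
  apply/subsetP=> u; rewrite in_setU => /orP[/KN|]; by rewrite !inE => /andP[].
have ltW'W : (#|W'| < #|W|)%N.
  by apply: proper_card; apply/properP; split=> //; exists v.
have nbr u b : u \in Kc -> b \in W -> e u b -> b \in W'.
  move=> uK bW eub; rewrite in_setU; have := KN u uK.
  rewrite !inE => /and3P[uW neuv nevu].
  have [evb|nevb] := boolP (e v b).
    by rewrite bW /=; apply/orP; right; apply/existsP; exists u; rewrite uK e_sym.
  have nebv : b != v by apply: contraNneq nevu => <-; rewrite e_sym.
  apply/orP; left; rewrite inE in uK; apply: connect_trans uK (connect1 _).
  by rewrite /= eub !inE uW neuv nevu bW nebv nevb.
(* Two non-adjacent members of [S] are joined by an induced path with interior in [Kc], which [v]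
   closes to an induced cycle. *)
have S_clique : {in S &, forall x y, x != y -> e x y}.
  move=> x y; rewrite !inE => /and3P[xW evx /exists_inP[kx kxK exkx]].
  case/and3P=> yW evy /exists_inP[ky kyK eyky] nexy.
  apply: contraPT isT => nexy'.
  pose D := [pred u | (u \in Kc) || (u == x) || (u == y)].
  pose R2 := [rel a b | [&& e a b, D a & D b]].
  have R2_sym : symmetric R2 by move=> a b; rewrite /= e_sym [X in _ && X]andbC.
  have Kconn u : u \in Kc -> connect R2 k0 u.
    rewrite inE => /connectP[p pR ->]; apply/connectP; exists p => //.
    have pK : all (mem Kc) (k0 :: p).
      by apply/allP=> a ap; rewrite /= inE; apply: (path_connect pR).
    apply: (sub_in_path (P := mem Kc) (e := R)) => // a b aK bK /and3P[eab _ _].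
    by rewrite /= eab /= (aK : a \in Kc) (bK : b \in Kc).
  have kconn a : a \in Kc -> forall z, D z -> e z a -> connect R2 k0 z.
    move=> aK z Dz eza; apply: connect_trans (Kconn a aK) (connect1 _).
    by apply: (introT and3P); split=> //; [rewrite e_sym | rewrite /= aK].
  have cxy : connect R2 x y.
    apply: (@connect_trans _ _ k0).
      by rewrite (sym_connect_sym R2_sym); apply: (kconn kx); rewrite //= eqxx orbT.
    by apply: (kconn ky); rewrite //= eqxx orbT.
  have [p [f [f0 fp fR f_inj f_ind]]] := induced_path cxy.
  have fD i : (i <= p)%N -> D (f i).
    case: i => [|i] lei; first by rewrite f0 /= eqxx orbT.
    by have /and3P[] := fR i lei.
  have nDv : ~~ D v.
    rewrite /= !negb_or; apply/andP; split; first apply/andP; first split.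
    - by apply: contraNN vW' => vK; rewrite in_setU vK.
    - by apply/eqP=> eqv; move: evx; rewrite -eqv e_irr.
    - by apply/eqP=> eqv; move: evy; rewrite -eqv e_irr.
  suff : False by [].
  apply: (e_chordal f0 fp evx evy nexy nexy') => //.
  - by move=> i /fR/and3P[].
  - move=> i j /[dup] /andP[ltij lejp] /f_ind; apply: contraNN => eij.
    apply: (introT and3P); split=> //; apply: fD => //.
    exact: ltnW (ltnW (leq_trans ltij lejp)).
  - by move=> i /fD Di; apply: contraNneq nDv => <-.
  move=> i /andP[lt0i ltip].
  have /orP[/orP[iK|/eqP ix]|/eqP iy] := fD i (ltnW ltip).
  - by have := KN _ iK; rewrite !inE => /and3P[].
  - by have := f_inj 0 i; rewrite lt0i ltnW // f0 ix eqxx => /(_ isT).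
  by have := f_inj i p; rewrite ltip leqnn fp iy eqxx => /(_ isT).
suff [u uK simpu] : exists2 u, u \in Kc & simplicial W' u.
  have := KN u uK; rewrite !inE => /and3P[uW neuv nevu].
  exists u; split=> // a b aW bW eua eub.
  by apply: simpu => //; apply: nbr uK _ _.
have IH w : w \in W' -> (exists2 b, b \in W' & (b != w) && ~~ e w b) ->
    exists u, [/\ u \in W', u != w, ~~ e w u & simplicial W' u].
  by apply: IHm; apply: leq_trans ltW'W _.
have inW' u : u \in W' -> u \in Kc \/ u \in S by rewrite in_setU => /orP.
(* The simplicial vertex must fall in [Kc]. One not adjacent to some [s] in [S] does, as [S] is a
   clique. If [S] is adjacent to everything, one not adjacent to some [s] in [Kc] does. Failing
   both, [W'] is a clique and [k0] will do. *)
have [/exists_inP[s sS /exists_inP[b bW' sb]]|noS] :=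
    boolP [exists s in S, exists b in W', (b != s) && ~~ e s b].
  have [||u [uW' neus nesu simpu]] := IH s; first by rewrite in_setU sS orbT.
    by exists b.
  exists u => //; case: (inW' u uW') => // uS.
  by case/negP: nesu; apply: S_clique; rewrite // eq_sym.
have univS s b : s \in S -> b \in W' -> b != s -> e s b.
  move=> sS bW' nebs; apply: contraNT noS => nesb; apply/exists_inP; exists s => //.
  by apply/exists_inP; exists b; rewrite ?nebs.
have [/exists_inP[s sK /exists_inP[b bW' sb]]|noK] :=
    boolP [exists s in Kc, exists b in W', (b != s) && ~~ e s b].
  have sW' : s \in W' by rewrite in_setU sK.
  have [|u [uW' neus nesu simpu]] := IH s sW'; first by exists b.
  exists u => //; case: (inW' u uW') => // uS.
  by case/negP: nesu; rewrite e_sym; apply: univS; rewrite // eq_sym.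
exists k0; first by rewrite inE connect0.
move=> a b aW' bW' _ _ neab; case: (inW' a aW') => [aK|aS].
  apply: contraNT noK => neab'; apply/exists_inP; exists a => //.
  by apply/exists_inP; exists b; rewrite // eq_sym neab.
by apply: univS; rewrite // eq_sym.
Qed.

(** A simplicial vertex is placed last, at position [#|W :\ u|], and the rest is ordered by
    induction. *)
Lemma chordal_elimination W : exists o : T -> nat,
  [/\ {in W &, injective o}, {in W, forall u, (o u < #|W|)%N} &
      {in W & &, forall u a b, (o a < o u)%N -> (o b < o u)%N ->
        e u a -> e u b -> a != b -> e a b}].
Proof.
elim: {W}_.+1 {-2}W (ltnSn #|W|) => // m IHm W ltWm.
have [->|[v vW]] := set_0Vmem W.
  by exists (fun=> 0%N); split=> [u|u|u]; rewrite inE.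
have [u uW simpu] : exists2 u, u \in W & simplicial W u.
  have [/exists_inP[s sW /exists_inP[b bW sb]]|univ] :=
      boolP [exists s in W, exists b in W, (b != s) && ~~ e s b].
    have [|u [uW _ _ simpu]] := chordal_simplicial sW; first by exists b.
    by exists u.
  exists v => // a b aW bW _ _ neab; apply: contraNT univ => nab.
  apply/exists_inP; exists a => //; apply/exists_inP; exists b => //.
  by rewrite eq_sym neab.
have cardW : #|W| = #|W :\ u|.+1 by rewrite (cardsD1 u W) uW.
have [|o [o_inj o_lt o_elim]] := IHm (W :\ u); first by rewrite -ltnS -cardW.
pose o' a := if a == u then #|W :\ u| else o a.
have inWu a : a \in W -> a != u -> a \in W :\ u by rewrite !inE => -> ->.
exists o'; split.
- move=> a b aW bW; rewrite /o'.
  case: (eqVneq a u) => [->|neau]; case: (eqVneq b u) => [->|nebu] //.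
  + by move=> eqo; have := o_lt _ (inWu b bW nebu); rewrite -eqo ltnn.
  + by move=> eqo; have := o_lt _ (inWu a aW neau); rewrite eqo ltnn.
  by apply: o_inj; apply: inWu.
- move=> a aW; rewrite /o' cardW ltnS; case: eqVneq => // neau.
  by apply/ltnW/o_lt/inWu.
move=> w a b wW aW bW; rewrite /o'.
case: (eqVneq w u) => [->|newu] lta ltb; first by move=> *; apply: simpu.
have lt_u : ~~ (#|W :\ u| < o w)%N by rewrite -leqNgt ltnW // o_lt // inWu.
move: lta ltb; case: (eqVneq a u) => [_|neau]; first by rewrite (negPf lt_u).
case: (eqVneq b u) => [_|nebu]; first by rewrite (negPf lt_u).
by move=> lta ltb; apply: o_elim => //; apply: inWu.
Qed.

End ChordalGraphs.

(** * From quadratic to chordal, and from elimination orders to modular chains *)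

Section GraphicSupersolvable.
Variables (K : fieldType) (l : nat) (e : rel 'I_l).
Hypotheses (e_sym : symmetric e) (e_irr : irreflexive e).
Local Notation H := (graphic_arrangement K e).
Implicit Types z : 'rV[K]_l.

Lemma quadratic_chordal (k : fieldType) : os_quadratic H k -> chordal e.
Proof.
move=> quadH v x y m f f0 fm evx evy nexy nexy' f_e f_inj f_ind f_v f_nev.
(* [D] lists the edges of the cycle formed by [v] and the path [f] from [x] to [y].
   [quadratic_shortcut] will give two consecutive edges ab, bc of it with a and c adjacent. *)
pose D a b := [|| (a == v) && ((b == x) || (b == y)) |
  [exists i : 'I_m, (a == f i) && (b == f i.+1)]].
pose r := [rel a b | D a b || D b a].
have DP a b : D a b -> a = v /\ (b = x \/ b = y) \/
    exists i, [/\ (i < m)%N, a = f i & b = f i.+1].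
  case/orP=> [/andP[/eqP-> /orP[]/eqP->]|/existsP[i /andP[/eqP-> /eqP->]]]; auto.
  by right; exists i; split.
have De a b : D a b -> e a b.
  by case/DP=> [[-> [->|->]]|[i [/f_e ? -> ->]]].
have Df i : (i < m)%N -> D (f i) (f i.+1).
  by move=> lti; apply/orP; right; apply/existsP; exists (Ordinal lti); rewrite !eqxx.
have Dvx : D v x by rewrite /D !eqxx.
have Dvy : D v y by rewrite /D !eqxx orbT.
have r_sym : symmetric r by move=> a b; rewrite /= orbC.
have sub_re : subrel r e by move=> a b /orP[]/De //; rewrite e_sym.
have rvy : r v y by rewrite /= Dvy.
have nvx : v != x by apply: contraTneq evx => <-; rewrite e_irr.
have nvy : v != y by apply: contraTneq evy => <-; rewrite e_irr.
have closed (z : 'I_l -> K) : (forall a b, r a b -> (a, b) != (v, y) ->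
    (a, b) != (y, v) -> z a = z b) -> z v = z y.
  move=> zr; transitivity (z x).
    by apply: zr; rewrite /= ?Dvx // xpair_eqE ?eqxx ?(negPf nvy).
  suff zf i : (i <= m)%N -> z (f i) = z x by rewrite -fm zf.
  elim: i => [|i IHi] lei; first by rewrite f0.
  rewrite -IHi ?(ltnW lei) //; apply/esym/zr; first by rewrite /= Df.
    by rewrite xpair_eqE negb_and f_v ?(ltnW lei).
  by rewrite xpair_eqE negb_and (f_v i.+1) // orbT.
have [a [b [c [rab rbc neac eac]]]] :=
  quadratic_shortcut e_sym e_irr quadH r_sym sub_re rvy closed.
have r_path a' b' : r a' b' -> a' != v -> b' != v -> exists i, (i < m)%N /\
    (a' = f i /\ b' = f i.+1 \/ b' = f i /\ a' = f i.+1).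
  by case/orP=> /DP[[-> _]|[i [lti -> ->]]]; rewrite ?eqxx // => _ _; exists i; auto.
have r_v b' : r v b' -> b' = x \/ b' = y.
  case/orP=> /DP.
    case=> [[_ //]|[i [lti eqv _]]].
    by have := f_v i (ltnW lti); rewrite -eqv eqxx.
  case=> [[_ [eqv|eqv]]|[i [lti _ eqv]]].
  - by rewrite eqv eqxx in nvx.
  - by rewrite eqv eqxx in nvy.
  by have := f_v i.+1 lti; rewrite -eqv eqxx.
have exyF a' b' : a' = x \/ a' = y -> b' = x \/ b' = y -> e a' b' -> False.
  by case=> -> [] ->; rewrite ?e_irr // 1?(e_sym y) (negPf nexy').
have e_v c' : e v c' -> (exists2 i, (i <= m)%N & c' = f i) -> c' = x \/ c' = y.
  move=> + [i lei eqc]; rewrite eqc => evi.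
  have [i0|i_gt0] := posnP i; first by left; rewrite i0.
  have [im|lti] := eqVneq i m; first by right; rewrite im.
  by have := f_nev i; rewrite i_gt0 ltn_neqAle lti lei evi => /(_ isT).
(* From [v] the cycle goes to [x] or [y], and a neighbour of [v] on the path is also [x] or [y], so
   an edge would join [x] and [y]. *)
have no_v a' b' c' : r a' b' -> r b' c' -> a' != c' -> e a' c' -> a' != v.
  move=> rab' rbc' neac' eac'; apply/eqP=> av; rewrite av in rab' neac' eac'.
  have bxy := r_v _ rab'.
  have nbv : b' != v by case: bxy => ->; rewrite eq_sym.
  have ncv : c' != v by rewrite eq_sym.
  have [i [lti ci]] := r_path _ _ rbc' nbv ncv.
  apply: (exyF b' c' bxy); last exact: sub_re.
  apply: e_v => //; case: ci => [[_ ->]|[-> _]]; first by exists i.+1.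
  by exists i => //; apply: ltnW.
have r_swap a' b' : r a' b' -> r b' a' by rewrite /= orbC.
have nav := no_v _ _ _ rab rbc neac eac.
have ncv : c != v.
  apply: (no_v c b a); [exact: r_swap | exact: r_swap | by rewrite eq_sym |].
  by rewrite e_sym.
have nbv : b != v.
  apply/eqP=> bv; rewrite bv in rab rbc.
  by apply: (exyF a c) => //; apply: r_v => //; apply: r_swap.
have f_eq i j : (i <= m)%N -> (j <= m)%N -> f i = f j -> i = j.
  move=> lei lej eqf; have [ltij|ltji|//] := ltngtP i j.
    by have := f_inj i j; rewrite ltij lej eqf eqxx => /(_ isT).
  by have := f_inj j i; rewrite ltji lei eqf eqxx => /(_ isT).
have step i j : (i < m)%N -> (j < m)%N -> f i.+1 = f j -> ~~ e (f i) (f j.+1).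
  move=> lti ltj eqf; have ij := f_eq _ _ lti (ltnW ltj) eqf.
  by apply: f_ind; rewrite -ij leqnn ij.
(* Now all three vertices lie on the path: either a and c are two steps apart, against its being
   induced, or they coincide. *)
have [i [lti ab]] := r_path _ _ rab nav nbv.
have [j [ltj bc]] := r_path _ _ rbc nbv ncv.
case: ab bc => -[ea eb] [] [eb' ec].
- by case/negP: (step i j lti ltj (etrans (esym eb) eb')); rewrite -ea -ec.
- case/eqP: neac; rewrite ea eb'; congr f; apply: succn_inj.
  by apply: f_eq => //; rewrite -eb.
- case/eqP: neac; rewrite eb ec.
  by rewrite (f_eq i j (ltnW lti) (ltnW ltj) (etrans (esym ea) eb')).
case/negP: (step j i ltj lti (etrans (esym ec) ea)).
by rewrite e_sym -eb -eb'.
Qed.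

Variable o : 'I_l -> nat.
Hypotheses (o_inj : injective o) (o_lt : forall a, (o a < l)%N).
Hypothesis o_elim : forall u a b, (o a < o u)%N -> (o b < o u)%N ->
  e u a -> e u b -> a != b -> e a b.

Definition initial_edges (i : nat) : {set 'I_#|edges e|} :=
  [set j | (o (edge_ends j).1 < i)%N && (o (edge_ends j).2 < i)%N].
Local Notation X i := (flat H (initial_edges i)).

Lemma mem_initial_flat i z :
  (z \in X i) <-> (forall a b, e a b -> (o a < i)%N -> (o b < i)%N -> z 0 a = z 0 b).
Proof.
split=> [/flat_graphicP zX a b eab ltai ltbi|zP].
  have [j jP] := edge_index e_sym e_irr eab.
  by have := zX j; rewrite inE; case: jP => -> /=; rewrite ltai ltbi => /(_ isT).
apply/flat_graphicP => j; rewrite inE => /andP[lt1 lt2].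
by apply: zP => //; apply: edge_endsP.
Qed.

Lemma initial_flatS i i' : (i <= i')%N -> (X i' <= X i)%VS.
Proof.
move=> leii'; apply: flatS; apply/subsetP=> j; rewrite !inE => /andP[lt1 lt2].
by rewrite !(leq_trans _ leii').
Qed.

Definition flat_equal (Y : {vspace 'rV[K]_l}) (a b : 'I_l) : Prop :=
  forall y, y \in Y -> y 0 a = y 0 b.

(* Vertices are added one at a time in the order [o]; the value at a new vertex is
   forced at most by its earlier neighbours, and these form a clique. *)
Lemma extend_into_flat Y i z : is_flat H Y -> (i <= l)%N ->
    (forall a b, e a b -> (o a < i)%N -> (o b < i)%N -> flat_equal Y a b ->
      z 0 a = z 0 b) ->
  exists2 y, y \in Y & forall a, (o a < i)%N -> y 0 a = z 0 a.
Proof.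
move=> [J YJ] leil; have [m eqm] : exists m, (i + m)%N = l.
  by exists (l - i)%N; rewrite subnKC.
elim: m i z eqm {leil} => [|m IHm] i z eqm zY.
  exists z => //; rewrite YJ; apply/flat_graphicP => j jJ.
  rewrite addn0 in eqm; apply: zY; rewrite ?eqm ?edge_endsP // => y.
  by rewrite YJ => /flat_graphicP; apply.
suff [z' z'z z'Y] : exists2 z' : 'rV[K]_l, (forall a, (o a < i)%N -> z' 0 a = z 0 a) &
    forall a b, e a b -> (o a < i.+1)%N -> (o b < i.+1)%N -> flat_equal Y a b ->
      z' 0 a = z' 0 b.
  have [||y yY yz] := IHm i.+1 z'; rewrite ?addSnnS //.
  by exists y => // a lta; rewrite yz ?z'z // ltnW.
have [[v ov]|noi] := pselect (exists v, o v = i); last first.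
  exists z => // a b eab lta ltb; apply: zY => //.
    by move: lta; rewrite ltnS leq_eqVlt => /orP[/eqP eqa|//]; case: noi; exists a.
  by move: ltb; rewrite ltnS leq_eqVlt => /orP[/eqP eqb|//]; case: noi; exists b.
have split_lt a : (o a < i.+1)%N -> a = v \/ (o a < i)%N.
  by rewrite ltnS leq_eqVlt => /orP[/eqP|]; rewrite -?ov; [move/o_inj|]; auto.
have nev a : (o a < i)%N -> a != v by apply: contraTneq => ->; rewrite ov ltnn.
(* Two earlier neighbours of [v] that [Y] identifies with [v] are adjacent and identified with each
   other, so [z] agrees on them. If there is none, the value is free and 0 is taken. *)
have [c cP] : exists c : K,
    forall b, e v b -> (o b < i)%N -> flat_equal Y v b -> c = z 0 b.
  have [[b [evb ltb Yvb]]|none] :=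
      pselect (exists b, [/\ e v b, (o b < i)%N & flat_equal Y v b]); last first.
    by exists 0 => b evb ltb Yvb; case: none; exists b.
  exists (z 0 b) => b' evb' ltb' Yvb'; have [->//|nebb'] := eqVneq b b'.
  apply: zY => //; last by move=> y yY; rewrite -Yvb ?Yvb'.
  by apply: (o_elim (u := v)) => //; rewrite ov.
exists (\row_a (if a == v then c else z 0 a)).
  by move=> a /nev/negPf nav; rewrite mxE nav.
move=> a b eab lta ltb Yab; rewrite !mxE.
have [av|{}lta] := split_lt a lta; have [bv|{}ltb] := split_lt b ltb.
- by rewrite av bv.
- rewrite av eqxx (negPf (nev b ltb)); apply: cP => //; rewrite -av //.
- rewrite bv eqxx (negPf (nev a lta)); apply/esym/cP; rewrite -?bv // 1?e_sym //.
  by move=> y yY; rewrite Yab.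
by rewrite (negPf (nev a lta)) (negPf (nev b ltb)); apply: zY.
Qed.

(** A vector [z] of the meet agrees on the first [i] vertices with some [y] in [Y], and [z - y] lies
    in the initial flat. Thus the meet is the sum of subspaces, for which the modular law holds. *)
Lemma initial_flat_meet Y i : is_flat H Y -> (i <= l)%N ->
  (flat_meet H (X i) Y <= X i + Y)%VS.
Proof.
move=> flY leil; apply/subvP=> z zM.
have [|y yY yz] := @extend_into_flat Y i z flY leil.
  move=> a b eab lta ltb Yab; have [j jP] := edge_index e_sym e_irr eab.
  suff : z \in H j by rewrite graphic_hplaneE; case: jP => -> /= /eqP.
  suff sub : (X i + Y <= H j)%VS by move: z zM; apply/subvP/(bigcapv_inf j).
  rewrite subv_add; apply/andP; split.
    by apply: flat_sub; rewrite inE; case: jP => -> /=; rewrite lta ltb.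
  apply/subvP=> y yY; rewrite graphic_hplaneE.
  by case: jP => -> /=; rewrite (Yab y yY).
rewrite -(subrK y z) memv_add //; apply/mem_initial_flat => a b _ lta ltb.
by rewrite !mxE !yz // !subrr.
Qed.

Lemma initial_flat_modular i : (i <= l)%N -> modular H (X i).
Proof.
move=> leil; split; first by exists (initial_edges i).
move=> Y flY Z flZ sYZ; apply/eqP; rewrite eqEsubv; apply/andP; split.
  apply/subvP=> z; rewrite memv_cap => /andP[zZ].
  move=> /(subvP (initial_flat_meet flY leil))/memv_addP[x xX [y yY eqz]].
  suff sub : (flat_join Z (X i) + Y <= flat_meet H (flat_join Z (X i)) Y)%VS.
    apply: (subvP sub); rewrite eqz memv_add // memv_cap xX andbT.
    rewrite (_ : x = z - y); last by rewrite eqz addrK.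
    by apply: memvB => //; apply: (subvP sYZ).
  by apply/subv_bigcapP => j.
rewrite flat_meetP; last exact: flat_joinP flZ (flat_meet_flat _ _ _).
rewrite /flat_join !subv_cap capvSl sYZ /=.
have := @flat_meetP _ _ _ H (X i) Y _ (flat_meet_flat H (X i) Y).
by rewrite subvv => /esym/andP[sX ->]; rewrite (subv_trans (capvSr _ _) sX).
Qed.

(** The earlier neighbours of the new vertex form a clique, on which vectors of the larger flat are
    constant, so a single equation separates the two flats. A vector [y] of [Y] violating it
    corrects any [x] by a multiple of [y]. *)
Lemma initial_flat_step Y i : (X i.+1 <= Y)%VS -> (Y <= X i)%VS ->
  ~~ (Y <= X i.+1)%VS -> Y = X i.
Proof.
move=> sXY sYX nsYX; apply/eqP; rewrite eqEsubv sYX /=; apply/subvP=> x xX.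
have split_lt d : (o d < i.+1)%N -> o d = i \/ (o d < i)%N.
  by rewrite ltnS leq_eqVlt => /orP[/eqP|]; auto.
have [y yY /mem_initial_flat nyX] : exists2 y, y \in Y & ~ y \in X i.+1.
  by have [y yY /negP nyX] := subvPn nsYX; exists y.
have [a [b [eab eqa ltb neyab]]] : exists a b,
    [/\ e a b, o a = i, (o b < i)%N & y 0 a != y 0 b].
  apply: contrapT => noab; apply: nyX => a b eab lta ltb; apply/eqP/negPn/negP=> neyab.
  have neab : a != b by apply: contraTneq eab => ->; rewrite e_irr.
  have [eqa|{}lta] := split_lt a lta; have [eqb|{}ltb] := split_lt b ltb.
  - by case/eqP: neab; apply: o_inj; rewrite eqa.
  - by case: noab; exists a, b.
  - by case: noab; exists b, a; rewrite e_sym eq_sym.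
  by case/eqP: neyab; have /mem_initial_flat := subvP sYX y yY; apply.
pose c := (x 0 a - x 0 b) / (y 0 a - y 0 b); pose w := x - c *: y.
have /mem_initial_flat wX : w \in X i by rewrite memvB // memvZ // (subvP sYX).
have wab : w 0 a = w 0 b.
  rewrite !mxE; apply/eqP; rewrite subr_eq addrAC -subr_eq0 opprD opprK addrA.
  rewrite (_ : _ + _ = x 0 a - x 0 b - c * (y 0 a - y 0 b)); last by ring.
  by rewrite /c divfK ?subrr // subr_eq0.
have wa d : e a d -> (o d < i)%N -> w 0 a = w 0 d.
  move=> ead ltd; rewrite wab; have [->//|nebd] := eqVneq b d.
  by apply: wX => //; apply: (o_elim (u := a)) => //; rewrite eqa.
have wX1 : w \in X i.+1.
  apply/mem_initial_flat => d d' edd' ltd ltd'.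
  have toa d1 : o d1 = i -> d1 = a by rewrite -eqa => /o_inj.
  have [/toa da|{}ltd] := split_lt d ltd; have [/toa da'|{}ltd'] := split_lt d' ltd'.
  - by rewrite da da'.
  - by rewrite da; apply: wa => //; rewrite -da.
  - by rewrite da'; apply/esym/wa => //; rewrite -da' e_sym.
  exact: wX.
by rewrite -(subrK (c *: y) x) memvD // ?memvZ // (subvP sXY).
Qed.

Lemma elimination_supersolvable : supersolvable H.
Proof.
exists [seq X i | i <- iota 0 l.+1]; last first.
  move=> _ /mapP[i + ->]; rewrite mem_iota add0n ltnS => /andP[_ leil].
  exact: initial_flat_modular.
split=> [_ /mapP[i _ ->]|_ _ /mapP[i _ ->] /mapP[i' _ ->]|Y flY cmpY].
- by exists (initial_edges i).
- by case/orP: (leq_total i i') => /initial_flatS->; rewrite ?orbT.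
have X0 : (Y <= X 0)%VS.
  by apply/subv_bigcapP => j; rewrite inE ltn0.
have Xl : (X l <= Y)%VS.
  by case: flY => J ->; apply: flatS; apply/subsetP=> j _; rewrite inE !o_lt.
have inX i : (i <= l)%N -> X i \in [seq X i | i <- iota 0 l.+1].
  by move=> leil; apply/mapP; exists i; rewrite // mem_iota add0n ltnS.
have [YXl|nYXl] := boolP (Y <= X l)%VS.
  by rewrite (_ : Y = X l) ?inX //; apply/eqP; rewrite eqEsubv YXl.
have ex_i : exists i, ~~ (Y <= X i)%VS by exists l.
(* The least index whose flat does not contain [Y] places [Y] between two consecutive members, and
   [initial_flat_step] identifies it with the larger. *)
case: (ex_minnP ex_i) => -[|i] nYXi min_i; first by rewrite X0 in nYXi.
have lti : (i < l)%N by apply: min_i.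
have YXi : (Y <= X i)%VS by apply: contraT => /min_i; rewrite ltnn.
rewrite (_ : Y = X i) ?inX 1?ltnW //; apply: initial_flat_step => //.
by have := cmpY _ (inX _ lti); rewrite (negPf nYXi) orbF.
Qed.

End GraphicSupersolvable.

Lemma chordal_supersolvable (K : fieldType) (l : nat) (e : rel 'I_l) :
  symmetric e -> irreflexive e -> chordal e -> supersolvable (graphic_arrangement K e).
Proof.
move=> e_sym e_irr e_chordal.
have [o [o_inj o_lt o_elim]] := chordal_elimination e_sym e_irr e_chordal setT.
apply: (@elimination_supersolvable _ _ _ e_sym e_irr o).
- by move=> a b; apply: o_inj; rewrite inE.
- by move=> a; have := o_lt a; rewrite cardsT card_ord inE; apply.
by move=> u a b; apply: o_elim; rewrite inE.
Qed.

Theorem theorem6p4 (k : fieldType) (char0 : [pchar k] =i pred0)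
    (R : realType) (l : nat) (e : rel 'I_l)
    (e_sym : symmetric e) (e_irr : irreflexive e) :
  (supersolvable (graphic_arrangement R[i] e) <->
     os_koszul (graphic_arrangement R[i] e) k) /\
  (supersolvable (graphic_arrangement R[i] e) <->
     os_quadratic (graphic_arrangement R[i] e) k).
Proof.
have quad_ss : os_quadratic (graphic_arrangement R[i] e) k ->
    supersolvable (graphic_arrangement R[i] e).
  move=> /(quadratic_chordal e_sym e_irr).
  by move=> /(chordal_supersolvable _ e_sym e_irr); apply.
split; split=> [ss|h].
- exact: supersolvable_koszul.
- exact/quad_ss/koszul_quadratic.
- exact/koszul_quadratic/supersolvable_koszul.
exact: quad_ss.
Qed.
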